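(* Let $\Omega\subset\mathbb R^n$ be a bounded open set, $1<p<\infty$, and let $\theta:\overline\Omega\to\mathbb R$ be Lipschitz on $\overline\Omega$. Let $t_0\in\mathbb R$ and suppose that there exist $\delta_0>0$, constants $c_1,c_2>0$, and parameters $\alpha\in[0,1)$, $\nu\ge0$ such that \[ c_1(t-t_0)^{\alpha(p-1)+\nu}\le A_{p,\theta}(t)\le c_2(t-t_0)^{\alpha(p-1)+\nu} \] for almost every $t\in(t_0,t_0+\delta_0)$. If $\alpha+\frac{\nu}{p-1}\ge1$, then, for every $\delta\in(0,\delta_0)$, \[ \operatorname{cap}_{p,\theta}(t_0,t_0+\delta)=0. \] Consequently, whenever the sets $E_{t_0}$ and $F_{t_0+\delta}$ form an interior condenser in $\Omega$, \[ \operatorname{Cap}_{p,\Omega}(E_{t_0},F_{t_0+\delta})=0. \]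
   Context: For $s\in\mathbb R$ let $E_s=\{x\in\Omega:\theta(x)\le s\}$ and $F_s=\{x\in\Omega:\theta(x)\ge s\}$. A pair $(E,F)$ of subsets of $\Omega$ is an interior condenser in $\Omega$ if $\overline E\subset\Omega$, $\overline F\subset\Omega$ and $\overline E\cap\overline F=\varnothing$; then \[\operatorname{Cap}_{p,\Omega}(E,F)=\inf_{u\in\mathcal A_{E,F}(\Omega)}\int_\Omega|\nabla u|^p\,\mathrm{d}x,\qquad \mathcal A_{E,F}(\Omega)=\{u\in W^{1,p}(\Omega):u\le0\text{ q.e. on }E,\ u\ge1\text{ q.e. on }F\},\] where q.e. (quasi-everywhere) means outside a set of zero Sobolev $p$-capacity, for the quasicontinuous representative. For $t\in\mathbb R$ let $\Sigma_t=\{x\in\Omega:\theta(x)=t\}$. The energy weight is defined for almost every $t$ by \[A_{p,\theta}(t)=\int_{\Sigma_t\cap\Omega}|\nabla\theta|^{p-1}\,\mathrm{d}\mathcal H^{n-1},\] with $\nabla\theta$ the almost everywhere defined gradient (by the coarea formula it is defined $\mathcal H^{n-1}$-a.e. on $\Sigma_t$ for a.e. $t$). For $a<b$ and $v\in W^{1,1}(a,b)$ (absolutely continuous representative on $[a,b]$) set $\mathcal E_{p,\theta}(v;a,b)=\int_a^b|v'(t)|^pA_{p,\theta}(t)\,\mathrm{d}t\in[0,+\infty]$, and \[\operatorname{cap}_{p,\theta}(a,b)=\inf\{\mathcal E_{p,\theta}(v;a,b): v\in W^{1,1}(a,b),\ v(a)=0,\ v(b)=1,\ \mathcal E_{p,\theta}(v;a,b)<\infty\}.\]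 *)

(* Defs.v *)
From HB Require Import structures.
From mathcomp Require Import all_boot all_order all_algebra.
From mathcomp Require Import all_classical all_reals all_analysis.

Set Implicit Arguments.
Unset Strict Implicit.
Unset Printing Implicit Defensive.
Import Order.TTheory GRing.Theory Num.Theory.
Import numFieldNormedType.Exports.

Local Open Scope classical_set_scope.
Local Open Scope ring_scope.

(** R^n is 'rV[R]_n, with its library topology. The library norm on row vectors
    is the sup norm, so the Euclidean norm is introduced separately; the two are
    equivalent, so topology, boundedness and Lipschitz continuity are the
    library's. *)

Definition enorm (R : realType) (n : nat) (x : 'rV[R]_n) : R :=
  Num.sqrt (\sum_(i < n) x ord0 i ^+ 2).

(** Borel sets of R^n: the product sigma-algebra, as the library does for
    pairs and tuples. *)

Definition rV_display : measure_display.
Proof. exact: default_measure_display. Qed.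

Section measurable_rV.
Context (R : realType) (n : nat).

Definition coord_rV (i : 'I_n) (x : 'rV[R]_n) : measurableTypeR R := x ord0 i.

Let rV_set0 : g_sigma_preimage coord_rV set0.
Proof. exact: sigma_algebra0. Qed.

Let rV_setC A : g_sigma_preimage coord_rV A -> g_sigma_preimage coord_rV (~` A).
Proof. exact: sigma_algebraC. Qed.

Let rV_bigcup (F : (set 'rV[R]_n)^nat) :
  (forall i, g_sigma_preimage coord_rV (F i)) ->
  g_sigma_preimage coord_rV (\bigcup_i (F i)).
Proof. exact: sigma_algebra_bigcup. Qed.

HB.instance Definition _ := @isMeasurable.Build rV_display 'rV[R]_n
  (g_sigma_preimage coord_rV) rV_set0 rV_setC rV_bigcup.

End measurable_rV.

Lemma measurable_coord_rV (R : realType) (n : nat) (i : 'I_n) :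
  measurable_fun [set: 'rV[R]_n] (@coord_rV R n i).
Proof.
move=> _ Y mY; rewrite setTI; apply: sub_sigma_algebra => /=.
rewrite -bigcup_seq/=; exists i => /=; first by rewrite mem_index_enum.
by exists Y => //; rewrite setTI.
Qed.

Lemma measurable_fun_rVP d (T : measurableType d) (R : realType) (n : nat)
    (f : T -> 'rV[R]_n) :
  (forall i, measurable_fun [set: T] (fun t => coord_rV i (f t))) ->
  measurable_fun [set: T] f.
Proof.
move=> mf.
have preS : g_sigma_preimage (fun i => @coord_rV R n i \o f) `<=` measurable.
  apply: smallest_sub; first exact: sigma_algebra_measurable.
  rewrite -bigcup_seq => A [i _] [B mB <-].
  exact: mf.
rewrite g_sigma_preimage_comp in preS.
by move=> _ A mA; apply: preS; exists A.
Qed.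

(** Lebesgue measure on R^n, by recursion on n: slice along the first coordinate
    (R^0 is a point of mass 1). *)

Definition cons_rV (R : realType) (n : nat) (z : measurableTypeR R * 'rV[R]_n) :
    'rV[R]_n.+1 :=
  \row_(i < n.+1) if unlift ord0 i is Some j then z.2 ord0 j else z.1.

Definition uncons_rV (R : realType) (n : nat) (x : 'rV[R]_n.+1) :
    measurableTypeR R * 'rV[R]_n :=
  (x ord0 ord0, \row_(j < n) x ord0 (lift ord0 j)).

Fixpoint lebesgue_rV (R : realType) (n : nat) : set 'rV[R]_n -> \bar R :=
  match n return set 'rV[R]_n -> \bar R with
  | 0%N => \d_(0 : 'rV[R]_0)
  | m.+1 => fun A =>
      (\int[@lebesgue_measure R]_x lebesgue_rV (fun y : 'rV[R]_m => A (cons_rV (x, y))))%E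
  end.
Arguments lebesgue_rV {R n} A : simpl never.

Lemma uncons_rVK (R : realType) (n : nat) (x : 'rV[R]_n.+1) :
  cons_rV (uncons_rV x) = x.
Proof.
apply/rowP => i; rewrite !mxE.
by case: unliftP => [j ->|->]; rewrite ?mxE.
Qed.

Lemma cons_rVK (R : realType) (n : nat) (z : measurableTypeR R * 'rV[R]_n) :
  uncons_rV (cons_rV z) = z.
Proof.
case: z => x y; rewrite /uncons_rV !mxE unlift_none/=; congr pair.
by apply/rowP => i; rewrite !mxE liftK.
Qed.

Lemma measurable_cons_rV (R : realType) (n : nat) :
  measurable_fun [set: measurableTypeR R * 'rV[R]_n] (@cons_rV R n).
Proof.
apply: measurable_fun_rVP => i; rewrite /coord_rV.
case: (unliftP ord0 i) => [j ->|->].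
  under eq_fun do rewrite mxE liftK.
  apply: (measurableT_comp (measurable_coord_rV j)).
  exact: measurable_snd.
under eq_fun do rewrite mxE unlift_none.
exact: measurable_fst.
Qed.

Lemma measurable_uncons_rV (R : realType) (n : nat) :
  measurable_fun [set: 'rV[R]_n.+1] (@uncons_rV R n).
Proof.
apply/measurable_fun_pairP; split.
  exact: (measurable_coord_rV ord0).
apply: measurable_fun_rVP => i; rewrite /coord_rV/=.
under eq_fun do rewrite mxE.
exact: (measurable_coord_rV (lift ord0 i)).
Qed.

Section lebesgue_rV_step.
Local Open Scope ereal_scope.
Context (R : realType) (n : nat) (m : {sigma_finite_measure set 'rV[R]_n -> \bar R}).

Definition lebesgue_rV_push (A : set 'rV[R]_n.+1) : \bar R :=
  (@lebesgue_measure R \x m) (@cons_rV R n @^-1` A).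

Local Notation push := lebesgue_rV_push.
Let pushE A : push A = (@lebesgue_measure R \x m) (@cons_rV R n @^-1` A).
Proof. by []. Qed.

Let push0 : push set0 = 0.
Proof. by rewrite pushE preimage_set0 measure0. Qed.

Let push_ge0 A : 0 <= push A.
Proof. by rewrite pushE; exact: measure_ge0. Qed.

Let push_sigma_additive : semi_sigma_additive push.
Proof.
have mf := @measurable_cons_rV R n.
move=> F mF tF mUF; rewrite pushE preimage_bigcup.
under eq_fun do under eq_bigr do rewrite pushE.
apply: measure_semi_sigma_additive.
- by move=> k; rewrite -[X in measurable X]setTI; exact: mf.
- apply/trivIsetP => /= i j _ _ ij; rewrite -preimage_setI.
  by move/trivIsetP : tF => /(_ _ _ _ _ ij) ->//; rewrite preimage_set0.
- by rewrite -preimage_bigcup -[X in measurable X]setTI; exact: mf.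
Qed.

HB.instance Definition _ := isMeasure.Build _ _ _ push
  push0 push_ge0 push_sigma_additive.

Let push_sigma_finite : sigma_finite setT push.
Proof.
have /sigma_finiteP[F [TF ndF Foo]] := sigma_finiteT (@lebesgue_measure R).
have /sigma_finiteP[G [TG ndG Goo]] := sigma_finiteT m.
exists (fun k => @uncons_rV R n @^-1` (F k `*` G k)).
  rewrite -preimage_bigcup (_ : \bigcup_k _ = setT) ?preimage_setT//.
  apply/seteqP; split => // -[x y] _.
  have [k _ Fkx] : (\bigcup_k F k) x by rewrite -TF.
  have [l _ Gly] : (\bigcup_k G k) y by rewrite -TG.
  exists (maxn k l) => //; split.
    by move: x Fkx; exact/subsetPset/ndF/leq_maxl.
  by move: y Gly; exact/subsetPset/ndG/leq_maxr.
move=> k; have [[mF Fk] [mG Gk]] := (Foo k, Goo k); split.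
  rewrite -[X in measurable X]setTI; apply: (@measurable_uncons_rV R n) => //.
  exact: measurableX.
rewrite pushE -comp_preimage (_ : _ \o _ = id); last first.
  by apply/funext => z /=; rewrite cons_rVK.
by rewrite preimage_id product_measure1E// lte_mul_pinfty// ge0_fin_numE.
Qed.

HB.instance Definition _ := Measure_isSigmaFinite.Build _ _ _ push push_sigma_finite.

Lemma lebesgue_rV_step :
  {m' : {sigma_finite_measure set 'rV[R]_n.+1 -> \bar R} | forall A,
    m' A = \int[@lebesgue_measure R]_x m (fun y => A (cons_rV (x, y)))}.
Proof.
exists push => A; rewrite /= /push /product_measure1.
apply: eq_integral => x _ /=; congr (m _); apply/seteqP.
by split => y /=; rewrite /xsection/= inE.
Qed.

End lebesgue_rV_step.

Lemma lebesgue_rV_measure (R : realType) (n : nat) :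
  {m : {sigma_finite_measure set 'rV[R]_n -> \bar R} | forall A, m A = lebesgue_rV A}.
Proof.
elim: n => [|n [m mE]]; first by exists \d_(0 : 'rV[R]_0).
have [m' m'E] := lebesgue_rV_step m; exists m' => A.
by rewrite m'E; apply: eq_integral => x _; exact: mE.
Qed.

Section lebesgue_rV_instance.
Local Open Scope ereal_scope.
Context (R : realType) (n : nat).

Let leb0 : @lebesgue_rV R n set0 = 0.
Proof. by have [m <-] := lebesgue_rV_measure R n; exact: measure0. Qed.

Let leb_ge0 A : 0 <= @lebesgue_rV R n A.
Proof. by have [m <-] := lebesgue_rV_measure R n; exact: measure_ge0. Qed.

Let leb_sigma_additive : semi_sigma_additive (@lebesgue_rV R n).
Proof.
have [m /funext <-] := lebesgue_rV_measure R n.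
exact: measure_semi_sigma_additive.
Qed.

HB.instance Definition _ := isMeasure.Build _ _ _ (@lebesgue_rV R n)
  leb0 leb_ge0 leb_sigma_additive.

Let leb_sigma_finite : sigma_finite setT (@lebesgue_rV R n).
Proof.
have [m /funext <-] := lebesgue_rV_measure R n.
exact: sigma_finiteT.
Qed.

HB.instance Definition _ := Measure_isSigmaFinite.Build _ _ _ (@lebesgue_rV R n)
  leb_sigma_finite.

End lebesgue_rV_instance.

(** Hausdorff measure of integer order m, for the Euclidean metric and with the
    normalization making it agree with Lebesgue measure on R^m. The diameter of
    the empty set is -oo, whence the separate case in [hausdorff_size]; in order
    0 this yields the counting measure. *)

Section hausdorff.
Local Open Scope ereal_scope.
Context (R : realType) (n m : nat).

Definition ediam (A : set 'rV[R]_n) : \bar R :=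
  ereal_sup [set (enorm (xy.1 - xy.2))%:E | xy in A `*` A].

Definition hausdorff_size (A : set 'rV[R]_n) : \bar R :=
  if A == set0 then 0
  else lebesgue_rV [set z : 'rV[R]_m | (enorm z <= 1)%R]
       * (2^-1%:E * ediam A) ^+ m.

Definition hausdorff_cover (d : R) (A : set 'rV[R]_n) : set ((set 'rV[R]_n)^nat) :=
  [set C | A `<=` \bigcup_k C k /\ forall k, ediam (C k) <= d%:E].

Definition hausdorff_pre (d : R) (A : set 'rV[R]_n) : \bar R :=
  ereal_inf [set \sum_(0 <= k <oo) hausdorff_size (C k) | C in hausdorff_cover d A].

Definition hausdorff (A : set 'rV[R]_n) : \bar R :=
  ereal_sup [set hausdorff_pre d A | d in [set d | (0 < d)%R]].

Lemma enorm_ge0 k (x : 'rV[R]_k) : (0 <= enorm x)%R.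
Proof. exact: sqrtr_ge0. Qed.

Lemma ediam0 : ediam set0 = -oo.
Proof. by rewrite /ediam setX0 image_set0 ereal_sup0. Qed.

Lemma hausdorff_size0 : hausdorff_size set0 = 0.
Proof. by rewrite /hausdorff_size eqxx. Qed.

Lemma hausdorff_size_ge0 A : 0 <= hausdorff_size A.
Proof.
rewrite /hausdorff_size; case: ifPn => // /set0P[x Ax].
apply: mule_ge0; first exact: measure_ge0.
apply: expe_ge0; apply: mule_ge0; first by rewrite lee_fin.
apply: (@le_trans _ _ (enorm (x - x))%:E); first by rewrite lee_fin enorm_ge0.
by apply: ereal_sup_ubound; exists (x, x).
Qed.

Lemma hausdorff_pre_ge0 d A : 0 <= hausdorff_pre d A.
Proof.
apply: le_ereal_inf_tmp => _ [C _ <-].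
by apply: nneseries_ge0 => k _ _; exact: hausdorff_size_ge0.
Qed.

Lemma hausdorff_pre0 d : hausdorff_pre d set0 = 0.
Proof.
apply/eqP; rewrite eq_le hausdorff_pre_ge0 andbT.
apply: ereal_inf_lbound; exists (fun=> set0).
  by split=> [//|k]; rewrite ediam0 leNye.
by apply: eseries0 => k _ _; exact: hausdorff_size0.
Qed.

Lemma le_hausdorff_pre d : {homo hausdorff_pre d : A B / A `<=` B >-> A <= B}.
Proof.
move=> A B AB; apply: ereal_inf_le_tmp => _ [C [BC Cd] <-]; exists C => //.
by split=> //; exact: subset_trans BC.
Qed.

Lemma hausdorff_pre_sigma_subadditive d : sigma_subadditive (hausdorff_pre d).
Proof.
move=> A; have [[i ioo]|] := pselect (exists i, hausdorff_pre d (A i) = +oo).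
  rewrite (eseries_pinfty _ _ ioo) ?leey// => k _.
  by rewrite -ltNye (lt_le_trans _ (hausdorff_pre_ge0 _ _)).
rewrite -forallNE => Aoo.
suff add2e (e : {posnum R}) : hausdorff_pre d (\bigcup_n A n) <=
    \sum_(i <oo) hausdorff_pre d (A i) + e%:num%:E.
  by apply/lee_addgt0Pr => _/posnumP[].
rewrite (le_trans _ (epsilon_trick _ _ _))//; last first.
  by move=> k; exact: hausdorff_pre_ge0.
have [G PG] : {G : ((set 'rV[R]_n)^nat)^nat & forall k, hausdorff_cover d (A k) (G k) /\
    \sum_(l <oo) hausdorff_size (G k l) <=
    hausdorff_pre d (A k) + (e%:num / (2 ^ k.+1)%:R)%:E}.
  apply: (@choice _ _ (fun k B => hausdorff_cover d (A k) B /\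
    \sum_(l <oo) hausdorff_size (B l) <=
    hausdorff_pre d (A k) + (e%:num / (2 ^ k.+1)%:R)%:E)) => k.
  have fink : hausdorff_pre d (A k) \is a fin_num.
    rewrite ge0_fin_numE ?hausdorff_pre_ge0// ltey; exact/eqP/Aoo.
  have ek : (0 < e%:num / (2 ^ k.+1)%:R)%R by [].
  have [_ [B BA <-] lt] := lb_ereal_inf_adherent ek fink.
  by exists B; split => //; exact/ltW.
have sG_ge0 x : 0 <= (hausdorff_size \o uncurry G) x by exact: hausdorff_size_ge0.
apply: (@le_trans _ _ (\esum_(i in setT) (hausdorff_size \o uncurry G) i)).
  apply: ereal_inf_lbound => /=.
  have /card_esym/ppcard_eqP[f] := card_nat2.
  exists (uncurry G \o f).
    split => [|i]; last by rewrite /= /uncurry; case: (f i) => a b; exact: (PG a).1.2.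
    move=> t [i _ /(PG i).1.1[j _ Gt]]; exists (f^-1%FUN (i, j)) => //=.
    by rewrite invK ?inE.
  rewrite -(esum_pred_image (hausdorff_size \o uncurry G) _ xpredT) ?[fun=> _]set_true//.
  by rewrite image_eq.
rewrite (_ : esum _ _ = \sum_(i <oo) \sum_(j <oo) hausdorff_size (G i j)).
  apply: lee_nneseries => k _ *; last exact: (PG k).2.
  by apply: nneseries_ge0 => *; exact: hausdorff_size_ge0.
pose J : nat -> set (nat * nat) := fun i => [set (i, j) | j in setT].
rewrite (_ : setT = \bigcup_k J k); last first.
  by rewrite predeqE => -[a b]; split => // _; exists a => //; exists b.
rewrite esum_bigcupT /=; last 2 first.
- apply/trivIsetP => i j _ _ ij.
  rewrite predeqE => -[k l] /=; split => //= -[] [_] _ [<-{k} _].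
  by move=> [l' _] [] /esym/eqP; rewrite (negbTE ij).
- by move=> /= [k l]; exact: hausdorff_size_ge0.
rewrite -(image_id [set: nat]) -fun_true esum_pred_image//; last first.
  by move=> k _; apply: esum_ge0 => *; exact: sG_ge0.
apply: eq_eseriesr => /= j _.
rewrite -(esum_pred_image (hausdorff_size \o uncurry G) (pair j) predT)//=; last first.
  by move=> ? ? _ _; exact: (@can_inj _ _ _ snd).
  by move=> k _; exact: hausdorff_size_ge0.
by congr esum; rewrite predeqE => -[a b]; split; move=> [i _ <-]; exists i.
Qed.

Lemma hausdorff_pre_le d A : (0 < d)%R -> hausdorff_pre d A <= hausdorff A.
Proof. by move=> d0; apply: ereal_sup_ubound; exists d. Qed.

Let hausdorff_ge0 A : 0 <= hausdorff A.
Proof. by apply: (le_trans (hausdorff_pre_ge0 1 A)); exact: hausdorff_pre_le. Qed.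

Let hausdorff0 : hausdorff set0 = 0.
Proof.
apply/eqP; rewrite eq_le hausdorff_ge0 andbT.
by apply: ge_ereal_sup => _ [d _ <-]; rewrite hausdorff_pre0.
Qed.

Let le_hausdorff : {homo hausdorff : A B / A `<=` B >-> A <= B}.
Proof.
move=> A B AB; apply: ge_ereal_sup => _ [d d0 <-].
by apply: (le_trans (@le_hausdorff_pre d _ _ AB)); exact: hausdorff_pre_le.
Qed.

Let hausdorff_sigma_subadditive : sigma_subadditive hausdorff.
Proof.
move=> F; apply: ge_ereal_sup => _ [d d0 <-].
apply: le_trans (hausdorff_pre_sigma_subadditive _ _) _.
apply: lee_nneseries => k _ *; first exact: hausdorff_pre_ge0.
exact: hausdorff_pre_le.
Qed.

HB.instance Definition _ := isOuterMeasure.Build R 'rV[R]_n hausdorff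
  hausdorff0 hausdorff_ge0 le_hausdorff hausdorff_sigma_subadditive.

Definition hausdorff_outer : {outer_measure set 'rV[R]_n -> \bar R} := hausdorff.

Definition hausdorff_measure :
  {measure set (caratheodory_type hausdorff_outer) -> \bar R} := hausdorff_outer.

End hausdorff.

Section sobolev.
Context (R : realType) (n : nat).
Local Notation E := 'rV[R]_n.

Definition partial (i : 'I_n) (f : E -> R) (x : E) : R :=
  'D_(delta_mx ord0 i) f x.

Definition gradient (f : E -> R) (x : E) : E := \row_(i < n) partial i f x.

Fixpoint class_C (k : nat) (f : E -> R) : Prop :=
  match k with
  | 0%N => continuous f
  | l.+1 => [/\ continuous f,
                forall i x, derivable f x (delta_mx ord0 i) &
                forall i, class_C l (partial i f)]
  end.

Definition test_function (Omega : set E) (phi : E -> R) : Prop :=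
  [/\ forall k, class_C k phi,
      compact (closure [set x | phi x != 0]) &
      closure [set x | phi x != 0] `<=` Omega].

(** Every Lebesgue class has a Borel representative, so functions in L^p are
    taken Borel measurable. *)
Definition Lp_on (p : R) (Omega : set E) (f : E -> R) : Prop :=
  measurable_fun Omega f /\
  (\int[@lebesgue_rV R n]_(x in Omega) (`|f x| `^ p)%:E < +oo)%E.

Definition weak_gradient (Omega : set E) (u : E -> R) (g : E -> E) : Prop :=
  forall (phi : E -> R), test_function Omega phi -> forall i : 'I_n,
    \int[@lebesgue_rV R n]_(x in Omega) (u x * partial i phi x) =
    - \int[@lebesgue_rV R n]_(x in Omega) (g x ord0 i * phi x).

(** u is in W^{1,p}(Omega) and g is (a representative of) its weak gradient. *)
Definition sobolev (p : R) (Omega : set E) (u : E -> R) (g : E -> E) : Prop :=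
  [/\ Lp_on p Omega u,
      forall i, Lp_on p Omega (fun x => g x ord0 i) &
      weak_gradient Omega u g].

Definition dirichlet_energy (p : R) (Omega : set E) (g : E -> E) : \bar R :=
  (\int[@lebesgue_rV R n]_(x in Omega) (enorm (g x) `^ p)%:E)%E.

(** Sobolev p-capacity, by test functions at least 1 near A. *)
Definition sobolev_capacity (p : R) (A : set E) : \bar R :=
  ereal_inf [set (\int[@lebesgue_rV R n]_x
                    (`|ug.1 x| `^ p + enorm (ug.2 x) `^ p)%:E)%E | ug in
    [set ug : (E -> R) * (E -> E) | sobolev p setT ug.1 ug.2 /\
      exists O : set E, [/\ open O, A `<=` O &
        {ae @lebesgue_rV R n, forall x, O x -> 1 <= ug.1 x}]]].

Definition quasi_everywhere (p : R) (A : set E) (P : E -> Prop) : Prop :=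
  sobolev_capacity p [set x | A x /\ ~ P x] = 0%E.

Definition quasicontinuous (p : R) (Omega : set E) (u : E -> R) : Prop :=
  forall e : R, 0 < e -> exists G : set E,
    [/\ open G, (sobolev_capacity p G < e%:E)%E &
        {within Omega `\` G, continuous u}].

Definition interior_condenser (Omega A B : set E) : Prop :=
  [/\ A `<=` Omega /\ B `<=` Omega, closure A `<=` Omega, closure B `<=` Omega &
      closure A `&` closure B = set0].

(** The inequalities q.e. bear on the quasicontinuous representative w of u. *)
Definition condenser_admissible (p : R) (Omega A B : set E)
    (u : E -> R) (g : E -> E) : Prop :=
  sobolev p Omega u g /\
  exists w : E -> R,
    [/\ quasicontinuous p Omega w,
        {ae @lebesgue_rV R n, forall x, Omega x -> w x = u x},
        quasi_everywhere p A (fun x => w x <= 0) &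
        quasi_everywhere p B (fun x => 1 <= w x)].

Definition condenser_capacity (p : R) (Omega A B : set E) : \bar R :=
  ereal_inf [set dirichlet_energy p Omega ug.2 | ug in
    [set ug : (E -> R) * (E -> E) | condenser_admissible p Omega A B ug.1 ug.2]].

(** theta is a total function, but only its values on Omega matter here. *)

Definition sublevel (Omega : set E) (theta : E -> R) (s : R) : set E :=
  [set x | Omega x /\ theta x <= s].

Definition superlevel (Omega : set E) (theta : E -> R) (s : R) : set E :=
  [set x | Omega x /\ s <= theta x].

Definition level (Omega : set E) (theta : E -> R) (t : R) : set E :=
  [set x | Omega x /\ theta x = t].

(** The integral is against H^{n-1} as a measure on its Caratheodory
    sigma-algebra. At points where theta is not differentiable, [gradient] has
    an arbitrary value: for Lipschitz theta these points are H^{n-1}-negligible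
    on almost every level set. *)
Definition energy_weight (p : R) (Omega : set E) (theta : E -> R) (t : R) : \bar R :=
  (\int[@hausdorff_measure R n n.-1]_(x in level Omega theta t)
      (enorm (gradient theta x) `^ (p - 1))%:E)%E.

End sobolev.

Section weighted_capacity.
Context (R : realType).

Definition test_function_itv (a b : R) (phi : R -> R) : Prop :=
  [/\ forall k t, derivable (derive1n k phi) t 1,
      compact (closure [set t | phi t != 0]) &
      closure [set t | phi t != 0] `<=` `]a, b[].

(** v is in W^{1,1}(a,b) and w is (a representative of) its weak derivative. *)
Definition sobolev11 (a b : R) (v w : R -> R) : Prop :=
  [/\ (@lebesgue_measure R).-integrable `]a, b[ (EFin \o v),
      (@lebesgue_measure R).-integrable `]a, b[ (EFin \o w) &
      forall phi, test_function_itv a b phi ->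
        \int[@lebesgue_measure R]_(t in `]a, b[) (v t * derive1 phi t) =
        - \int[@lebesgue_measure R]_(t in `]a, b[) (w t * phi t)].

Definition absolutely_continuous (a b : R) (v : R -> R) : Prop :=
  forall e : R, 0 < e -> exists2 d : R, 0 < d &
    forall s : seq (R * R),
      (forall I, I \in s -> a <= I.1 <= I.2 /\ I.2 <= b) ->
      pairwise (fun I J => (I.2 <= J.1) || (J.2 <= I.1)) s ->
      \sum_(I <- s) (I.2 - I.1) < d ->
      \sum_(I <- s) `|v I.2 - v I.1| < e.

(** The library convention 0 * +oo = 0 applies where w vanishes. *)
Definition weighted_energy (p : R) (A : R -> \bar R) (a b : R) (w : R -> R) : \bar R :=
  (\int[@lebesgue_measure R]_(t in `]a, b[) ((`|w t| `^ p)%:E * A t))%E.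

Definition weighted_capacity (p : R) (A : R -> \bar R) (a b : R) : \bar R :=
  ereal_inf [set weighted_energy p A a b vw.2 | vw in
    [set vw : (R -> R) * (R -> R) |
      [/\ sobolev11 a b vw.1 vw.2, absolutely_continuous a b vw.1,
          vw.1 a = 0 /\ vw.1 b = 1 &
          (weighted_energy p A a b vw.2 < +oo)%E]]].

End weighted_capacity.

(* Main.v *)
Require Import Defs.
From HB Require Import structures.
From mathcomp Require Import all_boot all_order all_algebra.
From mathcomp Require Import all_classical all_reals all_analysis.
From mathcomp Require Import measurable_realfun ring lra zify.
Import Order.TTheory GRing.Theory Num.Theory.
Import numFieldNormedType.Exports.
Local Open Scope classical_set_scope.
Local Open Scope ring_scope.

Set Implicit Arguments.
Unset Strict Implicit.
Unset Printing Implicit Defensive.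

(** With [g = alpha (p - 1) + nu], the criticality assumption reads [g >= p - 1].
    The logarithmic profile
      [v t = ln (max (d 2^-N) (min (t - t0) d) / (d 2^-N)) / (N ln 2)], [d = delta / 2],
    climbs from 0 to 1 and satisfies [|v'| <= (a N ln 2)^-1] where [t - t0 >= a].
    On each of the [N] dyadic shells [a < t - t0 < 8 a] its weighted energy is
    at most a constant times [a^-p a^g a (N ln 2)^-p], that is of order [N^-p],
    so the total is of order [N^(1-p)] and tends to 0.

    For the condenser, the competitor is [v \o theta], with [theta] extended to
    a Lipschitz function on the whole space. The full coarea formula is not
    needed, only an upper bound, up to a constant, of
    [\int |D_i theta| |grad theta|^(p-1)] over a shell by the integral in [t] of
    the energy weights. Up to a set where the integrand vanishes, a shell is a
    countable disjoint union of sets on which, for some [q > 0], [|D_i theta|] is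
    at most [2 q], [|grad theta|^(p-1)] is constant up to a factor 2, and [theta]
    expands lengths by at least [q] on the lines parallel to the i-th axis. On
    such a set replacing the i-th coordinate of x by [theta x] expands volume by at
    least [q], and the slices of the image are projections of pieces of level
    sets, whose volume is controlled by their Hausdorff measure. *)

(** * Lipschitz functions on the line *)

(** Measurability shapes the coarea bound. No measurability in [t] of the level integral is
    available, so it is compared pointwise with a measurable [K] whose integral dominates the one
    over space. Images of Borel sets need not be Borel, so the change of coordinate is done on
    compact subsets supplied by inner regularity. Level sets are integrated over on a Caratheodory
    sigma-algebra, which must be shown to contain the Borel sets before the contributions of the
    pieces can be added.

    The chain rule is avoided for [v \o theta]: the profile has corners, and a derivative takes the
    default value 0 where its quotients diverge, so difference quotients are compared directly.
    Differentiability is needed along the axes only; like integration by parts, it is proved on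
    lines and carried to the space by Fubini.

    Halving [delta] leaves room for overlapping shells: the largest one ends at [2 d = delta], still
    inside the range of the weight bound. *)

Definition lip (R : realType) (V : normedModType R) (L : R) (f : V -> R) :=
  forall x y, `|f x - f y| <= L * `|x - y|.

Lemma lip_continuous (R : realType) (V : normedModType R) (L : R) (f : V -> R) :
  lip L f -> continuous f.
Proof.
move=> fL x; apply/cvgrPdist_le => e e0.
near=> y.
rewrite (le_trans (fL _ _))//.
have L1 : 0 < `|L| + 1 by rewrite ltr_wpDl.
apply: (@le_trans _ _ ((`|L| + 1) * `|x - y|)).
  by rewrite ler_wpM2r// (le_trans (ler_norm L))// lerDl.
rewrite -ler_pdivlMl// mulrC.
near: y.
apply: cvgr_dist_le => //.
by rewrite divr_gt0.
Unshelve. all: by end_near. Qed.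

Lemma near_dnbhs0P (R : realType) (P : R -> Prop) :
  (\forall h \near 0^', P h) <->
  exists2 e : R, 0 < e & forall h, 0 < `|h| < e -> P h.
Proof.
rewrite near_withinE; split.
  move=> /nbhs_ballP[e /= e0 He]; exists e => // h /andP[h0 he].
  by apply: He; rewrite -?normr_gt0 //= /ball/= sub0r normrN.
move=> [e e0 He]; apply/nbhs_ballP; exists e => //= h.
by rewrite /ball/= sub0r normrN => he; rewrite -normr_gt0 => h0; apply: He; rewrite h0.
Qed.

(** * Measurability of limits of difference quotients *)

Section measurable_lim.
Context d (T : measurableType d) (R : realType) (q : R -> T -> R).
Hypothesis mq : forall h, measurable_fun setT (q h).
Hypothesis mC : forall e k : R, 0 < e -> measurable [set x | forall r s,
  0 < `|r| < e -> 0 < `|s| < e -> `|q r x - q s x| <= k].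

Let CC (m k : nat) := [set x | forall r s : R, 0 < `|r| < m.+1%:R^-1 ->
  0 < `|s| < m.+1%:R^-1 -> `|q r x - q s x| <= k.+1%:R^-1].

(** The Cauchy criterion with tolerances and radii of the form [1 / (k + 1)] turns convergence into
    countable set operations. The uncountable quantification over [r] and [s] stays inside [CC]; for
    quotients of continuous functions such a set is closed. *)
Lemma cvg_dnbhs0_cauchyE : [set x | cvg (q h x @[h --> 0^'])] =
  \bigcap_k \bigcup_m CC m k.
Proof.
apply/seteqP; split => x /=.
  move=> cx k _.
  have /cvgrPdist_le/(_ (k.+1%:R^-1 / 2)) : q h x @[h --> 0^'] --> lim (q h x @[h --> 0^']) by exact: cx.
  rewrite divr_gt0 ?invr_gt0// => /(_ isT) /near_dnbhs0P [e e0 He].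
  have [m _ me] : exists2 m, True & m.+1%:R^-1 < e.
    near \oo => m; exists m => //; near: m; exact: near_infty_natSinv_lt (PosNum e0).
  exists m => // r s /andP[r0 rm] /andP[s0 sm].
  have Hr : `|lim (q h x @[h --> 0^']) - q r x| <= k.+1%:R^-1 / 2.
    by apply: He; rewrite r0 (lt_trans rm).
  have Hs : `|lim (q h x @[h --> 0^']) - q s x| <= k.+1%:R^-1 / 2.
    by apply: He; rewrite s0 (lt_trans sm).
  rewrite (le_trans (ler_distD (lim (q h x @[h --> 0^'])) _ _))//.
  by rewrite [leRHS]splitr lerD// distrC.
move=> Hx; apply: cauchy_cvg; apply/cauchy_ballP => e e0.
have [k _ ke] : exists2 k, True & k.+1%:R^-1 < e.
  near \oo => m; exists m => //; near: m; exact: near_infty_natSinv_lt (PosNum e0).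
have [m _ Hm] := Hx k I.
have m0 : 0 < m.+1%:R^-1 :> R by rewrite invr_gt0.
have nm : \forall h \near 0^', 0 < `|h : R| < m.+1%:R^-1.
  by apply/near_dnbhs0P; exists (m.+1%:R^-1).
exists ([set q h x | h in [set h | 0 < `|h| < m.+1%:R^-1]],
        [set q h x | h in [set h | 0 < `|h| < m.+1%:R^-1]]) => /=.
  split; (apply: filterS nm => h Hh; exists h => //).
move=> [_ _] /= [[r Hr <-] [s Hs <-]].
by rewrite /ball/= (le_lt_trans (Hm _ _ Hr Hs)).
Unshelve. all: by end_near. Qed.

Lemma measurable_cvg_dnbhs0 : measurable [set x | cvg (q h x @[h --> 0^'])].
Proof.
rewrite cvg_dnbhs0_cauchyE; apply: bigcap_measurable => // k _.
by apply: bigcup_measurable => // m _; apply: mC; rewrite invr_gt0.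
Qed.

(** On the measurable set of convergence the limit is the sequential one along [1 / (n + 1)];
    elsewhere [lim] is the constant default value. *)
Lemma measurable_lim_dnbhs0 :
  measurable_fun setT (fun x => lim (q h x @[h --> 0^'])).
Proof.
have mS := measurable_cvg_dnbhs0.
rewrite -(setUv [set x | cvg (q h x @[h --> 0^'])]).
apply/measurable_funU => //; [exact: measurableC|split].
- apply: (@measurable_fun_cvg _ _ _ _ (fun n => q n.+1%:R^-1)) => //.
    by move=> n; apply: measurable_funTS.
  move=> x /= cx.
  have := cx; rewrite -/(cvg_to _ _) => {}cx.
  have : (n.+1%:R^-1 : R) @[n --> \oo] --> 0^'.
    move=> A /near_dnbhs0P [e /= e0 HA].
    suff : \forall n \near \oo, A n.+1%:R^-1 by [].
    near=> n; apply: HA; have n0 : 0 < n.+1%:R^-1 :> R by rewrite invr_gt0.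
    rewrite gtr0_norm// n0/=.
    near: n; exact: near_infty_natSinv_lt (PosNum e0).
  move=> h0.
  exact: (cvg_comp _ _ h0 cx).
- apply: (eq_measurable_fun (cst point)); last exact: measurable_cst.
  by move=> x; rewrite inE /= => ncx; rewrite /= dvgP.
Unshelve. all: by end_near. Qed.

End measurable_lim.

Lemma continuous_increment (R : realType) (V : normedModType R) (f : V -> R) (w : V) :
  continuous f -> continuous (fun x => `|f (w + x) - f x|).
Proof.
move=> cf x; apply: (@continuous_comp _ _ _ (fun x => f (w + x) - f x) Num.norm); last exact: norm_continuous.
apply: cvgB; last exact: cf.
apply: (@continuous_comp _ _ _ (fun x => w + x) f x); last exact: cf.
by apply: cvgD; [exact: cvg_cst|exact: cvg_id].
Qed.

Section difference_quotient.
Context (R : realType) (V : normedModType R) (f : V -> R) (v : V).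
Hypothesis cf : continuous f.

Definition dquot (h : R) (x : V) : R := h^-1 * (f (h *: v + x) - f x).

Lemma continuous_dquot h : continuous (dquot h).
Proof.
move=> x; rewrite /dquot; apply: cvgM; first exact: cvg_cst.
apply: cvgB; last exact: cf.
apply: (@continuous_comp _ _ _ (fun x => h *: v + x) f x); last exact: cf.
by apply: cvgD; [exact: cvg_cst|exact: cvg_id].
Qed.

Lemma closed_dquot_cauchy (e k : R) : closed [set x | forall r s : R,
  0 < `|r| < e -> 0 < `|s| < e -> `|dquot r x - dquot s x| <= k].
Proof.
rewrite (_ : mkset _ = \bigcap_(rs in [set rs : R * R |
   0 < `|rs.1| < e /\ 0 < `|rs.2| < e])
   (fun x => `|dquot rs.1 x - dquot rs.2 x|) @^-1` [set y | y <= k]); last first.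
  apply/seteqP; split => x /= H; first by move=> [r s] /= []; exact: H.
  by move=> r s hr hs; exact: (H (r, s)).
apply: closed_bigI => -[r s] _.
have /continuous_closedP : continuous (fun x => `|dquot r x - dquot s x|); last first.
  by move=> /(_ _ (@closed_le _ k)).
move=> x; apply: (@continuous_comp _ _ _ (fun x => dquot r x - dquot s x) Num.norm).
  by apply: cvgB; exact: continuous_dquot.
exact: norm_continuous.
Qed.

Lemma derivable_dquotE x : derivable f x v = cvg (dquot h x @[h --> 0^']).
Proof. by []. Qed.

Lemma derive_dquotE x : 'D_v f x = lim (dquot h x @[h --> 0^']).
Proof. by []. Qed.

End difference_quotient.

Lemma lip_dquot_le (R : realType) (V : normedModType R) L (f : V -> R) v h x :
  0 <= L -> lip L f -> h != 0 -> `|dquot f v h x| <= L * `|v|.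
Proof.
move=> L0 fL h0; rewrite /dquot normrM normfV ler_pdivrMl ?normr_gt0//.
by rewrite (le_trans (fL _ _))// addrK normrZ mulrCA.
Qed.

(** No derivability is assumed: where the quotients diverge, the derivative is the default value
    0. *)
Lemma lip_derive_le (R : realType) (V : normedModType R) L (f : V -> R) v x :
  0 <= L -> lip L f -> `|'D_v f x| <= L * `|v|.
Proof.
move=> L0 fL; rewrite derive_dquotE.
have [c|nc] := pselect (cvg (dquot f v h x @[h --> 0^'])); last first.
  by rewrite dvgP// normr0 mulr_ge0.
have near_le : \forall h \near 0^', `|dquot f v h x| <= L * `|v|.
  by apply/near_dnbhs0P; exists 1 => // h /andP[h0 _]; apply: lip_dquot_le; rewrite -?normr_gt0.
rewrite ler_norml; apply/andP; split.
  by apply: limr_ge => //; apply: filterS near_le => h; rewrite ler_norml => /andP[].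
by apply: limr_le => //; apply: filterS near_le => h; rewrite ler_norml => /andP[].
Qed.

Section lipschitz_derivative.
Context (R : realType).
Local Notation mu := (@lebesgue_measure R).

Lemma measurable_fun_derive1 (f : R -> R) : continuous f ->
  measurable_fun setT (derive1 f).
Proof.
move=> cf; rewrite (_ : derive1 f = fun x => lim (dquot f 1 h x @[h --> 0^'])).
  apply: measurable_lim_dnbhs0.
    by move=> h; apply: continuous_measurable_fun; exact: continuous_dquot.
  by move=> e k e0; apply: closed_measurable; exact: closed_dquot_cauchy.
by apply/funext => x; rewrite derive1E.
Qed.

End lipschitz_derivative.

Section ae_lemmas.
Context d (T : measurableType d) (R : realType) (mu : {measure set T -> \bar R}).

Lemma aeS (P Q : T -> Prop) : (forall x, P x -> Q x) ->
  {ae mu, forall x, P x} -> {ae mu, forall x, Q x}.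
Proof.
move=> PQ; apply: (filterS (F := almost_everywhere mu)) => //.
Qed.

Lemma aeS2 (P Q S : T -> Prop) : (forall x, P x -> Q x -> S x) ->
  {ae mu, forall x, P x} -> {ae mu, forall x, Q x} -> {ae mu, forall x, S x}.
Proof.
move=> PQ; apply: (filterS2 (F := almost_everywhere mu)) => //.
Qed.

Lemma measurable_aeP (A : set T) : measurable A ->
  mu (~` A) = 0 <-> {ae mu, forall x, A x}.
Proof.
move=> mA; split=> [A0|]; last by move=> /negligibleP ->//; exact: measurableC.
by exists (~` A); split => //; exact: measurableC.
Qed.

End ae_lemmas.

Lemma le_bounded_integrable d (T : measurableType d) (R : realType)
    (mu : {measure set T -> \bar R}) (D : set T) (f : T -> R) (M : R) :
  measurable D -> (mu D < +oo)%E -> measurable_fun D f ->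
  (forall x, D x -> `|f x| <= M) -> mu.-integrable D (EFin \o f).
Proof.
move=> mD Doo mf fM; apply: measurable_bounded_integrable => //.
exists M; split; first exact: num_real.
by move=> y My x Dx /=; rewrite (le_trans (fM _ Dx))// ltW.
Qed.

Lemma lebesgue_measure_itv_lty (R : realType) (a b : R) (x y : bool) :
  (@lebesgue_measure R [set` Interval (BSide x a) (BSide y b)] < +oo)%E.
Proof. by rewrite lebesgue_measure_itv/=; case: ifP => _; rewrite -?EFinB ltry. Qed.

(** * Differentiation of Lipschitz functions on the line *)

Section lipschitz_line.
Context (R : realType).
Local Notation mu := (@lebesgue_measure R).

(** Both measures are infima over the same covers by half-open intervals, so a comparison of
    increments passes to all sets, measurable or not. *)
Lemma lebesgue_stieltjes_le (g : cumulative R R) (L : R) :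
  (forall a b, a <= b -> g b - g a <= L * (b - a)) -> 0 < L -> forall A,
  (lebesgue_stieltjes_measure g A <= L%:E * mu A)%E.
Proof.
move=> gL L0 A.
rewrite /lebesgue_measure /lebesgue_stieltjes_measure /measure_extension /mu_ext.
rewrite -ereal_inf_pZl//; apply: le_ereal_inf_tmp => _ [_ [F FA <-] <-].
apply: (@le_trans _ _ (\sum_(k <oo) wlength g (F k))%E).
  by apply: ereal_inf_lbound; exists F.
rewrite -nneseriesZl => [|k _]; last exact: wlength_ge0.
apply: lee_nneseries => [*|k _]; first exact: wlength_ge0.
have [/(_ k) [ab _ <-] _] := FA.
have [le|lt] := leP ab.1 ab.2.
  rewrite wlength_itv_bnd//.
  have H : (wlength idfun `]ab.1, ab.2] = (ab.2 - ab.1)%:E)%E.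
    exact: (wlength_itv_bnd idfun).
  have : (L%:E * (ab.2 - ab.1)%:E <= L%:E * wlength idfun `]ab.1, ab.2])%E by rewrite H.
  by apply: le_trans; rewrite -EFinM lee_fin; exact: gL.
have -> : `]ab.1, ab.2]%classic = set0 :> set R.
  by rewrite set_itv_ge// bnd_simp -leNgt ltW.
have H : (L%:E * wlength idfun set0 = 0 :> \bar R)%E by rewrite wlength0 mule0.
by rewrite wlength0; have : (0 <= L%:E * wlength idfun set0 :> \bar R)%E by rewrite H.
Qed.

Lemma lebesgue_stieltjes_ocitv (g : cumulative R R) a b : a <= b ->
  (lebesgue_stieltjes_measure g `]a, b] = (g b - g a)%:E)%E.
Proof.
move=> ab; rewrite /lebesgue_stieltjes_measure /measure_extension measurable_mu_extE//.
  exact: (wlength_itv_bnd g).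
exact: is_ocitv.
Qed.

(** Adding [L * x] makes [f] nondecreasing. The Stieltjes measure of the sum is dominated by a
    multiple of Lebesgue measure, hence has a Radon-Nikodym density [W]; differentiating the
    integral of [W] yields [f' = W - L] almost everywhere. *)
Lemma lip_FTC (f : R -> R) L : 0 <= L -> lip L f ->
  {ae mu, forall x, derivable f x 1} /\
  forall a b, a <= b -> (\int[mu]_(x in `]a, b]) (derive1 f x)%:E = (f b - f a)%:E)%E.
Proof.
move=> L0 fL.
pose g0 x := f x + L * x.
have cf := lip_continuous fL.
have g_nd : {homo g0 : x y / x <= y}.
  move=> x y xy; rewrite /g0 -subr_ge0.
  have := fL x y; rewrite ler_norml => /andP[_].
  by rewrite distrC ger0_norm ?subr_ge0//; lra.
have g_rc : forall x, g0 @ at_right x --> g0 x.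
  apply: right_continuousW => x; apply: cvgD; first exact: cf.
  by apply: cvgM; [exact: cvg_cst|exact: cvg_id].
pose g : cumulative R R := HB.pack g0 (isCumulative.Build R _ R g0 g_nd g_rc).
have gL a b : a <= b -> g b - g a <= (2 * L + 1) * (b - a).
  move=> ab; rewrite /g/= /g0; have := fL b a; rewrite ler_norml => /andP[_].
  by rewrite ger0_norm ?subr_ge0//; lra.
have L20 : 0 < 2 * L + 1 by rewrite ltr_wpDl// mulr_ge0.
have gle := lebesgue_stieltjes_le gL L20.
(* Restricting to a bounded interval makes the Stieltjes measure finite, as Radon-Nikodym
   requires. *)
have loc (N : nat) : {ae mu, forall x, -N%:R < x < N%:R -> derivable f x 1} /\
    forall a b, -N%:R <= a -> a <= b -> b <= N%:R ->
      (\int[mu]_(x in `]a, b]) (derive1 f x)%:E = (f b - f a)%:E)%E.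
  pose D : set R := `]-N%:R, N%:R]%classic.
  have mD : measurable (D : set (measurableTypeR R)) by exact: measurable_itv.
  have Doo : (lebesgue_stieltjes_measure g D < +oo)%E.
    rewrite (le_lt_trans (gle _))// lebesgue_measure_itv/=.
    by case: ifP => _; rewrite ?mule0// -EFinB -EFinM ltry.
  pose nu := mfrestr mD Doo.
  have nudom : nu `<< mu.
    apply/null_content_dominatesP => A mA A0.
    apply/eqP; rewrite eq_le measure_ge0 andbT.
    rewrite (@le_trans _ _ (lebesgue_stieltjes_measure g A))//.
      by rewrite /nu /mfrestr /mrestr; apply: le_outer_measure; exact: subIsetl.
    by rewrite (le_trans (gle _))// A0 mule0.
  have [w [w0 wfin intw wE]] := radon_nikodym_sigma_finite nudom.
  pose W := fine \o w.
  have WE x : (W x)%:E = w x by rewrite /W/= fineK.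
  have intW : mu.-integrable setT (EFin \o W).
    by rewrite (_ : EFin \o W = w)//; apply/funext => x; rewrite /= WE.
  have nuE a b : -N%:R <= a -> a <= b -> b <= N%:R ->
      (\int[mu]_(x in `]a, b]) (W x)%:E = (g b - g a)%:E)%E.
    move=> Na ab bN.
    under eq_integral do rewrite WE.
    rewrite -wE; last exact: measurable_itv.
    transitivity (lebesgue_stieltjes_measure g (`]a, b] `&` D)); first by [].
    rewrite setIidl; first exact: lebesgue_stieltjes_ocitv.
    by apply: subset_itv; rewrite bnd_simp.
  have Wae : {ae mu, forall x, -N%:R < x < N%:R ->
      derivable f x 1 /\ derive1 f x = W x - L}.
    have := @FTC1 _ W (BRight (-N%:R)) _ (open_integrable_locally openT intW).
    have iW y : mu.-integrable [set` Interval (BRight (- N%:R)) (BRight y)] (EFin \o W).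
      by apply: integrableS intW.
    move=> /(_ iW)/=; apply: aeS => x Hx /andP[Nx xN].
    have {Hx} [|dF F'] := Hx _; first by rewrite lte_fin.
    set F := (fun _ => _) in dF F'.
    (* The integral [F] of [W] from [-N] equals the increment of [g] from [-N], so [phi] coincides
       with [f] near [x] and shares its derivative. *)
    pose phi y := F y + g (- N%:R) - L * y.
    have phif : \near x, phi x = f x.
      near=> y; rewrite /phi /F /Rintegral nuE//=.
      + rewrite /g/= /g0; ring.
      + by apply: ltW; near: y; exact: lt_nbhsr.
      + by apply: ltW; near: y; exact: lt_nbhsl.
    have dphi : is_derive x 1 phi (W x - L).
      have dF' : is_derive x 1 F (W x).
        by rewrite -F' derive1E; exact: derivableP.
      rewrite (_ : W x - L = W x + 0 - L *: 1); last by rewrite addr0 [L *: _]mulr1.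
      apply: is_deriveB.
    have df := near_eq_is_derive phif dphi.
    by split; [exact: ex_derive|rewrite derive1E derive_val].
  split; first by apply: aeS Wae => x Hx /Hx[].
  move=> a b Na ab bN.
  transitivity (\int[mu]_(x in `]a, b]) (W x - L)%:E)%E.
    apply: ae_eq_integral => //.
    - apply/measurable_EFinP/measurable_funTS; exact: measurable_fun_derive1.
    - by apply/measurable_EFinP/measurable_funTS/measurable_funB;
        [move/integrableP : intW => [/measurable_EFinP]|exact: measurable_cst].
    (* The derivative is identified on the open interval only, and [b] may be its right end. *)
    - have : {ae mu, forall x, x != b}.
        exists [set b]; split; [exact: measurable_set1|exact: lebesgue_measure_set1|].
        by move=> x /= /negP; rewrite negbK => /eqP.
      apply: aeS2 Wae => x Hx xb /=; rewrite in_itv/= => /andP[ax xb'].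
      have [|_ ->//] := Hx _.
      rewrite (le_lt_trans Na ax)/= (lt_le_trans _ bN)//.
      by rewrite lt_neqAle xb' andbT.
  under eq_integral do rewrite EFinB.
  rewrite integralB//; last 2 first.
  - exact: integrableS intW.
  - by apply: (@le_bounded_integrable _ _ _ _ _ (cst L) `|L|) => //; exact: lebesgue_measure_itv_lty.
  rewrite nuE// integral_cst//=; rewrite lebesgue_measure_itv/= lte_fin.
  case: ifPn => [_|]; first by rewrite -(EFinB b a) -EFinM -EFinB; congr (_%:E); rewrite /g/= /g0; ring.
  rewrite -leNgt => ba; have -> : b = a by apply/eqP; rewrite eq_le ba.
  by rewrite mule0 !subrr sube0.
split.
  have : {ae mu, forall x, forall N : nat, -N%:R < x < N%:R -> derivable f x 1}.
    by apply/ae_foralln => N; exact: (loc N).1.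
  apply: aeS => x Hx; apply: (Hx (Num.bound `|x|)).
  by rewrite -ltr_norml; exact: archi_boundP.
move=> a b ab; pose N := Num.bound (Num.max `|a| `|b|).
have Nab : Num.max `|a| `|b| < N%:R by apply: archi_boundP; rewrite le_max normr_ge0.
move: Nab; rewrite gt_max => /andP[/ltW Na /ltW Nb].
apply: (loc N).2 => //; move: Na Nb; rewrite !ler_norml => /andP[? ?] /andP[? ?] //.
Unshelve. all: by end_near. Qed.

End lipschitz_line.

Section line_ibp.
Context (R : realType).
Local Notation mu := (@lebesgue_measure R).

Lemma derivable_lip (phi : R -> R) (M : R) :
  (forall x, derivable phi x 1) -> (forall x, `|derive1 phi x| <= M) -> lip M phi.
Proof.
move=> dphi phiM.
suff H x y : x < y -> `|phi x - phi y| <= M * `|x - y|.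
  move=> x y; have [xy|yx|->] := ltgtP x y; first exact: H.
    by rewrite distrC [X in M * X]distrC; exact: H.
  by rewrite !subrr normr0 mulr0.
move=> xy.
have [||c _] := @MVT _ phi (derive1 phi) x y xy.
- by move=> z _; rewrite derive1E; exact: derivableP.
- by apply: derivable_within_continuous => z _; exact: dphi.
move=> E; rewrite distrC E normrM [`|x - y|]distrC.
by rewrite ler_wpM2r.
Qed.

Lemma lip_mul (f g : R -> R) L M A B : 0 <= A -> 0 <= B -> 0 <= L -> 0 <= M ->
  (forall x, `|f x| <= A) -> (forall x, `|g x| <= B) ->
  lip L f -> lip M g -> lip (A * M + B * L) (fun x => f x * g x).
Proof.
move=> A0 B0 L0 M0 fA gB fL gM x y.
have -> : f x * g x - f y * g y = f x * (g x - g y) + g y * (f x - f y) by ring.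
rewrite (le_trans (ler_normD _ _))// !normrM mulrDl lerD// -mulrA ler_pM//.
Qed.

(** The product [f * phi] is Lipschitz, so the integral of its derivative is an increment, which is
    0 between [-(K + 1)] and [K + 1]. The extra unit ensures that [phi] vanishes in a neighbourhood
    of every point left out, hence so does its derivative there. *)
Lemma lip_ibp (f phi : R -> R) L M A B K : 0 <= A -> 0 <= B -> 0 <= L -> 0 <= M -> 0 <= K ->
  lip L f -> (forall x, `|f x| <= A) ->
  (forall x, derivable phi x 1) -> (forall x, `|derive1 phi x| <= M) ->
  (forall x, `|phi x| <= B) -> (forall x, K <= `|x| -> phi x = 0) ->
  (\int[mu]_x (f x * derive1 phi x + derive1 f x * phi x)%:E = 0)%E.
Proof.
move=> A0 B0 L0 M0 K0 fL fA dphi phiM phiB phiK.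
have pL := derivable_lip dphi phiM.
have hL := lip_mul A0 B0 L0 M0 fA phiB fL pL.
have C0 : 0 <= A * M + B * L by rewrite addr_ge0// mulr_ge0.
have [_ /(_ (-(K + 1)) (K + 1))] := lip_FTC C0 hL.
have K1 : K <= K + 1 by rewrite lerDl.
have -> : - (K + 1) <= K + 1 by lra.
move=> /(_ isT).
rewrite !(phiK (K + 1)) ?(phiK (- (K + 1))) ?normrN ?ger0_norm ?addr_ge0//.
rewrite !mulr0 subrr => E.
have [aef _] := lip_FTC L0 fL.
have cf := lip_continuous fL.
have cphi := lip_continuous pL.
have mf' := measurable_fun_derive1 cf.
have mphi' := measurable_fun_derive1 cphi.
have mf := continuous_measurable_fun cf.
have mphi := continuous_measurable_fun cphi.
have mg : measurable_fun setT (fun x => f x * derive1 phi x + derive1 f x * phi x).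
  by apply: measurable_funD; apply: measurable_funM.
rewrite -(@setUv _ `](-(K+1)), K + 1]%classic).
rewrite integral_setU_EFin//; first last.
- exact/disj_setPCl.
- by rewrite setUv; exact: mg.
- exact: measurableC.
rewrite [X in (_ + X)%E]integral0_eq ?adde0; last first.
  move=> x /= /negP; rewrite in_itv/= => xK.
  have {}xK : K < `|x|.
    rewrite ltNge; apply/negP => /ler_normlP[x1 x2]; move/negP: xK; apply.
    by apply/andP; split; lra.
  rewrite (phiK x) ?(ltW xK)// mulr0 addr0 derive1E.
  suff -> : 'D_1 phi x = 'D_1 (cst 0) x by rewrite derive_cst mulr0.
  apply: near_eq_derive; near=> y; rewrite /= phiK//; apply: ltW.
  near: y.
  have : {for x, continuous (fun y : R => `|y|)} by exact: norm_continuous.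
  by move=> /cvgr_gt; apply.
apply: etrans E; apply: ae_eq_integral => //.
- by apply/measurable_EFinP/measurable_funTS.
- by apply/measurable_EFinP/measurable_funTS; exact: (measurable_fun_derive1 (lip_continuous hL)).
- apply: aeS aef => x dfx _; congr (_%:E).
  rewrite !derive1E.
  rewrite [RHS](_ : _ = f x *: 'D_1 phi x + phi x *: 'D_1 f x).
    by rewrite -[f x *: _]/(f x * _) -[phi x *: _]/(phi x * _) [phi x * _]mulrC.
  exact: (@deriveM _ _ f phi x 1 dfx (dphi x)).
Unshelve. all: by end_near. Qed.

End line_ibp.

(** * Lebesgue measure on row vectors *)

Section Borel_rV.
Context (R : realType) (n : nat).
Local Notation E := 'rV[R]_n.

Lemma le_coord_norm (x : E) i : `|x ord0 i| <= `|x|.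
Proof. by rewrite {2}/Num.norm/= mx_normrE; apply: (le_bigmax _ (fun ij => `|x ij.1 ij.2|) (ord0, i)). Qed.

Lemma rV_norm_le (x : E) (e : R) : 0 <= e -> (forall i, `|x ord0 i| <= e) -> `|x| <= e.
Proof.
move=> e0 xe; rewrite /Num.norm/= mx_normrE; apply: bigmax_le => // -[i j] _ /=.
by rewrite (ord1 i).
Qed.

(** Half-open intervals generate the Borel sets of each coordinate, and they are differences of
    half-lines. Borel regularity of Hausdorff measure and inner regularity are thereby reduced to
    half-spaces. *)
Lemma measurable_rV_ind (G : set (set E)) : sigma_algebra setT G ->
  (forall (i : 'I_n) (c : R), G [set x | x ord0 i <= c]) ->
  forall A, measurable A -> G A.
Proof.
move=> sG Gc.
have [G0 GC GU] := sG.
have GCT A : G A -> G (~` A) by move=> /GC; rewrite setTD.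
have GI A B : G A -> G B -> G (A `&` B).
  move=> GA GB; rewrite -[X in G X]setCK setCI -bigcup2E.
  apply/GCT/GU => -[|[|k]]/=; [exact: GCT|exact: GCT|exact: G0].
apply: smallest_sub => //.
rewrite -bigcup_seq => A [i _] [B mB <-]; rewrite setTI.
suff : measurable `<=` [set B | G (@coord_rV R n i @^-1` B)] by apply.
apply: smallest_sub.
  split => /=.
  - by rewrite preimage_set0.
  - by move=> C GC'; rewrite setTD preimage_setC; exact: GCT.
  - by move=> F GF; rewrite preimage_bigcup; exact: GU.
move=> _ [[a b] _ <-] /=.
have -> : @coord_rV R n i @^-1` `]a, b] = [set x : E | x ord0 i <= b] `&` ~` [set x : E | x ord0 i <= a].
  apply/seteqP; split => x /=; rewrite in_itv/= /coord_rV ltNge.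
    by move=> /andP[/negP].
  by move=> [-> /negP ->].
by apply: GI; [exact: Gc|apply: GCT; exact: Gc].
Qed.

(** The sigma-algebra is generated by the coordinates, so open sets enter through countability: an
    open set is the union of the cubes that it contains, with rational centre and side
    [2 / (k + 1)]. *)
Lemma rV_open_measurable (A : set E) : open A -> measurable A.
Proof.
move=> oA.
pose cube (qk : 'rV[rat]_n * nat) := [set y : E | forall j, `|y ord0 j - ratr (qk.1 ord0 j)| < qk.2.+1%:R^-1].
have mcube qk : measurable (cube qk).
  rewrite (_ : cube qk = \bigcap_(j in [set: 'I_n])
      (@coord_rV R n j @^-1` ball (ratr (qk.1 ord0 j) : R) qk.2.+1%:R^-1)).
    apply: fin_bigcap_measurable => // j _.
    rewrite -[X in measurable X]setTI; apply: measurable_coord_rV => //.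
    exact: measurable_ball.
  apply/seteqP; split => y /=.
    by move=> Hy j _; rewrite /= /ball/= distrC; exact: Hy.
  by move=> Hy j; rewrite distrC; exact: Hy.
have -> : A = \bigcup_qk (if `[< cube qk `<=` A >] then cube qk else set0).
  apply/seteqP; split; last by move=> x [qk _]; case: asboolP => // H /H.
  move=> x Ax.
  have /nbhs_ballP[e /= e0 He] : nbhs x A by exact: open_nbhs_nbhs.
  have [k _ ke] : exists2 k, True & k.+1%:R^-1 < e / 2.
    near \oo => k; exists k => //; near: k.
    have e20 : 0 < e / 2 by rewrite divr_gt0.
    exact: near_infty_natSinv_lt (PosNum e20).
  have k0 : 0 < k.+1%:R^-1 :> R by rewrite invr_gt0.
  have /choice[q qP] (j : 'I_n) : exists q : rat, `|x ord0 j - ratr q| < k.+1%:R^-1.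
    have xk : x ord0 j - k.+1%:R^-1 < x ord0 j + k.+1%:R^-1 by rewrite ltrD2l (lt_trans _ k0)// oppr_lt0.
    have [q] := rat_in_itvoo xk.
    rewrite in_itv/= => /andP[q1 q2]; exists q; rewrite ltr_norml; apply/andP; split.
      by rewrite ltrBrDr addrC -ltrBrDr opprK.
    by rewrite ltrBlDr -ltrBlDl.
  exists (\row_j q j, k) => //; case: asboolP => [_|] /=.
    by move=> j; rewrite mxE; exact: qP.
  case=> y /= Hy; apply: He; split => // i j; rewrite (ord1 i).
  have := Hy j; rewrite mxE => Hyj.
  rewrite /ball/= (le_lt_trans (ler_distD (ratr (q j)) _ _))//.
  rewrite distrC in Hyj.
  have H1 := lt_trans Hyj ke; have H2 := lt_trans (qP j) ke.
  by rewrite (splitr e) ltrD.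
apply: countable_bigcupT_measurable; first exact: countableP.
by move=> qk; case: ifP.
Unshelve. all: by end_near. Qed.

Lemma rV_closed_measurable (A : set E) : closed A -> measurable A.
Proof. move=> cA; rewrite -(setCK A); apply: measurableC; apply: rV_open_measurable; exact: closed_openC. Qed.

Lemma rV_continuous_measurable (f : E -> R) : continuous f -> measurable_fun setT f.
Proof.
move=> /continuousP cf; apply: (measurability _ (RGenOpens.measurableE R)).
move=> _ [_ [a [b ->] <-]]; rewrite setTI.
by apply: rV_open_measurable; apply: cf; exact: interval_open.
Qed.

Lemma rV_compactP (A : set E) (M : R) : closed A -> (forall x, A x -> `|x| <= M) -> compact A.
Proof.
move=> cA AM; apply: bounded_closed_compact => //.
exists M; split; first exact: num_real.
by move=> y My x /AM xM /=; rewrite (le_trans xM)// ltW.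
Qed.

End Borel_rV.

(** * Slicing along an arbitrary coordinate *)

Section insert_rV.
Context (R : realType) (n : nat).

(** Generalizes [cons_rV], the case [i = ord0]: [lebesgue_rV] slices along the first axis, whereas
    partial derivatives call for lines along every axis. *)
Definition ins (i : 'I_n.+1) (t : R) (y : 'rV[R]_n) : 'rV[R]_n.+1 :=
  \row_k if unlift i k is Some j then y ord0 j else t.

Definition del (i : 'I_n.+1) (x : 'rV[R]_n.+1) : 'rV[R]_n :=
  \row_j x ord0 (lift i j).

Lemma ins_at i t y : ins i t y ord0 i = t.
Proof. by rewrite mxE unlift_none. Qed.

Lemma ins_lift i t y j : ins i t y ord0 (lift i j) = y ord0 j.
Proof. by rewrite mxE liftK. Qed.

Lemma insK i t y : del i (ins i t y) = y.
Proof. by apply/rowP => j; rewrite mxE ins_lift. Qed.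

Lemma delK i (x : 'rV[R]_n.+1) : ins i (x ord0 i) (del i x) = x.
Proof. by apply/rowP => k; rewrite mxE; case: unliftP => [j ->|->]; rewrite ?mxE. Qed.

Lemma ins_inj i t y t' y' : ins i t y = ins i t' y' -> t = t' /\ y = y'.
Proof. by move=> h; split; [rewrite -(ins_at i t y) h ins_at|rewrite -(insK i t y) h insK]. Qed.

Lemma ins_add i (h t : R) (y : 'rV[R]_n) :
  h *: delta_mx ord0 i + ins i t y = ins i (h + t) y.
Proof.
apply/rowP => k; rewrite !mxE eqxx/=.
case: unliftP => [j ->|->]; last by rewrite eqxx mulr1.
by rewrite eq_sym eq_liftF mulr0 add0r.
Qed.

Lemma measurable_ins i :
  measurable_fun [set: measurableTypeR R * 'rV[R]_n] (fun z => ins i z.1 z.2).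
Proof.
apply: measurable_fun_rVP => k; rewrite /coord_rV.
case: (unliftP i k) => [j ->|->].
  under eq_fun do rewrite ins_lift.
  exact: (measurableT_comp (measurable_coord_rV j) measurable_snd).
by under eq_fun do rewrite ins_at; exact: measurable_fst.
Qed.

End insert_rV.

Lemma cons_rVE (R : realType) (n : nat) (z : measurableTypeR R * 'rV[R]_n) :
  cons_rV z = ins ord0 z.1 z.2.
Proof. by []. Qed.

Lemma ins_cons (R : realType) (n : nat) (i : 'I_n.+1) (z t : R) (y : 'rV[R]_n) :
  ins (lift ord0 i) t (cons_rV (z, y)) = cons_rV (z, ins i t y).
Proof.
apply/rowP => k; case: (unliftP ord0 k) => [j ->|->].
  rewrite [RHS]mxE liftK/=; case: (unliftP i j) => [l ->|->].
    have -> : lift ord0 (lift i l) = lift (lift ord0 i) (lift ord0 l).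
      by apply: val_inj; rewrite /= /bump !leq0n !add1n ltnS; case: leq.
    by rewrite !ins_lift.
  by rewrite !ins_at.
have E : ord0 = lift (lift ord0 i) ord0 by apply: val_inj.
by rewrite [in LHS]E ins_lift !ins_at.
Qed.

Section insert_measure.
Local Open Scope ereal_scope.
Context (R : realType).
Local Notation mu := (@lebesgue_measure R).
Local Notation leb n := (@lebesgue_rV R n).

(** Induction on the dimension: beyond the first coordinate, the induction hypothesis applies inside
    each first-coordinate slice, and Tonelli exchanges the two outer integrals. *)
Lemma lebesgue_rV_insE n (i : 'I_n.+1) (A : set 'rV[R]_n.+1) : measurable A ->
  leb n.+1 A = \int[mu]_t leb n [set y | A (ins i t y)].
Proof.
elim: n i A => [|n IH] i A mA; first by rewrite (ord1 i).
case: (unliftP ord0 i) => [j ->|->//].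
transitivity (\int[mu]_z \int[mu]_t leb n [set y | A (cons_rV (z, ins j t y))]).
  apply: eq_integral => z _; apply: (IH j (fun w => A (cons_rV (z, w)))).
  rewrite (_ : (fun w => A (cons_rV (z, w))) = (fun w => cons_rV (z, w)) @^-1` A) //.
  rewrite -[X in measurable X]setTI.
  apply: (@measurableT_comp _ _ _ _ _ _ (@cons_rV R n.+1) _
    (fun w : 'rV[R]_n.+1 => (z : measurableTypeR R, w))) => //.
    exact: measurable_cons_rV.
  by apply/measurable_fun_pairP; split; [exact: measurable_cst|exact: measurable_id].
transitivity (\int[mu]_t \int[mu]_z leb n [set y | A (cons_rV (z, ins j t y))]); last first.
  apply: eq_integral => t _ /=; rewrite /lebesgue_rV/=; apply: eq_integral => z _.
  by congr (_ _); apply/seteqP; split => y /=; rewrite ins_cons.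
pose F (zt : R * R) := leb n [set y | A (cons_rV (zt.1, ins j zt.2 y))].
have := @fubini_tonelli _ _ _ _ _ mu mu F.
apply.
- pose B := (fun w : (measurableTypeR R * measurableTypeR R) * 'rV[R]_n =>
    cons_rV (w.1.1, ins j w.1.2 w.2)) @^-1` A.
  have mB : measurable B.
    rewrite -[X in measurable X]setTI.
    apply: (@measurableT_comp _ _ _ _ _ _ (@cons_rV R n.+1) _
      (fun w : (measurableTypeR R * measurableTypeR R) * 'rV[R]_n => (w.1.1, ins j w.1.2 w.2))) => //.
      exact: measurable_cons_rV.
    apply/measurable_fun_pairP; split => /=.
      exact: (measurableT_comp measurable_fst measurable_fst).
    apply: (@measurableT_comp _ _ _ _ _ _ (fun z => ins j z.1 z.2) _
      (fun w : (measurableTypeR R * measurableTypeR R) * 'rV[R]_n => (w.1.2, w.2))).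
      exact: measurable_ins.
    apply/measurable_fun_pairP; split => /=; last exact: measurable_snd.
    exact: (measurableT_comp measurable_snd measurable_fst).
  have := measurable_fun_xsection (leb n) mB.
  congr measurable_fun; apply/funext => zt; congr (leb n _).
  by apply/seteqP; split => y; rewrite /xsection/= inE.
- by move=> z; exact: measure_ge0.
Qed.

End insert_measure.

Section insert_fubini.
Local Open Scope ereal_scope.
Context (R : realType) (n : nat) (i : 'I_n.+1).
Local Notation mu := (@lebesgue_measure R).
Local Notation leb n := (@lebesgue_rV R n).
Local Notation insz := (fun z : measurableTypeR R * 'rV[R]_n => ins i z.1 z.2).

Lemma lebesgue_rV_pushE (A : set 'rV[R]_n.+1) : measurable A ->
  leb n.+1 A = (mu \x leb n) (insz @^-1` A).
Proof.
move=> mA; rewrite (lebesgue_rV_insE i mA); apply: eq_integral => t _ /=.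
by congr (leb n _); apply/seteqP; split => y; rewrite /xsection/= inE.
Qed.

Lemma measurable_preimage_ins (A : set 'rV[R]_n.+1) : measurable A ->
  measurable (insz @^-1` A).
Proof. by move=> mA; rewrite -[X in measurable X]setTI; exact: measurable_ins. Qed.

(** By uniqueness of the product measure, one may measure the lines parallel to the i-th axis
    first. *)
Lemma lebesgue_rV_lineE (A : set 'rV[R]_n.+1) : measurable A ->
  leb n.+1 A = \int[leb n]_y mu [set t | A (ins i t y)].
Proof.
move=> mA; rewrite lebesgue_rV_pushE//.
transitivity ((mu \x^ leb n) (insz @^-1` A)).
  apply: product_measure_unique; last exact: measurable_preimage_ins.
  by move=> B C mB mC; rewrite /= product_measure2E.
apply: eq_integral => y _ /=; congr (mu _).
by apply/seteqP; split => t; rewrite /ysection/= inE.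
Qed.

Lemma lebesgue_rV_line_null (A : set 'rV[R]_n.+1) : measurable A ->
  (forall y, mu [set t | A (ins i t y)] = 0) -> leb n.+1 A = 0.
Proof.
move=> mA A0; rewrite lebesgue_rV_lineE//.
by under eq_integral do rewrite A0; rewrite integral0.
Qed.

Lemma integral_ins (f : 'rV[R]_n.+1 -> \bar R) : (leb n.+1).-integrable setT f ->
  \int[leb n.+1]_x f x = \int[leb n]_y \int[mu]_t f (ins i t y).
Proof.
move=> intf.
have mins : measurable_fun setT insz by exact: measurable_ins.
pose P := pushforward (mu \x leb n) insz.
have PE A : measurable A -> leb n.+1 A = P A by exact: lebesgue_rV_pushE.
have intPf : P.-integrable setT f.
  case/integrableP : intf => mf foo; apply/integrableP; split => //.
  by rewrite (@eq_measure_integral _ _ _ _ (leb n.+1)) // => A mA _; exact/esym/PE.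
have intf' : (mu \x leb n).-integrable setT (f \o insz).
  case/integrableP : intPf => mf foo; apply/integrableP; split.
    exact: measurableT_comp.
  move: foo; rewrite ge0_integral_pushforward ?preimage_setT//.
  exact: measurableT_comp.
transitivity (\int[P]_x f x).
  by apply: eq_measure_integral => A mA _; exact: PE.
transitivity (\int[mu \x leb n]_(x in insz @^-1` setT) (f \o insz) x).
  by apply: integral_pushforward => //; case/integrableP : intf.
rewrite preimage_setT.
by rewrite -(integral21_prod_meas1 intf').
Qed.

End insert_fubini.

Section cubes.
Local Open Scope ereal_scope.
Context (R : realType).
Local Notation leb n := (@lebesgue_rV R n).

Definition rV_cube n (c : 'rV[R]_n) (d : R) : set 'rV[R]_n :=
  [set x | forall j, (`|x ord0 j - c ord0 j| <= d)%R].

Lemma measurable_rV_cube n (c : 'rV[R]_n) d : measurable (rV_cube c d).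
Proof.
rewrite (_ : rV_cube c d = \bigcap_(j in [set: 'I_n])
    (@coord_rV R n j @^-1` [set` `[(c ord0 j - d)%R, (c ord0 j + d)%R]])).
  apply: fin_bigcap_measurable => // j _.
  by rewrite -[X in measurable X]setTI; apply: measurable_coord_rV => //.
apply/seteqP; split => x H j.
  by move=> _; rewrite /= in_itv/= -ler_distl; exact: H.
by have := H j I; rewrite /= in_itv/= -ler_distl.
Qed.

Lemma lebesgue_rV_cube n (c : 'rV[R]_n) (d : R) : (0 <= d)%R ->
  leb n (rV_cube c d) = ((2 * d) ^+ n)%:E.
Proof.
move=> d0; elim: n c => [|n IH] c.
  rewrite /lebesgue_rV/= diracE expr0 mem_set//.
  by move=> [].
pose c' := (\row_j c ord0 (lift ord0 j))%R.
transitivity (\int[@lebesgue_measure R]_(t in `[(c ord0 ord0 - d)%R, (c ord0 ord0 + d)%R])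
   (cst ((2 * d) ^+ n)%:E t)).
  rewrite [RHS]integral_mkcond; apply: eq_integral => t _.
  rewrite -/lebesgue_rV patchE; case: ifPn => [/set_mem|/negP tn].
    rewrite /= in_itv/= -ler_distl => tc.
    rewrite -(IH c'); congr lebesgue_rV; apply/seteqP; split => y.
      by move=> H j; have := H (lift ord0 j); rewrite cons_rVE ins_lift mxE.
    move=> H j; case: (unliftP ord0 j) => [k ->|->]; last by rewrite cons_rVE ins_at.
    by rewrite cons_rVE ins_lift; have := H k; rewrite mxE.
  rewrite -[RHS](measure0 (leb n)); congr lebesgue_rV; apply/seteqP; split => y //.
  move=> /(_ ord0); rewrite cons_rVE ins_at => H; exfalso; apply: tn.
  by rewrite inE /= in_itv/= -ler_distl.
rewrite integral_cst//= lebesgue_measure_itv/= lte_fin.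
case: ifPn => [_|]; first by rewrite -EFinB -EFinM; congr EFin; rewrite exprS; ring.
rewrite -leNgt => H; have -> : d = 0%R by lra.
by rewrite mulr0 mule0 exprS mul0r.
Qed.

Lemma bounded_lebesgue_rV_lty n (A : set 'rV[R]_n) (M : R) : measurable A ->
  (forall x, A x -> (`|x| <= M)%R) -> leb n A < +oo.
Proof.
move=> mA AM; apply: (@le_lt_trans _ _ (leb n (rV_cube 0 `|M|))).
  apply: le_measure; rewrite ?inE//; first exact: measurable_rV_cube.
  move=> x Ax j; rewrite mxE subr0 (le_trans (le_coord_norm _ _))//.
  by rewrite (le_trans (AM _ Ax))// ler_norm.
by rewrite lebesgue_rV_cube// ltry.
Qed.

End cubes.

(** * Partial derivatives of Lipschitz functions *)

Section partial_derivatives.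
Context (R : realType) (n : nat).
Implicit Types (f : 'rV[R]_n.+1 -> R) (i : 'I_n.+1).
Local Notation mu := (@lebesgue_measure R).
Local Notation leb := (@lebesgue_rV R n.+1).

Lemma dquot_ins f i h t y :
  dquot f (delta_mx ord0 i) h (ins i t y) = dquot (fun s => f (ins i s y)) 1 h t.
Proof. by rewrite /dquot ins_add [h *: 1]mulr1. Qed.

Lemma derivable_ins f i t y :
  derivable f (ins i t y) (delta_mx ord0 i) <-> derivable (fun s => f (ins i s y)) t 1.
Proof.
rewrite !derivable_dquotE (_ : (fun h => dquot f _ h _) = (fun h => dquot (fun s => f (ins i s y)) 1 h t))//.
by apply/funext => h; exact: dquot_ins.
Qed.

Lemma partial_ins f i t y :
  partial i f (ins i t y) = derive1 (fun s => f (ins i s y)) t.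
Proof.
rewrite derive1E /partial !derive_dquotE; congr (lim _).
by rewrite (_ : (fun h => dquot f _ h _) = (fun h => dquot (fun s => f (ins i s y)) 1 h t))//;
  apply/funext => h; exact: dquot_ins.
Qed.

Lemma ins_norm i t t' (y : 'rV[R]_n) : `|ins i t y - ins i t' y| <= `|t - t'|.
Proof.
apply: rV_norm_le => // k; rewrite !mxE.
by case: unlift => [j|//]; rewrite subrr normr0.
Qed.

Lemma lip_ins f L i y : 0 <= L -> lip L f -> lip L (fun s => f (ins i s y)).
Proof. by move=> L0 fL s t; rewrite (le_trans (fL _ _))// ler_wpM2l// ins_norm. Qed.

Lemma delta_norm i : `|delta_mx ord0 i : 'rV[R]_n.+1| <= 1.
Proof. by apply: rV_norm_le => // j; rewrite mxE eqxx/=; case: eqP; rewrite ?normr1 ?normr0. Qed.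

Lemma measurable_derivable f i : continuous f ->
  measurable [set x | derivable f x (delta_mx ord0 i)].
Proof.
move=> cf; apply: (measurable_cvg_dnbhs0 (q := dquot f (delta_mx ord0 i))).
  by move=> e k e0; apply: rV_closed_measurable; exact: closed_dquot_cauchy.
Qed.

Lemma measurable_partial f i : continuous f -> measurable_fun setT (partial i f).
Proof.
move=> cf; apply: (measurable_lim_dnbhs0 (q := dquot f (delta_mx ord0 i))).
  by move=> h; apply: rV_continuous_measurable; exact: continuous_dquot.
by move=> e k e0; apply: rV_closed_measurable; exact: closed_dquot_cauchy.
Qed.

Lemma lip_partial_le f L i x : 0 <= L -> lip L f -> `|partial i f x| <= L.
Proof.
move=> L0 fL; rewrite (le_trans (lip_derive_le _ _ L0 fL))//.
by rewrite -[leRHS]mulr1 ler_wpM2l// delta_norm.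
Qed.

(** The exceptional set is Borel and meets each line parallel to the i-th axis in a null set, by the
    one-dimensional theorem. *)
Lemma lip_ae_derivable f L i : 0 <= L -> lip L f ->
  {ae leb, forall x, derivable f x (delta_mx ord0 i)}.
Proof.
move=> L0 fL; have cf := lip_continuous fL.
apply/measurable_aeP; first exact: measurable_derivable.
apply: (lebesgue_rV_line_null (i := i)); first by apply: measurableC; exact: measurable_derivable.
move=> y; have [ae _] := lip_FTC L0 (lip_ins i y L0 fL).
have mD : measurable [set t | derivable (fun s => f (ins i s y)) t 1].
  apply: (measurable_cvg_dnbhs0 (q := dquot (fun s => f (ins i s y)) 1)) => e k e0.
  by apply: closed_measurable; apply: closed_dquot_cauchy; exact: lip_continuous (lip_ins i y L0 fL).
rewrite -((measurable_aeP mu mD).2 ae); congr (mu _).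
by apply/seteqP; split => t /= nd H; apply: nd;
  [exact: (derivable_ins f i t y).2|exact: (derivable_ins f i t y).1].
Qed.

End partial_derivatives.

(** * Weak gradients of Lipschitz functions *)

Lemma compact_normed_bounded (R : realType) (V : normedModType R) (K : set V) : compact K ->
  exists2 M : R, 0 <= M & forall x, K x -> `|x| <= M.
Proof.
move=> /compact_bounded [M [_ HM]].
exists (`|M| + 1); first by rewrite addr_ge0.
by apply: (HM (`|M| + 1)); rewrite (le_lt_trans (ler_norm M))// ltrDl.
Qed.

Lemma continuous_compact_support_bounded (R : realType) (V : normedModType R)
    (f : V -> R) (K : set V) :
  compact K -> continuous f -> (forall x, ~ K x -> f x = 0) ->
  exists2 M : R, 0 <= M & forall x, `|f x| <= M.
Proof.
move=> cK cf f0.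
have : compact (f @` K) by apply: continuous_compact => //; exact: continuous_subspaceT.
move=> /compact_normed_bounded [M M0 HM]; exists M => // x.
have [Kx|Kx] := pselect (K x); last by rewrite f0// normr0.
by apply: HM; exists x.
Qed.

Lemma Rintegral_support d (T : measurableType d) (R : realType)
    (mu : {measure set T -> \bar R}) (Omega K : set T) (g : T -> R) :
  measurable Omega -> K `<=` Omega -> (forall x, ~ K x -> g x = 0) ->
  \int[mu]_(x in Omega) g x = \int[mu]_x g x.
Proof.
move=> mO KO g0; rewrite /Rintegral; congr fine.
rewrite integral_mkcond; apply: eq_integral => x _.
rewrite patchE; case: ifPn => // /negP; rewrite inE => Ox.
by rewrite g0// => /KO.
Qed.

Section weak_gradient.
Context (R : realType) (n : nat).
Implicit Types (f : 'rV[R]_n.+1 -> R) (i : 'I_n.+1).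
Local Notation mu := (@lebesgue_measure R).
Local Notation leb := (@lebesgue_rV R n.+1).

Section test.
Variables (Omega : set 'rV[R]_n.+1) (phi : 'rV[R]_n.+1 -> R) (i : 'I_n.+1).
Hypothesis phiT : test_function Omega phi.
Let K := closure [set x | phi x != 0].

Lemma test_continuous : continuous phi.
Proof. by case: phiT => /(_ 0%N). Qed.

Lemma test_derivable x : derivable phi x (delta_mx ord0 i).
Proof. by case: phiT => /(_ 1%N) [_ + _] _ _; exact. Qed.

Lemma test_partial_continuous : continuous (partial i phi).
Proof. by case: phiT => /(_ 1%N) [_ _ +] _ _; exact. Qed.

Lemma test_eq0 x : ~ K x -> phi x = 0.
Proof. by move=> Kx; apply/eqP/negP => /negP px; apply: Kx; exact: subset_closure. Qed.

Lemma test_partial_eq0 x : ~ K x -> partial i phi x = 0.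
Proof.
move=> Kx; rewrite /partial.
suff -> : 'D_(delta_mx ord0 i) phi x = 'D_(delta_mx ord0 i) (cst 0 : 'rV[R]_n.+1 -> R) x by rewrite derive_cst.
apply: near_eq_derive.
have : open (~` K) by apply: closed_openC; exact: closed_closure.
by rewrite openE => /(_ x Kx); apply: filterS => y; exact: test_eq0.
Qed.

Lemma test_compact : compact K.
Proof. by case: phiT. Qed.

Lemma test_bounded : exists2 B : R, 0 <= B & forall x, `|phi x| <= B.
Proof. by apply: continuous_compact_support_bounded test_compact test_continuous _; exact: test_eq0. Qed.

Lemma test_partial_bounded : exists2 B : R, 0 <= B & forall x, `|partial i phi x| <= B.
Proof.
by apply: continuous_compact_support_bounded test_compact test_partial_continuous _;
  exact: test_partial_eq0.
Qed.

Lemma test_integrable (w psi : 'rV[R]_n.+1 -> R) (W P : R) : measurable_fun setT w ->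
  measurable_fun setT psi ->
  (forall x, `|w x| <= W) -> (forall x, `|psi x| <= P) -> (forall x, ~ K x -> psi x = 0) ->
  leb.-integrable setT (fun x => (w x * psi x)%:E).
Proof.
move=> mw mpsi wW psiP psi0.
have mK : measurable K by apply: rV_closed_measurable; exact: closed_closure.
have [M M0 KM] := compact_normed_bounded test_compact.
have : leb.-integrable K (fun x => (w x * psi x)%:E).
  apply: (@le_bounded_integrable _ _ _ _ _ (fun x => w x * psi x) (W * P)) => //.
  - exact: bounded_lebesgue_rV_lty KM.
  - by apply: measurable_funM; exact: measurable_funTS.
  - by move=> x _; rewrite normrM ler_pM.
move/integrable_mkcond => /(_ mK); congr (_.-integrable _ _); apply/funext => x.
rewrite patchE; case: ifPn => // /negP; rewrite inE => /psi0 ->.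
by rewrite mulr0.
Qed.

End test.

(** Since the test function has compact support in [Omega], both integrals extend to the whole
    space; integration by parts on each line parallel to the i-th axis then shows that their sum is
    0. The bounds on [u] and its partial derivatives make Fubini applicable. *)
Lemma lip_weak_gradient (Omega : set 'rV[R]_n.+1) u L B : open Omega ->
  0 <= L -> lip L u -> 0 <= B -> (forall x, `|u x| <= B) ->
  weak_gradient Omega u (gradient u).
Proof.
move=> oO L0 uL B0 uB phi phiT i.
have mO := rV_open_measurable oO.
have KO : closure [set x | phi x != 0] `<=` Omega by case: phiT.
under [in RHS]eq_Rintegral do rewrite mxE.
have p0 x := @test_eq0 phi x.
have dp0 x := @test_partial_eq0 phi i x.
rewrite (Rintegral_support leb mO KO); last by move=> x Kx; rewrite dp0// mulr0.
rewrite (Rintegral_support leb mO KO); last by move=> x Kx; rewrite p0// mulr0.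
have cu := lip_continuous uL.
have mu_ := rV_continuous_measurable cu.
have mdu := measurable_partial i cu.
have mphi := rV_continuous_measurable (test_continuous phiT).
have mdphi := rV_continuous_measurable (test_partial_continuous (i := i) phiT).
have [P P0 phiP] := test_bounded phiT.
have [Q Q0 dphiQ] := test_partial_bounded i phiT.
have duL x := lip_partial_le i x L0 uL.
have i1 := test_integrable phiT mu_ mdphi uB dphiQ dp0.
have i2 := test_integrable phiT mdu mphi duL phiP p0.
apply/eqP; rewrite -addr_eq0 -RintegralD//; apply/eqP.
rewrite /Rintegral (integral_ins i); last first.
  by under eq_fun do rewrite EFinD; exact: integrableD.
rewrite integral0_eq// => y _.
have [M M0 KM] := compact_normed_bounded (test_compact phiT).
have dphi1 t : derivable (fun s => phi (ins i s y)) t 1.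
  by apply: (derivable_ins phi i t y).1; apply: test_derivable; exact: phiT.
have dphiQ1 t : `|derive1 (fun s => phi (ins i s y)) t| <= Q.
  by rewrite -partial_ins.
have phi0 t : M + 1 <= `|t| -> phi (ins i t y) = 0.
  move=> Mt; apply: p0 => Kt.
  have := KM _ Kt; rewrite leNgt => /negP; apply.
  by rewrite (lt_le_trans _ (le_coord_norm _ i))// ins_at (lt_le_trans _ Mt)// ltrDl.
have M10 : 0 <= M + 1 by rewrite addr_ge0.
have := lip_ibp B0 P0 L0 Q0 M10 (lip_ins i y L0 uL) (fun t => uB (ins i t y))
  dphi1 dphiQ1 (fun t => phiP (ins i t y)) phi0.
by apply: etrans; apply: eq_integral => t _; rewrite !partial_ins.
Qed.

End weak_gradient.

(** * Hausdorff measure *)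

Section euclidean_norm.
Context (R : realType) (n : nat).

Lemma le_coord_enorm (x : 'rV[R]_n) i : `|x ord0 i| <= enorm x.
Proof.
rewrite -sqrtr_sqr ler_sqrt ?sqr_ge0//; last by apply: sumr_ge0 => *; exact: sqr_ge0.
by rewrite (bigD1 i)//= lerDl; apply: sumr_ge0 => *; exact: sqr_ge0.
Qed.

End euclidean_norm.

Section hausdorff_metric.
Local Open Scope ereal_scope.
Context (R : realType) (n m : nat).
Implicit Types A B X : set 'rV[R]_n.
Local Notation H := (@hausdorff_outer R n m).

Lemma hausdorff_pre_antitone d d' A : (d <= d')%R ->
  @hausdorff_pre R n m d' A <= @hausdorff_pre R n m d A.
Proof.
move=> dd'; apply: ereal_inf_le_tmp => _ [C [AC Cd] <-]; exists C => //.
by split => // k; rewrite (le_trans (Cd k))// lee_fin.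
Qed.

(** A set of diameter at most [d] cannot meet both [A] and [B], so a cover of the union splits into
    disjoint subfamilies covering each. *)
Lemma hausdorff_pre_separated d A B :
  (forall x y, A x -> B y -> (d < enorm (x - y))%R) ->
  @hausdorff_pre R n m d A + @hausdorff_pre R n m d B <= @hausdorff_pre R n m d (A `|` B).
Proof.
move=> sepAB; apply: le_ereal_inf_tmp => _ [C [ABC Cd] <-].
pose CA k := if `[< C k `&` A !=set0 >] then C k else set0.
pose CB k := if `[< C k `&` B !=set0 >] then C k else set0.
have size0 k : 0 <= @hausdorff_size R n m (C k) by exact: hausdorff_size_ge0.
have sizeA k : 0 <= @hausdorff_size R n m (CA k) by exact: hausdorff_size_ge0.
have sizeB k : 0 <= @hausdorff_size R n m (CB k) by exact: hausdorff_size_ge0.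
have leA : @hausdorff_pre R n m d A <= \sum_(0 <= k <oo) @hausdorff_size R n m (CA k).
  apply: ereal_inf_lbound; exists CA => //; split.
    move=> x Ax; have [|k _ Cx] := ABC x; first by left.
    by exists k => //; rewrite /CA; case: asboolP => // -[]; exists x.
  by move=> k; rewrite /CA; case: ifP => // _; rewrite ediam0 leNye.
have leB : @hausdorff_pre R n m d B <= \sum_(0 <= k <oo) @hausdorff_size R n m (CB k).
  apply: ereal_inf_lbound; exists CB => //; split.
    move=> x Bx; have [|k _ Cx] := ABC x; first by right.
    by exists k => //; rewrite /CB; case: asboolP => // -[]; exists x.
  by move=> k; rewrite /CB; case: ifP => // _; rewrite ediam0 leNye.
apply: (le_trans (leeD leA leB)).
rewrite -nneseriesD//; apply: lee_nneseries => k _; first by move=> _; exact: adde_ge0.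
rewrite /CA /CB; case: asboolP => [[x [Cx Ax]]|_]; case: asboolP => [[y [Cy By]]|_];
  rewrite ?hausdorff_size0 ?adde0 ?add0e//.
have := Cd k; rewrite leNgt => /negP; case.
apply: (@lt_le_trans _ _ (enorm (x - y))%:E); first by rewrite lte_fin; exact: sepAB.
by apply: ereal_sup_ubound; exists (x, y).
Qed.

(** The premeasure increases as the scale shrinks, so a single scale below [d1], [d2] and [e] serves
    both suprema on the left. *)
Lemma hausdorff_separated (e : R) A B : (0 < e)%R ->
  (forall x y, A x -> B y -> (e <= enorm (x - y))%R) ->
  H A + H B <= H (A `|` B).
Proof.
move=> e0 sepAB.
have pre_le d : (0 < d < e)%R ->
    @hausdorff_pre R n m d A + @hausdorff_pre R n m d B <= H (A `|` B).
  move=> /andP[d0 de]; apply: (le_trans (@hausdorff_pre_separated d A B _)).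
    by move=> x y Ax By; exact: lt_le_trans (sepAB _ _ Ax By).
  exact: hausdorff_pre_le.
have [->|AB] := eqVneq (H (A `|` B)) +oo; first exact: leey.
have fAB : H (A `|` B) \is a fin_num.
  by rewrite ge0_fin_numE ?outer_measure_ge0// ltey.
have fS X : X `<=` A `|` B -> H X \is a fin_num.
  move=> XAB; rewrite ge0_fin_numE ?outer_measure_ge0//.
  by rewrite (le_lt_trans (le_outer_measure H _ _ XAB))// ltey.
have fA : H A \is a fin_num by apply: fS => x; left.
have fB : H B \is a fin_num by apply: fS => x; right.
rewrite -leeBrDr//; apply: ge_ereal_sup => _ [d1 d10 <-].
have fp1 : @hausdorff_pre R n m d1 A \is a fin_num.
  rewrite ge0_fin_numE ?hausdorff_pre_ge0//.
  by rewrite (le_lt_trans (@hausdorff_pre_le R n m d1 A d10))// -ge0_fin_numE ?outer_measure_ge0.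
rewrite leeBrDr// addeC -leeBrDr//; apply: ge_ereal_sup => _ [d2 d20 <-].
rewrite leeBrDr// addeC.
pose d := (Num.min (e / 2) (Num.min d1 d2))%R.
have d0 : (0 < d)%R by rewrite !lt_min divr_gt0//= d10 d20.
apply: (le_trans _ (pre_le d _)).
  by apply: leeD; apply: hausdorff_pre_antitone; rewrite !ge_min lexx ?orbT.
by rewrite d0/= gt_min; apply/orP; left; rewrite ltr_pdivrMr// ltr_pMr// ltr1n.
Qed.

(** Caratheodory's criterion for metric outer measures. The half-space is at positive distance from
    [T k], the part of [X] beyond the shifted hyperplane [a k]. What lies between is cut into layers
    [D j] whose masses are summable, so the part not yet reached by [T k] has mass tending to 0. *)
Lemma hausdorff_caratheodory_halfspace (i : 'I_n) (c : R) :
  caratheodory_measurable H [set x | (x ord0 i <= c)%R].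
Proof.
apply: le_caratheodory_measurable => X.
set S := mkset _.
have [->|XE] := eqVneq (H X) +oo; first exact: leey.
have Xoo : H X < +oo by rewrite ltey.
pose a k : R := (c + k.+1%:R^-1)%R.
have a_lt j k : (j < k)%N -> (a k < a j)%R.
  by move=> jk; rewrite ltrD2l ltf_pV2 ?posrE// ltr_nat.
have a_le j k : (j <= k)%N -> (a k <= a j)%R.
  by move=> jk; rewrite lerD2l lef_pV2 ?posrE// ler_nat.
pose T k := X `&` [set x | (a k <= x ord0 i)%R].
pose D k := X `&` [set x | (a k.+1 <= x ord0 i < a k)%R].
have sep (s t : R) (A B : set 'rV[R]_n) : (s < t)%R ->
    (forall x, A x -> (x ord0 i <= s)%R) -> (forall x, B x -> (t <= x ord0 i)%R) ->
    H A + H B <= H (A `|` B).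
  move=> st As Bt; apply: (@hausdorff_separated (t - s)); first by rewrite subr_gt0.
  move=> x y /As xs /Bt yt; rewrite (le_trans _ (le_coord_enorm _ i))// !mxE.
  by rewrite ler_normr; apply/orP; right; lra.
have HS k : H (X `&` S) + H (T k) <= H X.
  apply: (le_trans (@sep c (a k) _ _ _ _ _)).
  - by rewrite /a ltrDl.
  - by move=> x [].
  - by move=> x [].
  - by apply: le_outer_measure => x [[]|[]].
have HD k : H (D k.+1) + H (T k) <= H (T k.+2).
  apply: (le_trans (@sep (a k.+1) (a k) _ _ _ _ _)).
  - exact: a_lt.
  - by move=> x [_ /andP[_ /ltW]].
  - by move=> x [].
  - apply: le_outer_measure => x [[Xx /andP[ax _]]|[Xx ax]]; split => //=.
    by rewrite (le_trans _ ax)// a_le// leqW.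
(* Consecutive layers touch, but layers two apart are separated: even and odd indices telescope
   separately, whence the two terms on the right. *)
have HDsum N : \sum_(k < N) H (D k.+1) <= H (T N) + H (T N.+1).
  elim: N => [|N IH]; first by rewrite big_ord0 adde_ge0// outer_measure_ge0.
  rewrite big_ord_recr/= (le_trans (leeD IH (lexx _)))//.
  rewrite [H (T N) + _]addeC -addeA leeD// addeC; exact: HD.
have TX k : H (T k) <= H X by apply: le_outer_measure => x [].
have sumoo : \sum_(0 <= k <oo) H (D k.+1) < +oo.
  apply: (@le_lt_trans _ _ (H X + H X)); last by rewrite lte_add_pinfty.
  apply: lime_le; first by apply: is_cvg_nneseries => *; exact: outer_measure_ge0.
  by apply: nearW => N; rewrite big_mkord (le_trans (HDsum N))// leeD.
have tail := nneseries_tail_cvg sumoo (fun k _ => outer_measure_ge0 H (D k.+1)).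
have HT k : H (X `&` ~` S) <= H (T k.+1) + \sum_(k <= j <oo) H (D j.+1).
  have sub : X `&` ~` S `<=` T k.+1 `|` \bigcup_(j in ~` `I_k) D j.+1.
    move=> x [Xx /negP]; rewrite -ltNge => cx.
    have [ax|ax] := leP (a k.+1) (x ord0 i); [by left|right].
    pose P N := (a N <= x ord0 i)%R.
    have ex : exists N, P N.
      near \oo => N; exists N; rewrite /P /a -lerBrDl; apply: ltW; near: N.
      have xc0 : (0 < x ord0 i - c)%R by rewrite subr_gt0.
      exact: (near_infty_natSinv_lt (PosNum xc0)).
    case: (ex_minnP ex) => -[|N] aN Nmin; rewrite /P in aN Nmin.
      by move: ax; rewrite ltNge (le_trans _ aN)// a_le.
    have xaN : (x ord0 i < a N)%R.
      by rewrite ltNge; apply/negP => /Nmin; rewrite ltnn.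
    have kN : (k < N)%N.
      rewrite ltnNge; apply/negP => Nk; move: ax; rewrite ltNge (le_trans _ aN)//.
      by rewrite a_le.
    (* Here [N.+1] is the least index whose hyperplane [x] has reached, so [x] lies in the layer
       [D N]; the tail is indexed by [D j.+1]. *)
    exists N.-1; first by move=> /=; lia.
    by rewrite (ltn_predK kN); split => //=; rewrite aN xaN.
  apply: (le_trans (le_outer_measure H _ _ sub)).
  apply: (le_trans (outer_measureU2 _ _ _)); apply: leeD => //.
  exact: outer_measure_sigma_subadditive_tail.
have HST k : H (X `&` S) + H (X `&` ~` S) <= H X + \sum_(k <= j <oo) H (D j.+1).
  apply: (@le_trans _ _ (H (X `&` S) + (H (T k.+1) + \sum_(k <= j <oo) H (D j.+1)))).
    by apply: leeD.
  by rewrite addeA leeD.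
have : (fun k => H X + \sum_(k <= j <oo) H (D j.+1)) @ \oo --> H X + 0.
  apply: cvgeD => //; last exact: cvg_cst.
  by rewrite fin_num_adde_defl.
rewrite adde0 => /cvg_lim <- //; apply: lime_ge.
  by apply/cvg_ex; exists (H X + 0); apply: cvgeD => //; [rewrite fin_num_adde_defl|exact: cvg_cst].
by apply: nearW => k; exact: HST.
Unshelve. all: by end_near. Qed.

End hausdorff_metric.

Section hausdorff_borel.
Local Open Scope ereal_scope.
Context (R : realType) (n m : nat).
Local Notation H := (@hausdorff_outer R n m).

Lemma hausdorff_borel (A : set 'rV[R]_n) : measurable A ->
  measurable (A : set (caratheodory_type H)).
Proof.
apply: (@measurable_rV_ind R n (caratheodory_measurable H)); last first.
  by move=> i c; exact: hausdorff_caratheodory_halfspace.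
split.
- exact: caratheodory_measurable_set0.
- by move=> B mB; rewrite setTD; exact: caratheodory_measurable_setC.
- by move=> F mF; exact: caratheodory_measurable_bigcup.
Qed.

Lemma hausdorff_measurable_fun (h : 'rV[R]_n -> R) (D : set 'rV[R]_n) :
  measurable_fun setT h -> measurable_fun (D : set (caratheodory_type H)) h.
Proof.
move=> mh; apply: measurable_funTS => _ Y mY; rewrite setTI.
by apply: hausdorff_borel; rewrite -[X in measurable X]setTI; exact: mh.
Qed.

End hausdorff_borel.

Lemma measurable_enorm_comp d (T : measurableType d) (R : realType) (n : nat)
    (D : set T) (g : T -> 'rV[R]_n) :
  (forall i, measurable_fun D (fun x => g x ord0 i)) ->
  measurable_fun D (fun x => enorm (g x)).
Proof.
move=> mg; apply: (@measurableT_comp _ _ _ _ _ _ (@Num.sqrt R)).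
  by apply: continuous_measurable_fun; exact: sqrt_continuous.
by apply: measurable_sum => i; apply: measurable_funX; exact: mg.
Qed.

Section hausdorff_projection.
Local Open Scope ereal_scope.
Context (R : realType) (m : nat).
Local Notation leb := (@lebesgue_rV R m).

(* The volume of the cube of half-side [1 / (m + 1)], which lies in the unit ball. *)
Definition ball_lb : R := (2 * m.+1%:R^-1) ^+ m.

Lemma ball_lb_gt0 : (0 < ball_lb)%R.
Proof. by rewrite exprn_gt0// mulr_gt0// invr_gt0. Qed.

Lemma measurable_enorm : measurable_fun setT (@enorm R m).
Proof.
apply: measurable_enorm_comp => i; exact: measurable_coord_rV.
Qed.

Lemma ball_lb_le : ball_lb%:E <= leb [set z | (enorm z <= 1)%R].
Proof.
have i0 : (0 <= m.+1%:R^-1 :> R)%R by rewrite invr_ge0.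
rewrite /ball_lb -(lebesgue_rV_cube 0 i0).
apply: le_measure; rewrite ?inE.
- exact: measurable_rV_cube.
- rewrite (_ : mkset _ = @enorm R m @^-1` `]-oo, 1%R]).
    by rewrite -[X in measurable X]setTI; apply: measurable_enorm => //; exact: measurable_itv.
  by apply/seteqP; split => x /=; rewrite in_itv.
- move=> x xc /=; rewrite -[X in (_ <= X)%R]sqrtr1 ler_wsqrtr//.
  apply: (@le_trans _ _ (\sum_(i < m) m.+1%:R^-1)%R).
    apply: ler_sum => i _; have := xc i; rewrite mxE subr0 => xi.
    rewrite -real_normK ?num_real// expr2 -[leRHS]mulr1 ler_pM//.
    by rewrite (le_trans xi)// invf_le1// ler1n.
  rewrite sumr_const card_ord -[leLHS]mulr_natl ler_pdivrMr ?ltr0n// mul1r ler_nat.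
  exact: leqnSn.
Qed.

(** Each covering set projects into a cube whose half-side is its diameter. Such a cube has volume
    [(2 diam)^m], which is [4 ^+ m] times the [(diam / 2)^m] of the normalization; [ball_lb] stands
    for the volume of the unit ball, which it bounds from below. *)
Lemma hausdorff_del (i : 'I_m.+1) (S : set 'rV[R]_m.+1) : measurable (del i @` S) ->
  ball_lb%:E * leb (del i @` S) <= (4 ^+ m)%:E * @hausdorff_outer R m.+1 m S.
Proof.
(* Any fixed scale would do: the scale 1 only makes the diameters finite. *)
move=> mS; apply: (@le_trans _ _ ((4 ^+ m)%:E * @hausdorff_pre R m.+1 m 1 S)); last first.
  by rewrite lee_pmul2l// ?lte_fin ?exprn_gt0//; exact: hausdorff_pre_le.
rewrite -ereal_inf_pZl ?exprn_gt0//; apply: le_ereal_inf_tmp => _ [_ [C [SC Cd] <-] <-].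
have /choice[c cP] (k : nat) : exists x, C k !=set0 -> C k x.
  have [[x Cx]|nC] := pselect (C k !=set0); first by exists x.
  by exists 0%R.
have dfin k : C k !=set0 -> (0 <= fine (ediam (C k)))%R /\ ediam (C k) = (fine (ediam (C k)))%:E.
  move=> [x Cx]; have e0 : 0 <= ediam (C k).
    apply: (@le_trans _ _ (enorm (x - x))%:E); first by rewrite lee_fin enorm_ge0.
    by apply: ereal_sup_ubound; exists (x, x).
  by rewrite fine_ge0// fineK// ge0_fin_numE// (le_lt_trans (Cd k))// ltry.
(* An empty [C k] must get the empty set: in dimension 0 even a cube of half-side 0 has volume 1. *)
pose Q k := if `[< C k !=set0 >] then rV_cube (del i (c k)) (fine (ediam (C k))) else set0.
have mQ k : measurable (Q k) by rewrite /Q; case: ifP => // _; exact: measurable_rV_cube.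
apply: (@le_trans _ _ (ball_lb%:E * \sum_(0 <= k <oo) leb (Q k))).
  rewrite lee_pmul2l// ?lte_fin ?ball_lb_gt0//.
  apply: measure_sigma_subadditive => // _ [x Sx <-].
  have [k _ Cx] := SC _ Sx; exists k => //; rewrite /Q.
  case: asboolP => [Ck|]; last by case; exists x.
  move=> j; rewrite !mxE.
  have [_ dE] := dfin k Ck.
  rewrite -lee_fin -dE; apply: (@le_trans _ _ (enorm (x - c k))%:E).
    have := le_coord_enorm (x - c k) (lift i j).
    by rewrite !mxE lee_fin.
  by apply: ereal_sup_ubound; exists (x, c k) => //; split => //=; exact: cP.
rewrite -!nneseriesZl//; last by move=> k _; exact: hausdorff_size_ge0.
apply: lee_nneseries => k _.
  by move=> _; rewrite mule_ge0// lee_fin ltW// ball_lb_gt0.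
rewrite /Q /hausdorff_size; case: asboolP => [Ck|nC]; last first.
  rewrite measure0 mule0 mule_ge0 ?lee_fin ?exprn_ge0//.
  exact: (hausdorff_size_ge0 m (C k)).
have [d0 dE] := dfin k Ck.
rewrite lebesgue_rV_cube//; case: ifPn => [/eqP C0|_]; first by case: Ck => x; rewrite C0.
rewrite dE -EFinM -EFin_expe muleCA -EFinM.
apply: (@le_trans _ _ (ball_lb%:E * (4 ^+ m * (2^-1 * fine (ediam (C k))) ^+ m)%:E)).
  rewrite -EFinM lee_fin ler_pM2l ?ball_lb_gt0// -exprMn.
  by rewrite (_ : 4 * _ = 2 * fine (ediam (C k)))%R//; lra.
apply: lee_wpmul2r; last exact: ball_lb_le.
by rewrite lee_fin mulr_ge0// exprn_ge0// mulr_ge0.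
Qed.

End hausdorff_projection.

(** * The coarea inequality *)

Section inner_regularity.
Local Open Scope ereal_scope.
Context (R : realType) (n : nat) (nu : {finite_measure set 'rV[R]_n -> \bar R}).
Implicit Types A : set 'rV[R]_n.

Definition inner_closed A := measurable A /\ forall e : R, (0 < e)%R ->
  exists F, [/\ closed F, F `<=` A & nu (A `\` F) < e%:E].

Lemma closed_inner_closed A : closed A -> inner_closed A.
Proof.
move=> cA; split; first exact: rV_closed_measurable.
by move=> e e0; exists A; split => //; rewrite setDv measure0 lte_fin.
Qed.

Let choose_closed (F : (set 'rV[R]_n)^nat) (e : R) : (0 < e)%R -> (forall k, inner_closed (F k)) ->
  exists C : (set 'rV[R]_n)^nat, [/\ forall k, closed (C k), forall k, C k `<=` F k &
    \sum_(0 <= k <oo) nu (F k `\` C k) <= e%:E].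
Proof.
move=> e0 iF.
have /choice[C CP] (k : nat) : exists C, [/\ closed C, C `<=` F k & nu (F k `\` C) < (e / (2 ^ k.+1)%:R)%:E].
  have ek : (0 < e / (2 ^ k.+1)%:R)%R by rewrite divr_gt0// ltr0n expn_gt0.
  exact: (iF k).2 _ ek.
exists C; split => [k|k|]; [by case: (CP k)|by case: (CP k)|].
apply: le_trans (@epsilon_trick0 R e xpredT (ltW e0)).
apply: lee_nneseries => [k _ _|k _]; first exact: measure_ge0.
by rewrite ltW//; case: (CP k).
Qed.

Lemma inner_closed_bigcap (F : (set 'rV[R]_n)^nat) : (forall k, inner_closed (F k)) ->
  inner_closed (\bigcap_k F k).
Proof.
move=> iF; have mF k : measurable (F k) by case: (iF k).
split; first exact: bigcapT_measurable.
move=> e e0; have e20 : (0 < e / 2)%R by rewrite divr_gt0.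
have [C [cC CF sumC]] := choose_closed e20 iF.
have mC k : measurable (C k) by exact: rV_closed_measurable.
exists (\bigcap_k C k); split.
- exact: closed_bigI.
- by move=> x Cx k _; apply: CF; exact: Cx.
apply: (@le_lt_trans _ _ (e / 2)%:E); last by rewrite lte_fin ltr_pdivrMr// ltr_pMr// ltr1n.
apply: le_trans sumC; apply: measure_sigma_subadditive.
- by move=> k; exact: measurableD.
- by apply: measurableD; exact: bigcapT_measurable.
- move=> x [Fx /existsNP[k /not_implyP[_ nCx]]]; exists k => //; split => //; exact: Fx.
Qed.

(** A countable union of closed sets need not be closed, so finitely many of them are kept;
    continuity from above of the finite measure [nu] controls what is lost by the truncation. *)
Lemma inner_closed_bigcup (F : (set 'rV[R]_n)^nat) : (forall k, inner_closed (F k)) ->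
  inner_closed (\bigcup_k F k).
Proof.
move=> iF; have mF k : measurable (F k) by case: (iF k).
have mUF : measurable (\bigcup_k F k) by exact: bigcupT_measurable.
split => // e e0; have e20 : (0 < e / 2)%R by rewrite divr_gt0.
have [C [cC CF sumC]] := choose_closed e20 iF.
have mC k : measurable (C k) by exact: rV_closed_measurable.
pose B N := \bigcup_k F k `\` \big[setU/set0]_(k < N) C k.
have mB N : measurable (B N) by apply: measurableD => //; exact: bigsetU_measurable.
have Blim : nu (\bigcap_N B N) < e%:E.
  apply: (@le_lt_trans _ _ (e / 2)%:E); last by rewrite lte_fin ltr_pdivrMr// ltr_pMr// ltr1n.
  apply: le_trans sumC; apply: measure_sigma_subadditive.
  - by move=> k; exact: measurableD.
  - exact: bigcapT_measurable.
  - move=> x Bx; have [[k _ Fx] _] := Bx 0%N I.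
    exists k => //; split => // Cx; have [_] := Bx k.+1 I; apply.
    by rewrite big_ord_recr/=; right.
have : nu \o B @ \oo --> nu (\bigcap_N B N).
  apply: nonincreasing_cvg_mu => //.
  - by rewrite ltey_eq fin_num_measure.
  - exact: bigcapT_measurable.
  - move=> a b ab; apply/subsetPset => x [Fx nC]; split => // Cx; apply: nC.
    rewrite -bigcup_mkord in Cx; rewrite -bigcup_mkord; case: Cx => k /= ka Ck.
    by exists k => //=; rewrite (leq_trans ka).
move=> /(_ [set x | x < e%:E]) [].
  by apply: open_nbhs_nbhs; split => //; exact: open_ereal_lt_ereal.
move=> N _ HN; exists (\big[setU/set0]_(k < N) C k); split.
- by rewrite -bigcup_mkord; apply: closed_bigcup => // *; exact: finite_II.
- by rewrite -bigcup_mkord => x [k _ /CF Fx]; exists k.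
- exact: (HN N (leqnn N)).
Qed.

Lemma measurable_inner_closed A : measurable A -> inner_closed A.
Proof.
suff : measurable A -> inner_closed A /\ inner_closed (~` A) by move=> H /H[].
apply: (@measurable_rV_ind R n (fun A => inner_closed A /\ inner_closed (~` A))).
  split.
  - split; first by apply: closed_inner_closed; exact: closed0.
    by rewrite setC0; apply: closed_inner_closed; exact: closedT.
  - by move=> B [iB iCB]; rewrite setTD setCK.
  - move=> F iF; split; first by apply: inner_closed_bigcup => k; case: (iF k).
    by rewrite setC_bigcup; apply: inner_closed_bigcap => k; case: (iF k).
move=> i c; split.
  apply: closed_inner_closed.
  have /continuous_closedP : continuous (fun x : 'rV[R]_n => x ord0 i) by exact: coord_continuous.
  by move=> /(_ _ (@closed_le _ c)).
have -> : ~` [set x : 'rV[R]_n | (x ord0 i <= c)%R] = \bigcup_k [set x : 'rV[R]_n | (c + k.+1%:R^-1 <= x ord0 i)%R].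
  apply/seteqP; split => x /=.
    move=> /negP; rewrite -ltNge => cx.
    near \oo => N; exists N => //=; rewrite -lerBrDl; apply: ltW; near: N.
    have xc0 : (0 < x ord0 i - c)%R by rewrite subr_gt0.
    exact: (near_infty_natSinv_lt (PosNum xc0)).
  by move=> [k _ /= ck]; apply/negP; rewrite -ltNge (lt_le_trans _ ck)// ltrDl.
apply: inner_closed_bigcup => k; apply: closed_inner_closed.
have /continuous_closedP : continuous (fun x : 'rV[R]_n => x ord0 i) by exact: coord_continuous.
by move=> /(_ _ (@closed_ge _ (c + k.+1%:R^-1)%R)).
Unshelve. all: by end_near. Qed.

End inner_regularity.

(** Inner regularity is applied to the restriction of Lebesgue measure to [A], which is finite
    because [A] is bounded. *)
Lemma lebesgue_rV_inner_compact (R : realType) (n : nat) (A : set 'rV[R]_n) (M e : R) :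
  measurable A -> (forall x, A x -> `|x| <= M) -> 0 < e ->
  exists P, [/\ compact P, P `<=` A & (@lebesgue_rV R n (A `\` P) < e%:E)%E].
Proof.
move=> mA AM e0.
have Aoo := bounded_lebesgue_rV_lty mA AM.
have [_ /(_ _ e0)[F [cF FA Fe]]] := measurable_inner_closed (mfrestr mA Aoo) mA.
exists F; split => //; first by apply: (rV_compactP cF) => x /FA /AM; exact.
have <- : (A `\` F) `&` A = A `\` F by rewrite setIidl//; exact: subDsetl.
exact: Fe.
Qed.

(** * Slices of the image of a compact set *)

Section compact_slices.
Local Open Scope ereal_scope.
Context (R : realType).
Local Notation mu := (@lebesgue_measure R).

Lemma lebesgue_measure_diam (A : set R) (l : R) : measurable A -> (0 <= l)%R ->
  (forall s t, A s -> A t -> (`|s - t| <= l)%R) -> mu A <= l%:E.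
Proof.
move=> mA l0 Al; have [->|/set0P[s0 As0]] := eqVneq A set0; first by rewrite measure0 lee_fin.
have lbA : has_lbound A.
  exists (s0 - l)%R => t At; have := Al _ _ As0 At; rewrite ler_norml => /andP[]; lra.
pose m := inf A.
apply: (@le_trans _ _ (mu `[m, (m + l)%R])).
  apply: le_measure; rewrite ?inE//.
  move=> s As; rewrite /= in_itv/= ge_inf//= -lerBlDr.
  apply: lb_le_inf; first by exists s0.
  by move=> t At; have := Al _ _ As At; rewrite ler_norml => /andP[]; lra.
rewrite lebesgue_measure_itv/= lte_fin; case: ifP => _; last by rewrite lee_fin.
by rewrite -EFinB lee_fin; lra.
Qed.

Lemma lebesgue_measure_expand (A : set R) (g : R -> R) (k : R) : measurable A -> (0 < k)%R ->
  measurable_fun setT g ->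
  (forall s t, A s -> A t -> (k * `|s - t| <= `|g s - g t|)%R) ->
  k%:E * mu A <= mu (g @` A).
Proof.
move=> mA k0 mg Ag.
rewrite {2}/mu /lebesgue_stieltjes_measure /measure_extension.
apply: le_ereal_inf_tmp => _ [F [mF AF] <-].
pose B j := A `&` g @^-1` (F j).
have mFj j : measurable (F j : set R).
  by apply: sub_sigma_algebra; exact: mF.
have mB j : measurable (B j).
  by apply: measurableI => //; rewrite -[X in measurable X]setTI; exact: mg.
apply: (@le_trans _ _ (k%:E * \sum_(0 <= j <oo) mu (B j))).
  rewrite lee_pmul2l//; apply: measure_sigma_subadditive => //.
  by move=> s As; have [j _ Fj] := AF (g s) ltac:(by exists s); exists j.
rewrite -nneseriesZl//; apply: lee_nneseries => [j _ _|j _].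
  by rewrite mule_ge0// lee_fin ltW.
have [[a b] _ /= Fab] := mF j.
have [ab|ba] := leP a b; last first.
  have F0 : F j = set0 by rewrite -Fab set_itv_ge// bnd_simp -leNgt ltW.
  rewrite /B F0 preimage_set0 setI0 measure0 mule0; exact: (@wlength_ge0 R idfun).
have wE : wlength idfun (F j) = (b - a)%:E.
  by rewrite -Fab; exact: (wlength_itv_bnd idfun).
have : k%:E * mu (B j) <= (b - a)%:E.
  rewrite -lee_pdivlMl// -EFinM; apply: lebesgue_measure_diam => //.
    by rewrite mulr_ge0// ?invr_ge0 ?(ltW k0)// subr_ge0.
  move=> s t [As Fs] [At Ft]; rewrite ler_pdivlMl// (le_trans (Ag _ _ As At))//.
  move: Fs Ft; rewrite /= -Fab /= !in_itv/= => /andP[? ?] /andP[? ?].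
  by rewrite ler_norml; apply/andP; split; lra.
by rewrite -wE.
Qed.

Lemma continuous_ins_del (n : nat) (i : 'I_n.+1) (f : 'rV[R]_n.+1 -> R) :
  continuous f -> continuous (fun x => ins i (f x) (del i x)).
Proof.
move=> cf x; have FF : Filter (nbhs x) by exact: nbhs_filter.
apply/cvgrPdist_le => e e0.
have nx : \forall y \near x, (`|x - y| <= e)%R.
  by have /cvgrPdist_le := @cvg_id _ (nbhs x); exact.
have nf : \forall y \near x, (`|f x - f y| <= e)%R by have /cvgrPdist_le := cf x; exact.
apply: filterS2 nx nf => y xy fxy; apply: rV_norm_le; first exact: ltW.
move=> k; rewrite !mxE; case: unlift => [j|//].
rewrite !mxE; apply: (@le_trans _ _ (`|x - y|)%R) => //.
by have := le_coord_norm (x - y)%R (lift i j); rewrite !mxE.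
Qed.

Section slices.
Variables (n : nat) (i : 'I_n.+1) (f : 'rV[R]_n.+1 -> R) (P : set 'rV[R]_n.+1) (k : R).
Hypotheses (cP : compact P) (cf : continuous f) (k0 : (0 < k)%R).
Hypothesis expand : forall x x', P x -> P x' -> del i x = del i x' ->
  (k * `|x ord0 i - x' ord0 i| <= `|f x - f x'|)%R.
Local Notation leb := (@lebesgue_rV R).

Let Phi x := ins i (f x) (del i x).
Let Q := Phi @` P.
Definition slice t := del i @` (P `&` f @^-1` [set t]).

Let mQ : measurable Q.
Proof.
apply: rV_closed_measurable; apply: compact_closed; first exact: norm_hausdorff.
by apply: continuous_compact => //; apply: continuous_subspaceT; exact: continuous_ins_del.
Qed.

Let sliceE t : slice t = [set y | Q (ins i t y)].
Proof.
apply/seteqP; split => y /=; first by move=> [x [Px <-] <-]; exists x.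
by move=> [x Px] /ins_inj[ft dy]; exists x.
Qed.

Let mQins : measurable ((fun z : measurableTypeR R * 'rV[R]_n => ins i z.1 z.2) @^-1` Q).
Proof. exact: measurable_preimage_ins. Qed.

(** Compactness of [P] is what makes this true: [Q] is then compact, hence Borel, and the slices of
    [P] are the coordinate sections of [Q]. *)
Lemma measurable_slice t : measurable (slice t).
Proof.
rewrite sliceE; have := measurable_xsection t mQins.
by congr (measurable _); apply/seteqP; split => y; rewrite /xsection/= inE.
Qed.

Lemma measurable_fun_slice : measurable_fun setT (fun t => leb (slice t)).
Proof.
have := measurable_fun_xsection (leb (n := n)) mQins.
congr measurable_fun; apply/funext => t; congr (leb _).
by rewrite sliceE; apply/seteqP; split => y; rewrite /xsection/= inE.
Qed.

(* The slices are those of the image of [P] under replacing the i-th coordinate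
   of x by [f x]. *)
Lemma le_lebesgue_slices : k%:E * leb P <= \int[mu]_t leb (slice t).
Proof.
have mP : measurable P.
  by apply: rV_closed_measurable; apply: compact_closed => //; exact: norm_hausdorff.
have -> : \int[mu]_t leb (slice t) = leb Q.
  rewrite (lebesgue_rV_insE i mQ); apply: eq_integral => t _; by rewrite sliceE.
have mysec (A : set 'rV[R]_n.+1) y : measurable A -> measurable [set t | A (ins i t y)].
  move=> mA; have := measurable_ysection y (measurable_preimage_ins i mA).
  by congr (measurable _); apply/seteqP; split => t; rewrite /ysection/= inE.
have mfysec (A : set 'rV[R]_n.+1) : measurable A ->
    measurable_fun setT (fun y => mu [set t | A (ins i t y)]).
  move=> mA; have := measurable_fun_ysection mu (measurable_preimage_ins i mA).
  congr measurable_fun; apply/funext => y; congr (mu _).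
  by apply/seteqP; split => t; rewrite /ysection/= inE.
rewrite (lebesgue_rV_lineE i mP) (lebesgue_rV_lineE i mQ).
rewrite -ge0_integralZl//; [|exact: mfysec|by rewrite lee_fin ltW].
- apply: ge0_le_integral => //.
  + by move=> y _; rewrite mule_ge0// lee_fin ltW.
  + by apply: measurable_funeM; exact: mfysec.
  + exact: mfysec.
  (* On the line above [y], the section of [Q] is the image of that of [P] under [f], which expands
     lengths by [k]. *)
  + move=> y _; rewrite (_ : [set t | Q (ins i t y)] =
      (fun s => f (ins i s y)) @` [set s | P (ins i s y)]).
      apply: lebesgue_measure_expand k0 _ _; first exact: (mysec P y mP).
        apply: (@measurableT_comp _ _ _ _ _ _ f _ (fun s : measurableTypeR R => ins i s y)).
          exact: rV_continuous_measurable.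
        apply: (@measurableT_comp _ _ _ _ _ _ (fun z : measurableTypeR R * 'rV[R]_n => ins i z.1 z.2)
          _ (fun s : measurableTypeR R => (s, y))).
          exact: measurable_ins.
        by apply/measurable_fun_pairP; split; [exact: measurable_id|exact: measurable_cst].
      move=> s t Ps Pt; have := expand Ps Pt; rewrite !insK !ins_at; exact.
    apply/seteqP; split => t /=.
      move=> [x Px] /ins_inj[<- dy]; exists (x ord0 i) => /=; by rewrite -dy delK.
    by move=> [s Ps <-]; exists (ins i s y) => //; rewrite /Phi insK.
Qed.

End slices.
End compact_slices.

(** * Comparison of volume with level integrals *)

Section coarea.
Local Open Scope ereal_scope.
Context (R : realType) (n : nat) (i : 'I_n.+1) (f h : 'rV[R]_n.+1 -> R) (L : R).
Hypotheses (L0 : (0 <= L)%R) (fL : lip L f).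
Hypotheses (mh : measurable_fun setT h) (h0 : forall x, (0 <= h x)%R).
Local Notation mu := (@lebesgue_measure R).
Local Notation leb n := (@lebesgue_rV R n).
Local Notation Hm := (@hausdorff_measure R n.+1 n).
Local Notation df := (partial i f).

Let cf : continuous f := lip_continuous fL.
Let mf : measurable_fun setT f := rV_continuous_measurable cf.
Let mdf : measurable_fun setT df := measurable_partial i cf.

Let mlevel (t : R) (B : set 'rV[R]_n.+1) : measurable B -> measurable (B `&` f @^-1` [set t]).
Proof.
move=> mB; apply: measurableI => //; rewrite -[X in measurable X]setTI.
exact: mf.
Qed.

Definition level_integral (B : set 'rV[R]_n.+1) (t : R) : \bar R :=
  \int[Hm]_(x in B `&` f @^-1` [set t]) (h x)%:E.

Lemma le_level_integral B B' t : measurable B -> measurable B' -> B `<=` B' ->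
  level_integral B t <= level_integral B' t.
Proof.
move=> mB mB' BB'; apply: ge0_subset_integral.
- by apply: hausdorff_borel; exact: mlevel.
- by apply: hausdorff_borel; exact: mlevel.
- by apply/measurable_EFinP; exact: hausdorff_measurable_fun.
- by move=> x _; rewrite lee_fin.
- by move=> x [/BB' ? ?].
Qed.

Lemma level_integral_bigcup (F : (set 'rV[R]_n.+1)^nat) t :
  (forall k, measurable (F k)) -> trivIset setT F ->
  level_integral (\bigcup_k F k) t = \sum_(0 <= k <oo) level_integral (F k) t.
Proof.
move=> mF tF; rewrite /level_integral setI_bigcupl.
apply: (@ge0_integral_bigcup _ (caratheodory_type (hausdorff_outer R n.+1 n)) R Hm
  (fun k => F k `&` f @^-1` [set t]) (fun x => (h x)%:E)).
- by move=> k; apply: hausdorff_borel; exact: mlevel.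
- by apply/measurable_EFinP; exact: hausdorff_measurable_fun.
- by move=> x _; rewrite lee_fin.
- exact: trivIset_setIr.
Qed.

(* [h] is here [|grad f|^(p-1)]; the second clause bounds from below how [f]
   stretches the lines parallel to the i-th axis. *)
Definition expanding (B : set 'rV[R]_n.+1) := exists q c : R,
  [/\ (0 < q)%R, (0 < c)%R,
    forall x, B x -> (`|df x| <= 2 * q)%R /\ (c <= h x <= 2 * c)%R &
    forall x x', B x -> B x' -> del i x = del i x' ->
      (q * `|x ord0 i - x' ord0 i| <= `|f x - f x'|)%R].

Lemma expandingS B B' : B' `<=` B -> expanding B -> expanding B'.
Proof.
move=> BB' [q [c [q0 c0 Bd Be]]]; exists q, c; split => //.
  by move=> x /BB' /Bd.
by move=> x x' /BB' + /BB'; exact: Be.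
Qed.

(* [4 ^+ n] comes from covering by cubes in [hausdorff_del]; 8 collects three
   factors 2, lost on [df], on [h] and in the passage to a compact subset. *)
Definition coarea_cst : R := (8 * 4 ^+ n)%R.

(** Since [B] is expanding with constants [q] and [c], the integrand is at most [4 q c], the slices
    recover [q] times the volume, and [c] bounds [h] from below on the level sets. [K] is a
    measurable substitute for the level integral. *)
Lemma expanding_coarea (B : set 'rV[R]_n.+1) (M : R) : measurable B ->
  (forall x, B x -> (`|x| <= M)%R) -> expanding B ->
  exists K : R -> \bar R, [/\ measurable_fun setT K, forall t, 0 <= K t,
    forall t, (ball_lb R n)%:E * K t <= coarea_cst%:E * level_integral B t &
    \int[leb n.+1]_(x in B) (`|df x| * h x)%:E <= \int[mu]_t K t].
Proof.
move=> mB BM [q [c [q0 c0 Bd Be]]].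
have Boo := bounded_lebesgue_rV_lty mB BM.
have Bfin : leb n.+1 B \is a fin_num by rewrite ge0_fin_numE.
(* [P] keeps at least half the volume of [B]. The null case is apart because the loss allowed must
   be positive. *)
have [P [cP PB lebP]] : exists P, [/\ compact P, P `<=` B & leb n.+1 B <= 2%:E * leb n.+1 P].
  have [B0|B0] := eqVneq (leb n.+1 B) 0.
    by exists set0; split => //; [exact: compact0|rewrite B0 measure0 mule0].
  have b0 : (0 < fine (leb n.+1 B) / 2)%R.
    by rewrite divr_gt0// fine_gt0// Boo andbT lt0e B0 measure_ge0.
  have [P [cP PB Pe]] := lebesgue_rV_inner_compact mB BM b0.
  exists P; split => //.
  have mP : measurable P.
    by apply: rV_closed_measurable; apply: compact_closed => //; exact: norm_hausdorff.
  have BE : leb n.+1 B = leb n.+1 P + leb n.+1 (B `\` P).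
    rewrite -measureU//; [by rewrite setDUK|exact: measurableD|by rewrite setDIK].
  have Pfin : leb n.+1 P \is a fin_num.
    by rewrite ge0_fin_numE// (le_lt_trans _ Boo)// le_measure ?inE.
  have Dfin : leb n.+1 (B `\` P) \is a fin_num.
    by rewrite ge0_fin_numE// (le_lt_trans _ Boo)// le_measure ?inE//; first [exact: measurableD|exact: subDsetl].
  move: Pe BE; rewrite -(fineK Pfin) -(fineK Dfin) -(fineK Bfin) lte_fin -EFinD -EFinM lee_fin.
  by move=> H1 [H2]; lra.
have mP : measurable P.
  by apply: rV_closed_measurable; apply: compact_closed => //; exact: norm_hausdorff.
have Pe x x' : P x -> P x' -> del i x = del i x' ->
    (q * `|x ord0 i - x' ord0 i| <= `|f x - f x'|)%R.
  by move=> Px Px'; apply: Be; exact: PB.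
(* The 8 is [2 * 2] from the upper bounds on the partial derivative and on [h], times 2 from the
   volume of [B] against that of [P]. *)
exists (fun t => (8 * c)%:E * leb n (slice i f P t)); split.
- by apply: measurable_funeM; exact: measurable_fun_slice.
- by move=> t; rewrite mule_ge0// lee_fin mulr_ge0// ltW.
- move=> t; rewrite muleCA.
  have ms := measurable_slice i cP cf t.
  apply: (@le_trans _ _ ((8 * c)%:E * ((4 ^+ n)%:E * @hausdorff_outer R n.+1 n (P `&` f @^-1` [set t])))).
    by rewrite lee_pmul2l ?lte_fin ?mulr_gt0//; exact: hausdorff_del.
  apply: (@le_trans _ _ (coarea_cst%:E * level_integral P t)); last first.
    by rewrite lee_pmul2l ?lte_fin ?mulr_gt0 ?exprn_gt0//; exact: le_level_integral.
  rewrite muleA -EFinM (_ : 8 * c * 4 ^+ n = coarea_cst * c)%R; last by rewrite /coarea_cst; ring.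
  rewrite EFinM -muleA lee_pmul2l ?lte_fin ?mulr_gt0 ?exprn_gt0//.
  have mPt : measurable (P `&` f @^-1` [set t] : set (caratheodory_type (hausdorff_outer R n.+1 n))).
    by apply: hausdorff_borel; exact: mlevel.
  have <- : \int[Hm]_(x in P `&` f @^-1` [set t]) (cst c%:E x) =
      c%:E * hausdorff_outer R n.+1 n (P `&` f @^-1` [set t]).
    exact: (integral_cst Hm mPt c%:E).
  apply: (@ge0_le_integral _ (caratheodory_type (hausdorff_outer R n.+1 n)) R Hm _ mPt
    (cst c%:E) (fun x => (h x)%:E)).
  + by move=> x _; rewrite lee_fin ltW.
  + exact: measurable_cst.
  + by apply/measurable_EFinP; exact: hausdorff_measurable_fun.
  + by move=> x [/PB /Bd[_ /andP[ch _]] _]; rewrite lee_fin.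
- apply: (@le_trans _ _ ((4 * q * c)%:E * leb n.+1 B)).
    have <- : \int[leb n.+1]_(x in B) (cst (4 * q * c)%:E x) = (4 * q * c)%:E * leb n.+1 B.
      exact: (integral_cst (leb n.+1) mB (4 * q * c)%:E).
    apply: ge0_le_integral => //.
    + by move=> x _; rewrite lee_fin mulr_ge0.
    + apply/measurable_EFinP/measurable_funTS/measurable_funM => //.
      exact: measurableT_comp.
    + move=> x /Bd[dq /andP[_ hc]]; rewrite lee_fin.
      by rewrite (_ : 4 * q * c = (2 * q) * (2 * c))%R; [exact: ler_pM|ring].
  apply: (@le_trans _ _ ((4 * q * c)%:E * (2%:E * leb n.+1 P))).
    by rewrite lee_pmul2l// lte_fin !mulr_gt0.
  rewrite ge0_integralZl//; [|exact: measurable_fun_slice|by rewrite lee_fin mulr_ge0// ltW].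
  apply: (@le_trans _ _ ((8 * c)%:E * (q%:E * leb n.+1 P))).
    by rewrite !muleA -!EFinM (_ : 4 * q * c * 2 = 8 * c * q)%R//; ring.
  rewrite lee_pmul2l ?lte_fin ?mulr_gt0//.
  exact: le_lebesgue_slices.
Qed.

End coarea.

Section coarea_cover.
Context (R : realType) (n : nat) (i : 'I_n.+1) (f h : 'rV[R]_n.+1 -> R) (L : R).
Hypotheses (L0 : 0 <= L) (fL : lip L f).
Hypotheses (mh : measurable_fun setT h) (h0 : forall x, 0 <= h x).
Variables (D : set 'rV[R]_n.+1) (mD : measurable D).
Local Notation df := (partial i f).
Local Notation e_i := (delta_mx ord0 i : 'rV[R]_n.+1).

Let cf : continuous f := lip_continuous fL.
Let mdf : measurable_fun setT df := measurable_partial i cf.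

(** A derivative larger than [q] only bounds the quotients at a scale depending on the point; [m]
    makes that scale uniform, and the set is closed. *)
Definition steep (q : R) (m : nat) := [set x | forall s : R, `|s| <= m.+1%:R^-1 ->
  q * `|s| <= `|f (s *: e_i + x) - f x|].

(** The rationals [q] and [c] fix the sizes of the partial derivative and of [h] up to a factor 2.
    The slab of index [l] has width [1 / (m + 1)], so two points of a piece on a line along the i-th
    axis are within the reach of [steep]. *)
Definition piece (k : rat * rat * nat * int) : set 'rV[R]_n.+1 :=
  let: (q, c, m, l) := k in
  D `&` ((fun x => `|df x|) @^-1` [set` `](ratr q), (2 * ratr q)]] `&`
  (h @^-1` [set` `[(ratr c), (2 * ratr c)]] `&`
  (steep (ratr q) m `&`
  (fun x => x ord0 i * m.+1%:R) @^-1` [set` `[l%:~R, (l + 1)%:~R[]))).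

Lemma closed_steep q m : closed (steep q m).
Proof.
rewrite (_ : steep q m = \bigcap_(s in [set s : R | `|s| <= m.+1%:R^-1])
   (fun x => `|f (s *: e_i + x) - f x|) @^-1` [set y | q * `|s| <= y]); last first.
  by apply/seteqP; split => x H s; exact: H.
apply: closed_bigI => s _.
have /continuous_closedP : continuous (fun x => `|f (s *: e_i + x) - f x|).
  exact: continuous_increment.
by move=> /(_ _ (@closed_ge _ (q * `|s|))).
Qed.

Lemma measurable_piece k : measurable (piece k).
Proof.
move: k => [[[q c] m] l]; apply: measurableI => //.
apply: measurableI.
  rewrite -[X in measurable X]setTI.
  have : measurable_fun setT (fun x => `|df x|) by exact: measurableT_comp.
  by apply => //; exact: measurable_itv.
apply: measurableI; first by rewrite -[X in measurable X]setTI; apply: mh => //; exact: measurable_itv.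
apply: measurableI; first by apply: rV_closed_measurable; exact: closed_steep.
rewrite -[X in measurable X]setTI.
have : measurable_fun setT (fun x : 'rV[R]_n.+1 => x ord0 i * m.+1%:R).
  by apply: measurable_funM => //; exact: measurable_coord_rV.
by apply => //; exact: measurable_itv.
Qed.

Lemma expanding_piece k : (0 < k.1.1.1) -> (0 < k.1.1.2) -> expanding i f h (piece k).
Proof.
move: k => [[[q c] m] l] /= q0 c0; exists (ratr q), (ratr c); split.
- by rewrite ltr0q.
- by rewrite ltr0q.
- move=> x [_ [/= dq [hc _]]]; move: dq hc; rewrite /= !in_itv/= => /andP[_ dq] hc; split=> //.
- move=> x x' [_ [_ [_ [sx xl]]]] [_ [_ [_ [_ xl']]]] xx'.
  have E : (x' ord0 i - x ord0 i) *: e_i + x = x'.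
    by rewrite -{2}(delK i x) ins_add subrK xx' delK.
  have := sx (x' ord0 i - x ord0 i); rewrite E [`|x ord0 i - _|]distrC [`|f x - _|]distrC; apply.
  move: xl xl'; rewrite /= !in_itv/= !rmorphD/= => /andP[a1 a2] /andP[b1 b2].
  rewrite -[leRHS]mul1r ler_pdivlMr// -(ger0_norm (ler0n R m.+1)) -normrM mulrBl.
  by rewrite ler_norml; apply/andP; split; lra.
Qed.

Lemma piece_cover x : D x -> 0 < `|df x| -> 0 < h x ->
  exists k, [/\ 0 < k.1.1.1, 0 < k.1.1.2 & piece k x].
Proof.
move=> Dx d0 hx0.
have [|q] := @rat_in_itvoo R (`|df x| / 2) `|df x|; first by rewrite ltr_pdivrMr// ltr_pMr// ltr1n.
rewrite in_itv/= => /andP[q1 q2].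
have q0 : 0 < ratr q :> R by rewrite (lt_trans _ q1)// divr_gt0.
have [|c] := @rat_in_itvoo R (h x / 2) (h x); first by rewrite ltr_pdivrMr// ltr_pMr// ltr1n.
rewrite in_itv/= => /andP[c1 c2].
have c0 : 0 < ratr c :> R by rewrite (lt_trans _ c1)// divr_gt0.
(* A nonzero derivative forces convergence, the default value being 0. *)
have cv : cvg (dquot f e_i s x @[s --> 0^']).
  apply/not_notP => nc; move: d0; rewrite /partial derive_dquotE dvgP//.
  by rewrite normr0 ltxx.
have : \forall s \near 0^', ratr q < `|dquot f e_i s x|.
  have : `|dquot f e_i s x| @[s --> 0^'] --> `|df x|.
    apply: (@cvg_comp _ _ _ _ Num.norm); last exact: norm_continuous.
    exact: cv.
  by move=> /cvgr_gt; apply.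
move=> /near_dnbhs0P[e e0 He].
have [m _ me] : exists2 m, True & m.+1%:R^-1 < e.
  near \oo => k; exists k => //; near: k; exact: near_infty_natSinv_lt (PosNum e0).
exists (q, c, m, Num.floor (x ord0 i * m.+1%:R)); split; rewrite /= -?(ltr0q R)//.
split => //; split; first by rewrite /= in_itv/=; apply/andP; split => //; lra.
split; first by rewrite /= in_itv/=; apply/andP; split; lra.
split.
  move=> s sm; have [->|s0] := eqVneq s 0; first by rewrite normr0 mulr0.
  have := He s; rewrite normr_gt0 s0 (le_lt_trans sm me) => /(_ isT).
  rewrite /dquot normrM normfV => /ltW; rewrite ler_pdivlMl ?normr_gt0//.
  by rewrite mulrC.
rewrite /= in_itv/=; apply/andP; split; first exact: Num.Theory.floor_le_tmp.
exact: Num.Theory.floorD1_gt.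
Unshelve. all: by end_near. Qed.

End coarea_cover.

Section coarea_inequality.
Local Open Scope ereal_scope.
Context (R : realType) (n : nat) (i : 'I_n.+1) (f h : 'rV[R]_n.+1 -> R) (L : R).
Hypotheses (L0 : (0 <= L)%R) (fL : lip L f).
Hypotheses (mh : measurable_fun setT h) (h0 : forall x, (0 <= h x)%R).
Variables (D : set 'rV[R]_n.+1) (M0 : R).
Hypotheses (mD : measurable D) (DM : forall x, D x -> (`|x| <= M0)%R).
Local Notation df := (partial i f).
Local Notation leb := (@lebesgue_rV R n.+1).
Local Notation mu := (@lebesgue_measure R).

Let mdf : measurable_fun setT df := measurable_partial i (lip_continuous fL).
Let F x := (`|df x| * h x)%:E.

Let mF : measurable_fun setT F.
Proof. by apply/measurable_EFinP/measurable_funM => //; exact: measurableT_comp. Qed.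

Let F0 x : 0 <= F x.
Proof. by rewrite lee_fin mulr_ge0. Qed.

(** Pieces are enumerated through their codes and made disjoint by [seqDU]; the functions [K] of the
    pieces are summed, and so are the level integrals, by countable additivity on each level set. *)
Lemma coarea_lower : exists K : R -> \bar R, [/\ measurable_fun setT K, forall t, 0 <= K t,
    forall t, (ball_lb R n)%:E * K t <= (coarea_cst R n)%:E * level_integral f h D t &
    \int[leb]_(x in D) F x <= \int[mu]_t K t].
Proof.
pose B (k : nat) : set 'rV[R]_n.+1 :=
  if unpickle k is Some idx then
    if (0 < (idx : rat * rat * nat * int).1.1.1)%R && (0 < idx.1.1.2)%R
    then piece i f h D idx else set0
  else set0.
have mB k : measurable (B k).
  rewrite /B; case: unpickle => [idx|//]; case: ifP => // _.
  exact: (measurable_piece i fL mh mD).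
have BD k : B k `<=` D.
  rewrite /B; case: unpickle => [[[[q c] m] l]|]; last exact: sub0set.
  by case: ifP => _; [move=> x []|exact: sub0set].
have expanding0 : expanding i f h set0 by exists 1%R, 1%R; split => //.
have gB k : expanding i f h (B k).
  rewrite /B; case: unpickle => [idx|//]; case: ifP => // /andP[q0 c0].
  exact: expanding_piece.
have mB' := seqDU_measurable mB.
have B'D k : seqDU B k `<=` D by apply: subset_trans (BD k); exact: subset_seqDU.
have tB' := @trivIset_seqDU _ B.
have /choice[K KP] (k : nat) : exists K : R -> \bar R, [/\ measurable_fun setT K, forall t, 0 <= K t,
    forall t, (ball_lb R n)%:E * K t <= (coarea_cst R n)%:E * level_integral f h (seqDU B k) t &
    \int[leb]_(x in seqDU B k) F x <= \int[mu]_t K t].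
  apply: (expanding_coarea fL mh h0 (M := M0)) => //.
    by move=> x /B'D /DM.
  by apply: expandingS (gB k); exact: subset_seqDU.
have mUB : measurable (\bigcup_k seqDU B k) by exact: bigcupT_measurable.
have UBD : \bigcup_k seqDU B k `<=` D by move=> x [k _ /B'D].
exists (fun t => \sum_(0 <= k <oo) K k t); split.
- apply: ge0_emeasurable_sum => [k t _ _|k _]; by case: (KP k).
- by move=> t; apply: nneseries_ge0 => k _ _; case: (KP k).
- move=> t; rewrite -nneseriesZl; last by move=> k _; case: (KP k).
  apply: (@le_trans _ _ (\sum_(0 <= k <oo) ((coarea_cst R n)%:E * level_integral f h (seqDU B k) t))).
    apply: lee_nneseries => [k _ _|k _]; last by case: (KP k).
    by rewrite mule_ge0// ?lee_fin ?(ltW (ball_lb_gt0 _ _))//; case: (KP k).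
  have l0 k : 0 <= level_integral f h (seqDU B k) t.
    by apply: integral_ge0 => x _; rewrite lee_fin.
  have C0 : (0 < coarea_cst R n)%R by rewrite mulr_gt0// exprn_gt0.
  rewrite nneseriesZl// lee_pmul2l//.
  rewrite -(level_integral_bigcup fL mh h0)//.
  exact: (le_level_integral fL mh h0).
- apply: (@le_trans _ _ (\int[leb]_(x in \bigcup_k seqDU B k) F x)).
    rewrite integral_mkcond [leRHS]integral_mkcond; apply: ge0_le_integral => //.
    + by move=> x _; exact: erestrict_ge0.
    + by apply/(measurable_restrictT _ _).1 => //; exact: measurable_funTS.
    + by apply/(measurable_restrictT _ _).1 => //; exact: measurable_funTS.
    move=> x _; rewrite !patchE; case: ifPn => [/set_mem Dx|_]; last by case: ifP.
    case: ifPn => // /negP nBx; rewrite /F lee_fin.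
    have [->|d0] := eqVneq (df x) 0%R; first by rewrite normr0 mul0r.
    have [->|hx0] := eqVneq (h x) 0%R; first by rewrite mulr0.
    exfalso; apply: nBx; rewrite inE -seqDU_bigcup_eq.
    have [||idx [q0 c0 px]] := @piece_cover R n i f h D x Dx.
    + by rewrite normr_gt0.
    + by rewrite lt_neqAle eq_sym hx0 h0.
    have := pickleK idx; move: (pickle idx) => N NE.
    by exists N => //; rewrite /B NE q0 c0.
  rewrite ge0_integral_bigcup//; last by exact: measurable_funTS.
  rewrite integral_nneseries//; [|by move=> k; case: (KP k)|by move=> k t _; case: (KP k)].
  apply: lee_nneseries => [k _ _|k _]; last by case: (KP k).
  by apply: integral_ge0.
Qed.

Lemma coarea_le (a b M : R) : (forall x, D x -> (a < f x < b)%R) -> (a <= b)%R -> (0 <= M)%R ->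
  {ae mu, forall t : R, (a < t < b)%R -> level_integral f h D t <= M%:E} ->
  (ball_lb R n)%:E * \int[leb]_(x in D) (`|df x| * h x)%:E <=
  (coarea_cst R n * M * (b - a))%:E.
Proof.
move=> Dab ab M00 aeM; have [K [mK K0 KG FK]] := coarea_lower.
have r0 := ball_lb_gt0 R n.
have C0 : (0 < coarea_cst R n)%R by rewrite mulr_gt0// exprn_gt0.
apply: (@le_trans _ _ ((ball_lb R n)%:E * \int[mu]_t K t)); first by rewrite lee_pmul2l.
rewrite -ge0_integralZl//; last by rewrite lee_fin ltW.
(* On [D] the values of [f] lie in []a, b[], so for any other [t] the level integral runs over the
   empty set and [K t] is 0. *)
apply: (@le_trans _ _ (\int[mu]_(t in `]a, b[) ((ball_lb R n)%:E * K t))).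
  rewrite [leRHS]integral_mkcond; apply: ge0_le_integral => //.
  - by move=> t _; rewrite mule_ge0// lee_fin ltW.
  - exact: measurable_funeM.
  - apply/(measurable_restrictT _ _).1 => //; apply: measurable_funTS.
    exact: measurable_funeM.
  move=> t _; rewrite patchE; case: ifPn => // /negP tab.
  apply: (le_trans (KG t)).
  rewrite /level_integral (_ : D `&` _ = set0) ?integral_set0 ?mule0//.
  apply/seteqP; split => x //= [/Dab fab fx]; apply: tab.
  by rewrite inE /= in_itv/= -fx.
apply: (@le_trans _ _ (\int[mu]_(t in `]a, b[) (cst (coarea_cst R n * M)%:E t))).
  apply: ae_ge0_le_integral => //.
  - by move=> t _; rewrite mule_ge0// lee_fin ltW.
  - by apply: measurable_funTS; exact: measurable_funeM.
  - by move=> t _; rewrite lee_fin mulr_ge0// ltW.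
  apply: aeS aeM => t Ht; rewrite /= in_itv/= => tab; have {}Ht := Ht tab.
  apply: (le_trans (KG t)); by rewrite [leRHS]EFinM lee_pmul2l// lte_fin.
have -> : \int[mu]_(t in `]a, b[) (cst (coarea_cst R n * M)%:E t) =
    (coarea_cst R n * M)%:E * mu `]a, b[.
  by apply: integral_cst; exact: measurable_itv.
rewrite lebesgue_measure_itv/= lte_fin; case: ifPn => [_|].
  by rewrite -EFinB -EFinM lexx.
by move=> _; rewrite mule0 lee_fin !mulr_ge0// ?subr_ge0// ltW.
Qed.

End coarea_inequality.

(** * Extension and composition of Lipschitz functions *)

(** McShane's extension: the infimum over [z] in [A] of [f z + L * |x - z|]. *)
Lemma lipschitz_extension (R : realType) (V : normedModType R) (A : set V)
    (f : V -> R) (L : R) : 0 <= L ->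
  (forall x y, A x -> A y -> `|f x - f y| <= L * `|x - y|) ->
  exists F : V -> R, lip L F /\ forall x, A x -> F x = f x.
Proof.
move=> L0 fL.
have [->|/set0P[z0 Az0]] := eqVneq A set0.
  by exists (fun=> 0); split => // x y; rewrite subrr normr0 mulr_ge0.
pose E x := [set f z + L * `|x - z| | z in A].
have E0 x : E x !=set0 by exists (f z0 + L * `|x - z0|), z0.
have lbE x y z : A y -> A z -> f y - L * `|x - y| <= f z + L * `|x - z|.
  move=> Ay Az; have := fL y z Ay Az; rewrite ler_norml => /andP[_].
  have : L * `|y - z| <= L * (`|x - y| + `|x - z|).
    by rewrite ler_wpM2l// (distrC x y) ler_distD.
  lra.
have hlb x : has_lbound (E x).
  by exists (f z0 - L * `|x - z0|) => _ [z Az <-]; exact: lbE.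
exists (fun x => inf (E x)); split; last first.
  move=> x Ax; apply/eqP; rewrite eq_le; apply/andP; split.
    by apply: ge_inf => //; exists x => //; rewrite subrr normr0 mulr0 addr0.
  apply: lb_le_inf => // _ [z Az <-].
  by have := lbE x x z Ax Az; rewrite subrr normr0 mulr0 subr0.
have half x y : inf (E x) - L * `|x - y| <= inf (E y).
  apply: lb_le_inf => // _ [z Az <-].
  have : inf (E x) <= f z + L * `|x - z| by apply: ge_inf => //; exists z.
  have : L * `|x - z| <= L * (`|x - y| + `|y - z|) by rewrite ler_wpM2l// ler_distD.
  lra.
move=> x y; rewrite ler_norml; have := half x y; have := half y x.
by rewrite (distrC y x) => ? ?; apply/andP; split; lra.
Qed.

(** Replaces the chain rule. Nothing is asked of [u] beyond the increments: if its quotients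
    diverge, its derivative is the default 0 and the bound is trivial. *)
Lemma derive_comparison (R : realType) (V : normedModType R) (u f : V -> R) (x v : V) (c : R) :
  0 <= c -> (\forall y \near x, `|u y - u x| <= c * `|f y - f x|) ->
  derivable f x v -> `|'D_v u x| <= c * `|'D_v f x|.
Proof.
move=> c0 uf dfx; rewrite !derive_dquotE.
have [cu|ncu] := pselect (cvg (dquot u v h x @[h --> 0^'])); last first.
  by rewrite (dvgP ncu) normr0 mulr_ge0.
have cf : cvg (dquot f v h x @[h --> 0^']) by [].
have nu : `|dquot u v h x| @[h --> 0^'] --> `|lim (dquot u v h x @[h --> 0^'])|.
  by apply: (@cvg_comp _ _ _ _ Num.norm); [exact: cu|exact: norm_continuous].
have nf : c * `|dquot f v h x| @[h --> 0^'] --> c * `|lim (dquot f v h x @[h --> 0^'])|.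
  apply: cvgM; first exact: cvg_cst.
  by apply: (@cvg_comp _ _ _ _ Num.norm); [exact: cf|exact: norm_continuous].
apply: (ler_cvg_to nu nf).
have hv : h *: v + x @[h --> (0:R)^'] --> x.
  apply: cvg_within_filter.
  have : h *: v + x @[h --> (0:R)] --> 0 *: v + x.
    by apply: cvgD; [apply: cvgZr_tmp; exact: cvg_id|exact: cvg_cst].
  by rewrite scale0r add0r.
have : \forall h \near 0^', `|u (h *: v + x) - u x| <= c * `|f (h *: v + x) - f x|.
  exact: (hv _ uf).
apply: filterS => h; rewrite /dquot !normrM mulrCA => H.
by rewrite ler_wpM2l.
Qed.

Section ge0_integral_comparison.
Local Open Scope ereal_scope.
Context d (T : measurableType d) (R : realType) (mu : {measure set T -> \bar R}).
Import HBNNSimple.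

(* The library's integral of a nonnegative function is a supremum over simple
   functions below it, so the smaller function need not be measurable. *)
Lemma ae_ge0_le_integral_upper (D : set T) (f g : T -> \bar R) : measurable D ->
  (forall x, D x -> 0 <= f x) -> (forall x, D x -> 0 <= g x) -> measurable_fun D g ->
  {ae mu, forall x, D x -> f x <= g x} ->
  \int[mu]_(x in D) f x <= \int[mu]_(x in D) g x.
Proof.
move=> mD f0 g0 mg fg.
rewrite ge0_integralE//; apply: ge_ereal_sup => _ [s sf <-].
rewrite -integralT_nnsfun [leRHS]integral_mkcond.
apply: ae_ge0_le_integral => //.
- by move=> x _; rewrite lee_fin.
- exact/measurable_EFinP.
- by move=> x _; exact: erestrict_ge0.
- exact/(measurable_restrictT _ _).1.
apply: aeS fg => x fgx _; have := sf x.
rewrite /= !patchE; case: ifPn => [/set_mem Dx /le_trans|_]; last exact.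
by apply; exact: fgx.
Qed.

End ge0_integral_comparison.

(** * The logarithmic profile *)

Section logarithmic_profile.
Context (R : realType) (t0 d1 : R) (N : nat).
Hypotheses (d10 : 0 < d1) (N0 : (0 < N)%N).
Implicit Types s t a : R.

(** This is [ln (d1 / log_inner)], the total rise of the logarithm, so that the profile ends at
    1. *)
Definition log_height : R := N%:R * ln 2.
Definition log_inner : R := d1 / 2 ^+ N.
Definition clamp s : R := Num.max log_inner (Num.min s d1).
Definition log_profile t : R := ln (clamp (t - t0) / log_inner) / log_height.
(* Consecutive shells [shell_radius k < s < 8 * shell_radius k] overlap, so that
   open shells cover the closed interval where the profile varies. *)
Definition shell_radius (k : nat) : R := d1 / 2 ^+ k.+2.

Lemma log_height_gt0 : 0 < log_height.
Proof. by rewrite mulr_gt0 ?ltr0n// ln_gt0// ltr1n. Qed.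

Lemma log_inner_gt0 : 0 < log_inner.
Proof. by rewrite divr_gt0// exprn_gt0. Qed.

Lemma log_inner_le : log_inner <= d1.
Proof. by rewrite ler_pdivrMr ?exprn_gt0// ler_peMr ?(ltW d10)// exprn_ege1// ler1n. Qed.

Lemma clamp_ge s : log_inner <= clamp s.
Proof. by rewrite le_max lexx. Qed.

Lemma clamp_gt0 s : 0 < clamp s.
Proof. exact: lt_le_trans log_inner_gt0 (clamp_ge s). Qed.

Lemma clamp_le s : clamp s <= d1.
Proof. by rewrite ge_max log_inner_le ge_min lexx orbT. Qed.

Lemma clamp_lip s s' : `|clamp s - clamp s'| <= `|s - s'|.
Proof.
rewrite /clamp; have := log_inner_le; set e := log_inner => ed.
have [?|?] := leP s d1; have [?|?] := leP s' d1;
  repeat (match goal with |- context [Num.max ?x ?y] => have [?|?] := leP x y end);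
  rewrite ?ler_norml; have := ler_norm (s - s'); have := ler_norm (s' - s);
  rewrite (distrC s' s) => ? ?; apply/andP; split; lra.
Qed.

Lemma ln_lip a s t : 0 < a -> a <= s -> a <= t -> `|ln s - ln t| <= a^-1 * `|s - t|.
Proof.
move=> a0.
suff H s' t' : a <= s' -> s' <= t' -> `|ln s' - ln t'| <= a^-1 * `|s' - t'|.
  move=> sa ta; have [st|/ltW ts] := leP s t; first exact: H.
  by rewrite distrC (distrC s); exact: H.
move=> sa st; have s0 : 0 < s' by exact: lt_le_trans sa.
have t0' : 0 < t' by exact: lt_le_trans st.
rewrite distrC (distrC s') ger0_norm; last by rewrite subr_ge0 ler_ln.
rewrite (@ger0_norm _ (t' - s')) ?subr_ge0//.
rewrite -ln_div ?posrE// (_ : t' / s' = 1 + (t' - s') / s'); last by field; rewrite gt_eqF.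
rewrite (le_trans (le_ln1Dx _))//.
  by rewrite (@lt_le_trans _ _ 0) ?ltrN10// divr_ge0 ?subr_ge0// ltW.
by rewrite mulrC ler_wpM2r ?subr_ge0// lef_pV2 ?posrE.
Qed.

Lemma log_profileB t s : log_profile t - log_profile s =
  (ln (clamp (t - t0)) - ln (clamp (s - t0))) / log_height.
Proof.
rewrite /log_profile -mulrBl !ln_div ?posrE ?log_inner_gt0 ?clamp_gt0//.
by congr (_ / _); ring.
Qed.

Lemma log_profile_lip_from a t s : 0 < a -> a <= clamp (t - t0) -> a <= clamp (s - t0) ->
  `|log_profile t - log_profile s| <= (a * log_height)^-1 * `|t - s|.
Proof.
move=> a0 ta sa; rewrite log_profileB normrM normfV (gtr0_norm log_height_gt0).
rewrite ler_pdivrMr ?log_height_gt0// (le_trans (ln_lip a0 ta sa))//.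
have -> : (a * log_height)^-1 * `|t - s| * log_height = a^-1 * `|t - s|.
  by field; rewrite !gt_eqF ?log_height_gt0.
rewrite ler_wpM2l ?invr_ge0 ?(ltW a0)// (le_trans (clamp_lip _ _))//.
by rewrite opprB addrA subrK.
Qed.

Lemma log_profile_lip : lip ((log_inner * log_height)^-1) log_profile.
Proof. by move=> t s; apply: log_profile_lip_from; rewrite ?log_inner_gt0 ?clamp_ge. Qed.

Lemma clamp_ge_id a s : a <= d1 -> a <= s -> a <= clamp s.
Proof. by move=> ad sa; rewrite le_max le_min ad sa orbT. Qed.

Lemma log_profile_eq0 t : t - t0 <= log_inner -> log_profile t = 0.
Proof.
move=> ts; rewrite /log_profile /clamp (_ : Num.max _ _ = log_inner).
  by rewrite divff ?gt_eqF ?log_inner_gt0// ln1 mul0r.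
by apply/max_idPl; rewrite ge_min ts.
Qed.

Lemma log_profile_eq1 t : d1 <= t - t0 -> log_profile t = 1.
Proof.
move=> ts; rewrite /log_profile /clamp (_ : Num.max _ _ = d1); last first.
  rewrite (_ : Num.min _ _ = d1); last by apply/min_idPr.
  by apply/max_idPr; exact: log_inner_le.
have -> : d1 / log_inner = 2 ^+ N.
  by rewrite /log_inner invf_div mulrCA divff ?mulr1// gt_eqF.
by rewrite lnXn// -[X in X / _]mulr_natl -/log_height divff// gt_eqF// log_height_gt0.
Qed.

Lemma log_profile_itv t : 0 <= log_profile t <= 1.
Proof.
have L0 := log_height_gt0; have e0 := log_inner_gt0.
apply/andP; split.
  by rewrite divr_ge0 ?(ltW L0)// ln_ge0// ler_pdivlMr// mul1r clamp_ge.
have td : t0 + d1 - t0 = d1 by rewrite addrAC subrr add0r.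
apply: (@le_trans _ _ (log_profile (t0 + d1))); last by rewrite log_profile_eq1 ?td.
rewrite ler_pM2r ?invr_gt0// ler_ln ?posrE ?divr_gt0 ?clamp_gt0// ler_pM2r ?invr_gt0//.
by rewrite (le_trans (clamp_le _))//; apply: clamp_ge_id; rewrite ?td.
Qed.

Lemma shell_radius_gt0 k : 0 < shell_radius k.
Proof. by rewrite divr_gt0// exprn_gt0. Qed.

(** For [d1 = delta / 2] this keeps each shell within distance [delta] of [t0], where the weight
    bound holds. *)
Lemma shell_radius_le k : 8 * shell_radius k <= 2 * d1.
Proof.
rewrite /shell_radius mulrA ler_pdivrMr ?exprn_gt0// !exprS.
have : 1 <= 2 ^+ k :> R by rewrite exprn_ege1// ler1n.
have := d10; set u := 2 ^+ k; nra.
Qed.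

(** The least [k] with [shell_radius k < s] works: by minimality [s] is at most
    [2 * shell_radius k], or at most [d1] when [k = 0]. It is below [N] because [shell_radius N.-1]
    is half of [log_inner]. *)
Lemma shell_exists s : log_inner <= s <= d1 ->
  exists2 k, (k < N)%N & shell_radius k < s < 8 * shell_radius k.
Proof.
move=> /andP[es sd]; pose P k := shell_radius k < s.
have s0 : 0 < s by exact: lt_le_trans log_inner_gt0 es.
have PN : P N.-1.
  rewrite /P (lt_le_trans _ es)// /shell_radius /log_inner prednK// exprS.
  rewrite ltr_pM2l// ltf_pV2 ?posrE ?mulr_gt0 ?exprn_gt0//.
  by rewrite ltr_pMl ?exprn_gt0// ltr1n.
have exP : exists k, P k by exists N.-1.
case: (ex_minnP exP) => k Pk kmin; exists k.
  by rewrite (leq_ltn_trans (kmin _ PN))// ltn_predL.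
rewrite [X in X && _]Pk /=; case: k Pk kmin => [|k] Pk kmin.
  by rewrite (le_lt_trans sd)// /shell_radius expr2; lra.
have : ~~ P k by apply/negP => /kmin; rewrite ltnn.
rewrite -leNgt => /le_lt_trans; apply.
rewrite (_ : shell_radius k = 2 * shell_radius k.+1).
  by rewrite ltr_pM2r ?shell_radius_gt0// ltr_nat.
by rewrite /shell_radius (exprS 2 k.+2); field; rewrite expf_neq0.
Qed.

(** The powers of the radius combine into the exponent [g + 1 - p]. Criticality makes it
    nonnegative, so each term has a bound independent of [k], and there are [N] terms. *)
Lemma shell_sum (p g c : R) : 1 < p -> p - 1 <= g -> 0 <= c ->
  \sum_(k < N) ((shell_radius k * log_height)^-1 `^ p *
    (c * (8 * shell_radius k) `^ g * (8 * shell_radius k))) <=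
  (c * 8 `^ (g + 1) * d1 `^ (g + 1 - p)) * (N%:R * log_height `^ (- p)).
Proof.
move=> p1 pg c0.
apply: (@le_trans _ _ (\sum_(k < N) ((c * 8 `^ (g + 1) * d1 `^ (g + 1 - p)) * log_height `^ (- p)))).
  apply: ler_sum => k _; set a := shell_radius k.
  have a0 : 0 < a by exact: shell_radius_gt0.
  have L0 := log_height_gt0.
  have ad : a <= d1.
    by have := shell_radius_le k; rewrite -/a; move: a0 d10; lra.
  have g0 : 0 <= g by lra.
  have E : (8 * a) `^ g * (8 * a) = 8 `^ (g + 1) * a `^ (g + 1).
    have a80 : 0 < 8 * a by rewrite mulr_gt0.
    rewrite -[X in _ * X](@powRr1 _ (8 * a)) ?(ltW a80)// -powRD; last by rewrite (gt_eqF a80) implybT.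
    by rewrite powRM ?(ltW a0).
  have -> : (a * log_height)^-1 `^ p * (c * (8 * a) `^ g * (8 * a)) =
      (c * 8 `^ (g + 1) * a `^ (g + 1 - p)) * log_height `^ (- p).
    rewrite -(mulrA c) E.
    have aL : 0 <= a * log_height by rewrite mulr_ge0 ?(ltW a0) ?(ltW L0).
    have -> : (a * log_height)^-1 `^ p = a `^ (- p) * log_height `^ (- p).
      rewrite -(powR_inv1 aL) -powRrM mulN1r powRM ?(ltW a0) ?(ltW L0)//.
    rewrite (@powRD _ a (g + 1) (- p)); last by rewrite (gt_eqF a0) implybT.
    ring.
  rewrite ler_wpM2r ?powR_ge0// ler_wpM2l ?mulr_ge0 ?powR_ge0//.
  by apply: ge0_ler_powR => //; rewrite ?nnegrE ?(ltW a0) ?(ltW d10)//; lra.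
rewrite sumr_const card_ord -[leLHS]mulr_natl.
by rewrite mulrCA lexx.
Qed.

End logarithmic_profile.

Lemma log_decay_eq0 (R : realType) (x : \bar R) (C p : R) : 1 < p -> 0 <= C ->
  (0 <= x)%E ->
  (forall N : nat, (0 < N)%N -> (x <= (C * (N%:R * log_height R N `^ (- p)))%:E)%E) ->
  x = 0%E.
Proof.
move=> p1 C0 x0 xN; apply/eqP; rewrite eq_le x0 andbT.
apply/lee_addgt0Pr => e e0; rewrite add0e.
have l20 : 0 < ln 2 :> R by rewrite ln_gt0// ltr1n.
pose B : R := C * ln 2 `^ (- p) / e.
have B0 : 0 <= B by rewrite divr_ge0 ?mulr_ge0 ?powR_ge0// ltW.
(* Chosen so that [N^(p - 1)] is at least [B]; this is possible since [p > 1]. *)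
pose N := (Num.bound (B `^ (p - 1)^-1)).+1.
have NB : B <= N%:R `^ (p - 1).
  have p10 : 0 < p - 1 by rewrite subr_gt0.
  have -> : B = (B `^ (p - 1)^-1) `^ (p - 1) by rewrite -powRrM mulVf ?gt_eqF// powRr1.
  apply: ge0_ler_powR; rewrite ?nnegrE ?powR_ge0 ?(ltW p10)//.
  apply: ltW; apply: lt_trans (archi_boundP (powR_ge0 _ _)) _.
  by rewrite ltr_nat.
have Np : 0 < N%:R `^ (p - 1) :> R by rewrite powR_gt0// ltr0n.
apply: (le_trans (xN N _)) => //; rewrite lee_fin.
have NN : 0 < N%:R :> R by rewrite ltr0n.
have -> : C * (N%:R * log_height R N `^ (- p)) = B * e / N%:R `^ (p - 1).
  rewrite /B divfK ?gt_eqF// /log_height powRM ?(ltW l20)//.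
  have -> : (N%:R `^ (p - 1))^-1 = N%:R * (N%:R : R) `^ (- p).
    rewrite -powRN opprB -{2}(@powRr1 _ (N%:R : R))// -powRD//.
    by rewrite (gt_eqF NN) implybT.
  by ring.
by rewrite ler_pdivrMr// mulrC ler_wpM2l// ltW.
Qed.

(** Below the inner radius and above the outer one the composition is locally constant. Otherwise
    [f x] lies in an open shell, and continuity keeps nearby values above the inner radius of the
    shell, where the slope is controlled. It serves with [f = id] on the line and with [f = theta]
    in space. *)
Lemma log_profile_comparison (R : realType) (V : normedModType R) (t0 d1 : R) (N : nat)
    (f : V -> R) (x : V) : 0 < d1 -> (0 < N)%N -> {for x, continuous f} ->
  (forall v, derivable f x v -> 'D_v (log_profile t0 d1 N \o f) x = 0) \/
  exists2 k, (k < N)%N & t0 + shell_radius d1 k < f x < t0 + 8 * shell_radius d1 k /\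
    forall v, derivable f x v ->
      `|'D_v (log_profile t0 d1 N \o f) x| <=
      (shell_radius d1 k * log_height R N)^-1 * `|'D_v f x|.
Proof.
move=> d10 N0 cfx.
have zero (c : R) : (\forall y \near x, log_profile t0 d1 N (f y) = c) ->
    log_profile t0 d1 N (f x) = c ->
    forall v, derivable f x v -> 'D_v (log_profile t0 d1 N \o f) x = 0.
  move=> nc xc v dfx; apply/eqP; rewrite -normr_le0 -(mul0r `|'D_v f x|).
  apply: derive_comparison => //; apply: filterS nc => y /= ->.
  by rewrite xc subrr normr0 mul0r.
have [lo|lo] := ltP (f x) (t0 + log_inner d1 N).
  left; apply: (@zero 0); last by apply: log_profile_eq0 => //; lra.
  near=> y; apply: log_profile_eq0 => //; rewrite lerBlDl; apply: ltW; near: y.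
  by move/cvgr_lt : cfx; apply.
have [hi|hi] := ltP (t0 + d1) (f x).
  left; apply: (@zero 1); last by apply: log_profile_eq1 => //; lra.
  near=> y; apply: log_profile_eq1 => //; rewrite lerBrDl; apply: ltW; near: y.
  by move/cvgr_gt : cfx; apply.
right; have [|k kN /andP[ak ka]] := @shell_exists _ d1 N d10 N0 (f x - t0).
  by apply/andP; split; lra.
exists k => //; split; first by apply/andP; split; lra.
have a0 := shell_radius_gt0 d10 k.
have ad : shell_radius d1 k <= d1.
  by have := shell_radius_le d10 k; lra.
move=> v dfx; apply: derive_comparison => //.
  by rewrite invr_ge0 mulr_ge0 ?(ltW a0)// ltW// log_height_gt0.
near=> y; apply: log_profile_lip_from => //.
  apply: clamp_ge_id => //; rewrite lerBrDl; apply: ltW; near: y.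
  by move/cvgr_gt : cfx; apply; lra.
by apply: clamp_ge_id => //; apply: ltW.
Unshelve. all: by end_near. Qed.

(** The function [f] is not assumed measurable, so that it may contain the energy weight; only the
    majorant built from [F] is. *)
Lemma integral_shells d (T : measurableType d) (R : realType)
    (mu : {measure set T -> \bar R}) (D : set T) (I : nat -> set T) (w : nat -> R)
    (F : T -> \bar R) (f : T -> \bar R) (N : nat) :
  measurable D -> (forall k, measurable (I k)) -> (forall k, 0 <= w k) ->
  (forall x, (0 <= F x)%E) -> measurable_fun setT F ->
  (forall x, D x -> (0 <= f x)%E) ->
  {ae mu, forall x, D x -> (f x <= \sum_(k < N) (w k)%:E * (F \_ (I k)) x)%E} ->
  (\int[mu]_(x in D) f x <= \sum_(k < N) (w k)%:E * \int[mu]_(x in D `&` I k) F x)%E.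
Proof.
move=> mD mI w0 F0 mF f0 fle.
have F_0 k x : (0 <= (F \_ (I k)) x)%E by apply: erestrict_ge0.
have mF_ k : measurable_fun D (F \_ (I k)).
  apply: measurable_funTS; apply/(measurable_restrictT _ _).1 => //.
  exact: measurable_funTS.
have t0 k x : (0 <= (w k)%:E * (F \_ (I k)) x)%E by rewrite mule_ge0// lee_fin.
have mt k : measurable_fun D (fun x => (w k)%:E * (F \_ (I k)) x)%E.
  exact: measurable_funeM.
apply: (@le_trans _ _ (\int[mu]_(x in D) \sum_(k < N) (w k)%:E * (F \_ (I k)) x)%E).
  apply: ae_ge0_le_integral_upper => //; last exact: emeasurable_sum.
  by move=> x _; apply: sume_ge0.
rewrite ge0_integral_sum//; apply: lee_sum => k _.
by rewrite ge0_integralZl// ?lee_fin// integral_mkcondr.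
Qed.

Section euclidean_comparison.
Context (R : realType) (n : nat).
Implicit Types x y : 'rV[R]_n.

Lemma enorm_le_sum x : enorm x <= \sum_(i < n) `|x ord0 i|.
Proof.
have s0 : 0 <= \sum_(i < n) `|x ord0 i| by apply: sumr_ge0.
rewrite -[leRHS](ger0_norm s0) -sqrtr_sqr ler_wsqrtr//.
rewrite [leRHS]expr2 mulr_suml; apply: ler_sum => i _.
rewrite -real_normK ?num_real// expr2 ler_wpM2l//.
by rewrite (bigD1 i)//= lerDl; apply: sumr_ge0.
Qed.

Lemma enorm_comparison x y c : 0 <= c ->
  (forall i, `|x ord0 i| <= c * `|y ord0 i|) -> enorm x <= c * enorm y.
Proof.
move=> c0 xy; rewrite -[X in X * _](ger0_norm c0) -sqrtr_sqr -sqrtrM ?sqr_ge0//.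
rewrite ler_wsqrtr// mulr_sumr; apply: ler_sum => i _.
rewrite -exprMn -[leLHS]real_normK ?num_real// -[leRHS]real_normK ?num_real//.
by rewrite normrM (ger0_norm c0) lerXn2r// ?nnegrE ?mulr_ge0.
Qed.

End euclidean_comparison.

Lemma bounded_Lp_on (R : realType) (n : nat) (p : R) (Omega : set 'rV[R]_n)
    (f : 'rV[R]_n -> R) (B : R) : 0 <= p -> measurable Omega ->
  (@lebesgue_rV R n Omega < +oo)%E -> measurable_fun Omega f ->
  (forall x, `|f x| <= B) -> Lp_on p Omega f.
Proof.
move=> p0 mO Ooo mf fB; split => //.
have B0 : 0 <= B by exact: le_trans (fB 0).
apply: (@le_lt_trans _ _ (\int[@lebesgue_rV R n]_(x in Omega) (cst (B `^ p)%:E x))%E).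
  apply: ge0_le_integral => //.
  - apply/measurable_EFinP.
    apply: (@measurableT_comp _ _ _ _ _ _ (fun y : R => y `^ p)); first exact: measurable_powR.
    exact: measurableT_comp.
  - move=> x _; rewrite lee_fin; apply: ge0_ler_powR => //; rewrite nnegrE//.
have -> : (\int[@lebesgue_rV R n]_(x in Omega) cst (B `^ p)%:E x = (B `^ p)%:E * @lebesgue_rV R n Omega)%E.
  exact: (integral_cst (@lebesgue_rV R n) mO).
by rewrite lte_mul_pinfty// lee_fin powR_ge0.
Qed.

Lemma enorm0 (R : realType) n : enorm (0 : 'rV[R]_n) = 0.
Proof. by rewrite /enorm big1 ?sqrtr0// => i _; rewrite mxE expr0n. Qed.

Lemma sobolev_capacity0 (R : realType) (n : nat) (p : R) : 0 < p ->
  @sobolev_capacity R n p set0 = 0%E.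
Proof.
move=> p0; apply/eqP; rewrite eq_le; apply/andP; split.
  apply: ereal_inf_lbound; exists (fun=> 0, fun=> 0) => /=.
    have Lp0 : @Lp_on R n p setT (fun=> 0).
      split; first exact: measurable_cst.
      by under eq_integral do rewrite normr0 powR0 ?gt_eqF//; rewrite integral0.
    split; last by exists set0; split => //; apply: aeW.
    split=> //= [i|phi _ i]; first by under [X in Lp_on _ _ X]eq_fun do rewrite mxE.
    under eq_Rintegral do rewrite mul0r.
    under [in RHS]eq_Rintegral do rewrite mxE mul0r.
    by rewrite /Rintegral integral0 oppr0.
  by under eq_integral do rewrite normr0 enorm0 powR0 ?gt_eqF// addr0; rewrite integral0.
apply: le_ereal_inf_tmp => _ [ug _ <-]; apply: integral_ge0 => x _.
by rewrite lee_fin addr_ge0// powR_ge0.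
Qed.

(** * The two capacities *)

Section lipschitz_line_sobolev.
Context (R : realType).
Local Notation mu := (@lebesgue_measure R).

Lemma lip_absolutely_continuous (a b L : R) (v : R -> R) : 0 <= L -> lip L v ->
  absolutely_continuous a b v.
Proof.
move=> L0 vL e e0; exists (e / (L + 1)); first by rewrite divr_gt0// ltr_wpDl.
move=> s sab _ sd.
apply: (@le_lt_trans _ _ (L * \sum_(I <- s) (I.2 - I.1))).
  rewrite mulr_sumr big_seq [leRHS]big_seq; apply: ler_sum => I /sab[/andP[_ I12] _].
  by rewrite (le_trans (vL _ _))// ger0_norm// subr_ge0.
have [->|L00] := eqVneq L 0; first by rewrite mul0r.
have L00' : 0 < L by rewrite lt_neqAle eq_sym L00.
apply: (@lt_le_trans _ _ (L * (e / (L + 1)))); first by rewrite ltr_pM2l.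
by rewrite mulrA ler_pdivrMr ?ltr_wpDl// mulrC ler_wpM2l// ?(ltW e0)// lerDl.
Qed.

Lemma lip_sobolev11 (a b L B : R) (v : R -> R) : 0 <= L -> lip L v -> 0 <= B ->
  (forall t, `|v t| <= B) -> sobolev11 a b v (derive1 v).
Proof.
move=> L0 vL B0 vB.
have cv := lip_continuous vL.
have mv := continuous_measurable_fun cv.
have mdv := measurable_fun_derive1 cv.
have dvL t : `|derive1 v t| <= L.
  by rewrite derive1E (le_trans (lip_derive_le _ _ L0 vL))// normr1 mulr1.
have mab : measurable (`]a, b[ : set (measurableTypeR R)) by exact: measurable_itv.
have aboo := @lebesgue_measure_itv_lty R a b false true.
split.
- by apply: (le_bounded_integrable mab aboo (M := B)) => //; exact: measurable_funTS.
- by apply: (le_bounded_integrable mab aboo (M := L)) => //; exact: measurable_funTS.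
move=> phi [phiC cK Kab]; set K := closure _ in cK Kab.
have dphi t : derivable phi t 1 by exact: (phiC 0%N).
have cphi : continuous phi.
  by move=> t; apply: differentiable_continuous; apply/derivable1_diffP.
have cdphi : continuous (derive1 phi).
  move=> t; apply: differentiable_continuous; apply/derivable1_diffP.
  exact: (phiC 1%N).
have p0 t : ~ K t -> phi t = 0.
  by move=> Kt; apply/eqP/negP => /negP pt; apply: Kt; exact: subset_closure.
have dp0 t : ~ K t -> derive1 phi t = 0.
  move=> Kt; rewrite derive1E.
  suff -> : 'D_1 phi t = 'D_1 (cst 0) t by rewrite derive_cst.
  apply: near_eq_derive.
  have : open (~` K) by apply: closed_openC; exact: closed_closure.
  by rewrite openE => /(_ t Kt); apply: filterS => y; exact: p0.
have [M M0 KM] := compact_normed_bounded cK.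
have [P P0 phiP] := continuous_compact_support_bounded cK cphi p0.
have [Q Q0 dphiQ] := continuous_compact_support_bounded cK cdphi dp0.
have mphi := continuous_measurable_fun cphi.
have mdphi := continuous_measurable_fun cdphi.
have mK : measurable (K : set (measurableTypeR R)).
  by apply: closed_measurable; exact: closed_closure.
have Koo : (mu K < +oo)%E by exact: compact_finite_measure.
have int (w psi : R -> R) W S : measurable_fun setT w -> measurable_fun setT psi ->
    (forall t, `|w t| <= W) -> (forall t, `|psi t| <= S) -> (forall t, ~ K t -> psi t = 0) ->
    mu.-integrable setT (fun t => (w t * psi t)%:E).
  move=> mw mpsi wW psiS psi0.
  have : mu.-integrable K (fun t => (w t * psi t)%:E).
    apply: (@le_bounded_integrable _ _ _ mu K (fun t => w t * psi t) (W * S)) => //.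
    - by apply: measurable_funM; exact: measurable_funTS.
    - by move=> t _; rewrite normrM ler_pM.
  move/integrable_mkcond => /(_ mK); congr (_.-integrable _ _); apply/funext => t.
  rewrite patchE; case: ifPn => // /negP; rewrite inE => /psi0 ->.
  by rewrite mulr0.
rewrite (Rintegral_support mu mab Kab); last by move=> t Kt; rewrite dp0// mulr0.
rewrite (Rintegral_support mu mab Kab); last by move=> t Kt; rewrite p0// mulr0.
have i1 := int _ _ _ _ mv mdphi vB dphiQ dp0.
have i2 := int _ _ _ _ mdv mphi dvL phiP p0.
apply/eqP; rewrite -addr_eq0 -RintegralD//; apply/eqP.
have M10 : 0 <= M + 1 by rewrite addr_ge0.
have phi0 t : M + 1 <= `|t| -> phi t = 0.
  move=> Mt; apply: p0 => Kt; have := KM _ Kt; rewrite leNgt => /negP; apply.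
  by rewrite (lt_le_trans _ Mt)// ltrDl.
have := lip_ibp B0 P0 L0 Q0 M10 vL vB dphi dphiQ phiP phi0.
by rewrite /Rintegral => ->.
Qed.

End lipschitz_line_sobolev.

Section weighted_capacity_zero.
Context (R : realType) (p t0 delta c g : R) (A : R -> \bar R).
Hypotheses (p1 : 1 < p) (delta0 : 0 < delta) (pg : p - 1 <= g) (c0 : 0 <= c).
Hypotheses (A0 : forall t, (0 <= A t)%E)
  (Ac : {ae @lebesgue_measure R, forall t, t0 < t < t0 + delta ->
     (A t <= (c * (t - t0) `^ g)%:E)%E}).
Local Notation mu := (@lebesgue_measure R).
Local Notation d1 := (delta / 2).

Let d10 : 0 < d1. Proof. by rewrite divr_gt0. Qed.
Let g0 : 0 <= g. Proof. by move: p1 pg; lra. Qed.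

Lemma weighted_energy_le N : (0 < N)%N ->
  (weighted_energy p A t0 (t0 + delta) (derive1 (log_profile t0 d1 N)) <=
   ((c * 8 `^ (g + 1) * d1 `^ (g + 1 - p)) * (N%:R * log_height R N `^ (- p)))%:E)%E.
Proof.
move=> N0; set v := log_profile t0 d1 N.
pose a k := shell_radius d1 k.
have a0 k : 0 < a k by exact: shell_radius_gt0.
have L0 : 0 < log_height R N by exact: log_height_gt0.
pose I k : set (measurableTypeR R) := `]t0 + a k, t0 + 8 * a k[%classic.
have mI k : measurable (I k) by exact: measurable_itv.
have mD : measurable (`]t0, t0 + delta[ : set (measurableTypeR R)) by exact: measurable_itv.
(* As [g >= 0], the weight on a shell is bounded through the outer radius [8 * a k]; with this
   constant put in [w k], the function left to integrate is 1. *)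
pose w k := (a k * log_height R N)^-1 `^ p * (c * (8 * a k) `^ g).
have w0 k : 0 <= w k by rewrite mulr_ge0 ?powR_ge0// mulr_ge0 ?powR_ge0.
have shells : (weighted_energy p A t0 (t0 + delta) (derive1 v) <=
    \sum_(k < N) (w k)%:E * \int[mu]_(x in `]t0, (t0 + delta)%R[ `&` I k) (cst 1 x))%E.
  apply: integral_shells => //.
    by move=> t _; rewrite mule_ge0// lee_fin powR_ge0.
  apply: aeS Ac => t At; rewrite /= in_itv/= => tab; have {}At := At tab.
  have sum0 : (0 <= \sum_(k < N) (w k)%:E * (cst 1 \_ (I k)) t)%E.
    by apply: sume_ge0 => k _; rewrite mule_ge0 ?lee_fin//; exact: erestrict_ge0.
  have dt : derivable (@id R) t 1 by exact: derivable_id.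
  have [D0|[k kN [tk Dk]]] := @log_profile_comparison R R t0 d1 N id t d10 N0 (@cvg_id _ _).
    by rewrite derive1E D0// normr0 powR0 ?mul0e// gt_eqF// (lt_trans _ p1).
  rewrite (bigD1 (Ordinal kN))//= -[leLHS]adde0 leeD//; last first.
    by apply: sume_ge0 => j _; rewrite mule_ge0 ?lee_fin//; exact: erestrict_ge0.
  rewrite patchE mem_set; last by rewrite /I /= in_itv.
  rewrite mule1 /w EFinM; apply: lee_pmul => //.
    rewrite lee_fin; apply: ge0_ler_powR; rewrite ?nnegrE//; first by move: p1; lra.
      by rewrite invr_ge0 mulr_ge0// ltW.
    by have := Dk 1 dt; rewrite derive_id normr1 mulr1 derive1E.
  apply: (le_trans At); rewrite lee_fin ler_wpM2l// ge0_ler_powR ?nnegrE//.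
  - by move: tab; lra.
  - by rewrite mulr_ge0// ltW.
  - by move: tk => /andP[_]; rewrite /a; lra.
apply: (le_trans shells).
have shell := @shell_sum R d1 N d10 N0 p g c p1 pg c0.
rewrite -lee_fin in shell; apply: le_trans shell.
rewrite -sumEFin; apply: lee_sum => k _.
rewrite [leRHS](_ : _ = (w k)%:E * (8 * a k)%:E)%E; last by rewrite -EFinM /w /a; congr (_%:E); ring.
apply: lee_wpmul2l; first by rewrite lee_fin.
rewrite integral_cst ?mul1e; last exact: measurableI.
apply: (@le_trans _ _ (mu (I k))); first by apply: le_measure; rewrite ?inE//; exact: measurableI.
rewrite lebesgue_measure_itv/= lte_fin; case: ifPn => _; last by rewrite lee_fin mulr_ge0// ltW.
rewrite -EFinB lee_fin; move: (a0 k); rewrite /a; lra.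
Qed.

Lemma weighted_capacity_eq0 : weighted_capacity p A t0 (t0 + delta) = 0%E.
Proof.
apply: (@log_decay_eq0 R _ (c * 8 `^ (g + 1) * d1 `^ (g + 1 - p)) p) => //.
- by rewrite !mulr_ge0// powR_ge0.
- apply: le_ereal_inf_tmp => _ [vw _ <-]; apply: integral_ge0 => t _.
  by rewrite mule_ge0// lee_fin powR_ge0.
move=> N N0; apply: le_trans (weighted_energy_le N0).
apply: ereal_inf_lbound; exists (log_profile t0 d1 N, derive1 (log_profile t0 d1 N)) => //=.
have vL := @log_profile_lip R t0 d1 N d10 N0.
have L0 : 0 <= (log_inner d1 N * log_height R N)^-1.
  by rewrite invr_ge0 mulr_ge0// ltW ?log_inner_gt0 ?log_height_gt0.
split.
- apply: (lip_sobolev11 _ _ L0 vL ler01) => t.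
  by have /andP[v0 v1] := @log_profile_itv R t0 d1 N d10 N0 t; rewrite ger0_norm.
- exact: lip_absolutely_continuous vL.
- split; first by apply: log_profile_eq0 => //; rewrite subrr ltW// log_inner_gt0.
  by apply: log_profile_eq1 => //; move: delta0; lra.
by rewrite (le_lt_trans (weighted_energy_le N0))// ltry.
Qed.

End weighted_capacity_zero.

Lemma lip_comp (R : realType) (V : normedModType R) (K L : R) (u : R -> R) (f : V -> R) :
  0 <= K -> lip K u -> lip L f -> lip (K * L) (u \o f).
Proof.
move=> K0 uK fL x y; rewrite -mulrA (le_trans (uK _ _))//.
by rewrite ler_wpM2l.
Qed.

Section level_energy.
Context (R : realType) (n : nat) (Omega : set 'rV[R]_n.+1) (theta : 'rV[R]_n.+1 -> R).
Context (L M0 p t0 delta c g : R).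
Hypotheses (oO : open Omega) (OM : forall x, Omega x -> `|x| <= M0).
Hypotheses (L0 : 0 <= L) (tL : lip L theta).
Hypotheses (p1 : 1 < p) (delta0 : 0 < delta) (pg : p - 1 <= g) (c0 : 0 <= c).
Local Notation leb := (@lebesgue_rV R n.+1).
Local Notation h := (fun x => enorm (gradient theta x) `^ (p - 1)).
Hypothesis Ac : {ae @lebesgue_measure R, forall t, t0 < t < t0 + delta ->
   (level_integral theta h Omega t <= (c * (t - t0) `^ g)%:E)%E}.

Let ct : continuous theta. Proof. exact: lip_continuous tL. Qed.
Let mt : measurable_fun setT theta. Proof. exact: rV_continuous_measurable. Qed.
Let mO : measurable Omega. Proof. exact: rV_open_measurable. Qed.
Let g0 : 0 <= g. Proof. by move: p1 pg; lra. Qed.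
Let C0 : 0 < coarea_cst R n. Proof. by rewrite mulr_gt0// exprn_gt0. Qed.
Let cst0 : 0 <= n.+1%:R * coarea_cst R n * c / ball_lb R n.
Proof. by rewrite divr_ge0 ?(ltW (ball_lb_gt0 _ _))// !mulr_ge0// ltW. Qed.
Let menorm : measurable_fun setT (fun x => enorm (gradient theta x)).
Proof.
apply: measurable_enorm_comp => i; under eq_fun do rewrite mxE.
exact: measurable_partial.
Qed.
Let mpow q : measurable_fun setT (fun x => enorm (gradient theta x) `^ q).
Proof.
apply: (@measurableT_comp _ _ _ _ _ _ (fun y : R => y `^ q)) => //.
Qed.

(** The Euclidean norm is at most the sum of the absolute values of the coordinates, so one factor
    of [|grad theta|^p] splits over the axes into integrands of the coarea inequality; the factor
    [n.+1] counts the axes. *)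
Lemma shell_energy_le a b : 0 <= a -> a <= b -> b <= delta ->
  (\int[leb]_(x in Omega `&` theta @^-1` `](t0 + a)%R, (t0 + b)%R[)
     (enorm (gradient theta x) `^ p)%:E <=
   (n.+1%:R * coarea_cst R n * c / ball_lb R n * (b `^ g * b))%:E)%E.
Proof.
move=> a0 ab bd; set D := _ `&` _.
have mI : measurable (`]t0 + a, t0 + b[ : set (measurableTypeR R)) by exact: measurable_itv.
have mD : measurable D.
  apply: measurableI => //; rewrite -[X in measurable X]setTI; exact: mt.
have b0 : 0 <= b by exact: le_trans ab.
have r0 := ball_lb_gt0 R n.
have cb : 0 <= c * b `^ g by rewrite mulr_ge0 ?powR_ge0.
have h0 x : 0 <= h x by exact: powR_ge0.
have mterm i : measurable_fun D (fun x => (`|partial i theta x| * h x)%:E).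
  apply/measurable_EFinP/measurable_funTS/measurable_funM => //.
  by apply: measurableT_comp => //; exact: measurable_partial.
have coarea i : (\int[leb]_(x in D) (`|partial i theta x| * h x)%:E <=
    (coarea_cst R n * (c * b `^ g) * b / ball_lb R n)%:E)%E.
  rewrite EFinM lee_pdivlMr// muleC.
  apply: (@le_trans _ _ (coarea_cst R n * (c * b `^ g) * (t0 + b - (t0 + a)))%:E); last first.
    by rewrite lee_fin ler_wpM2l ?mulr_ge0 ?(ltW C0) ?powR_ge0//; lra.
  apply: (coarea_le i tL (mpow _) h0 mD (M0 := M0)) => //.
  - by move=> x [/OM].
  - by move=> x [_]; rewrite /= in_itv.
  - by rewrite lerD2l.
  apply: aeS Ac => t At /andP[tb ta].
  have {}At : (level_integral theta h Omega t <= (c * (t - t0) `^ g)%:E)%E.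
    by apply: At; apply/andP; split; lra.
  apply: (le_trans (le_level_integral tL (mpow _) h0 t mD mO _)); first exact: subIsetl.
  apply: (le_trans At); rewrite lee_fin ler_wpM2l// ge0_ler_powR ?nnegrE//; lra.
apply: (@le_trans _ _ (\int[leb]_(x in D) \sum_(i < n.+1) (`|partial i theta x| * h x)%:E)%E).
  apply: ge0_le_integral => //.
  - by move=> x _; rewrite lee_fin powR_ge0.
  - by apply/measurable_EFinP; exact: measurable_funTS.
  - exact: emeasurable_sum.
  move=> x _; rewrite sumEFin lee_fin -mulr_suml.
  rewrite -(mulr_powRB1 (enorm_ge0 _))//; last by rewrite (lt_trans _ p1).
  rewrite ler_wpM2r// (le_trans (enorm_le_sum _))//.
  by apply: ler_sum => i _; rewrite mxE.
rewrite ge0_integral_sum//; last by move=> i x _; rewrite lee_fin mulr_ge0.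
apply: (@le_trans _ _ (\sum_(i < n.+1) (coarea_cst R n * (c * b `^ g) * b / ball_lb R n)%:E)%E).
  by apply: lee_sum => i _; exact: coarea.
rewrite sumEFin lee_fin sumr_const card_ord -[leLHS]mulr_natl le_eqVlt; apply/orP; left.
by apply/eqP; ring.
Qed.

Local Notation d1 := (delta / 2).
Let d10 : 0 < d1. Proof. by rewrite divr_gt0. Qed.

Lemma profile_energy_le N : (0 < N)%N ->
  (dirichlet_energy p Omega (gradient (log_profile t0 d1 N \o theta)) <=
   ((n.+1%:R * coarea_cst R n * c / ball_lb R n * 8 `^ (g + 1) * d1 `^ (g + 1 - p)) *
    (N%:R * log_height R N `^ (- p)))%:E)%E.
Proof.
move=> N0; set u := _ \o theta.
pose a k := shell_radius d1 k.
have a0 k : 0 < a k by exact: shell_radius_gt0.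
have Lam0 : 0 < log_height R N by exact: log_height_gt0.
pose I k := theta @^-1` `]t0 + a k, t0 + 8 * a k[%classic.
have mI k : measurable (I k).
  have mJ : measurable (`]t0 + a k, t0 + 8 * a k[ : set (measurableTypeR R)) by exact: measurable_itv.
  by rewrite -[X in measurable X]setTI; exact: mt.
pose w k := (a k * log_height R N)^-1 `^ p.
have w0 k : 0 <= w k by exact: powR_ge0.
pose F x := (enorm (gradient theta x) `^ p)%:E.
have F0 x : (0 <= F x)%E by rewrite lee_fin powR_ge0.
have shells : (dirichlet_energy p Omega (gradient u) <=
    \sum_(k < N) (w k)%:E * \int[leb]_(x in Omega `&` I k) F x)%E.
  apply: integral_shells => //.
  - by apply/measurable_EFinP.
  - by move=> x _; rewrite lee_fin powR_ge0.
  have : {ae leb, forall x, forall i, derivable theta x (delta_mx ord0 i)}.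
    (* Countable intersections of full sets are indexed by [nat]; [inord] reaches every axis. *)
    suff : {ae leb, forall x, forall k, derivable theta x (delta_mx ord0 (inord k))}.
      by apply: aeS => x dx i; rewrite -(inord_val i); exact: dx.
    by apply/ae_foralln => k; exact: lip_ae_derivable L0 tL.
  apply: aeS => x dx Ox.
  have F_0 k : (0 <= (F \_ (I k)) x)%E by apply: erestrict_ge0.
  have [D0|[k kN [tk Dk]]] := @log_profile_comparison R _ t0 d1 N theta x d10 N0 (ct (x := x)).
    suff -> : gradient u x = 0.
      by rewrite enorm0 powR0 ?gt_eqF ?(lt_trans _ p1)//; apply: sume_ge0 => k _; rewrite mule_ge0 ?lee_fin.
    by apply/rowP => i; rewrite !mxE /partial D0.
  rewrite (bigD1 (Ordinal kN))//= -[leLHS]adde0 leeD//; last first.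
    by apply: sume_ge0 => j _; rewrite mule_ge0 ?lee_fin.
  rewrite patchE mem_set; last by rewrite /I /= in_itv.
  have ai : 0 <= (a k * log_height R N)^-1 by rewrite invr_ge0 mulr_ge0// ltW.
  rewrite -EFinM lee_fin /w -powRM ?enorm_ge0//.
  have pp : 0 <= p by rewrite ltW// (lt_trans _ p1).
  apply: ge0_ler_powR; rewrite ?nnegrE ?enorm_ge0 ?mulr_ge0 ?enorm_ge0//.
  by apply: enorm_comparison => // i; rewrite !mxE; exact: Dk.
apply: (le_trans shells).
have shell := @shell_sum R d1 N d10 N0 p g _ p1 pg cst0.
rewrite -lee_fin in shell; apply: le_trans shell.
rewrite -sumEFin; apply: lee_sum => k _; rewrite EFinM.
apply: lee_wpmul2l; first by rewrite lee_fin.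
rewrite -[leRHS](_ : (n.+1%:R * coarea_cst R n * c / ball_lb R n * ((8 * a k) `^ g * (8 * a k)))%:E = _)%E.
  apply: shell_energy_le; rewrite ?(ltW (a0 _))//.
    by move: (a0 k); lra.
  by have := shell_radius_le d10 k; rewrite -/(a k); lra.
by rewrite !mulrA.
Qed.

(** The competitor is bounded and Lipschitz, hence Sobolev on the bounded set [Omega]. Being
    continuous, it is its own quasicontinuous representative, and the two inequalities hold with
    empty exceptional sets. *)
Lemma profile_admissible N : (0 < N)%N ->
  condenser_admissible p Omega (sublevel Omega theta t0) (superlevel Omega theta (t0 + delta))
    (log_profile t0 d1 N \o theta) (gradient (log_profile t0 d1 N \o theta)).
Proof.
move=> N0; set u := _ \o theta.
have K0 : 0 <= (log_inner d1 N * log_height R N)^-1.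
  by rewrite invr_ge0 mulr_ge0// ltW ?log_inner_gt0 ?log_height_gt0.
have uL : lip _ u := lip_comp K0 (@log_profile_lip R t0 d1 N d10 N0) tL.
have KL0 := mulr_ge0 K0 L0.
have cu := lip_continuous uL.
have u1 x : `|u x| <= 1.
  by have /andP[v0 v1] := @log_profile_itv R t0 d1 N d10 N0 (theta x); rewrite ger0_norm.
have pp : 0 < p by rewrite (lt_trans _ p1).
have Ooo := bounded_lebesgue_rV_lty mO OM.
have cap0 : sobolev_capacity p set0 = 0%E :> \bar R := @sobolev_capacity0 R n.+1 p pp.
split.
  split.
  - apply: (bounded_Lp_on (B := 1)) => //; first exact: ltW.
    by apply: measurable_funTS; exact: rV_continuous_measurable.
  - move=> i; apply: (bounded_Lp_on (B := (log_inner d1 N * log_height R N)^-1 * L)) => //.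
    + exact: ltW.
    + under eq_fun do rewrite mxE.
      by apply: measurable_funTS; exact: measurable_partial.
    + by move=> x; rewrite mxE; exact: lip_partial_le.
  - exact: (lip_weak_gradient oO KL0 uL ler01 u1).
exists u; split.
- move=> e e0; exists set0; split; first exact: open0.
    by rewrite cap0 lte_fin.
  by apply: continuous_subspaceT.
- exact: aeW.
- rewrite /quasi_everywhere [X in sobolev_capacity _ X](_ : _ = set0)//.
  apply/seteqP; split => // x [[_ tx] /=]; apply.
  by rewrite /u /= log_profile_eq0// ltW// (le_lt_trans _ (log_inner_gt0 _ d10))// subr_le0.
- rewrite /quasi_everywhere [X in sobolev_capacity _ X](_ : _ = set0)//.
  apply/seteqP; split => // x [[_ tx] /=]; apply.
  by rewrite /u /= log_profile_eq1//; move: tx delta0; lra.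
Qed.

Lemma condenser_capacity_eq0 :
  condenser_capacity p Omega (sublevel Omega theta t0) (superlevel Omega theta (t0 + delta)) = 0%E.
Proof.
apply: (@log_decay_eq0 R _ (n.+1%:R * coarea_cst R n * c / ball_lb R n *
    8 `^ (g + 1) * d1 `^ (g + 1 - p)) p) => //.
- by rewrite mulr_ge0 ?powR_ge0// mulr_ge0 ?powR_ge0.
- apply: le_ereal_inf_tmp => _ [ug _ <-]; apply: integral_ge0 => x _.
  by rewrite lee_fin powR_ge0.
move=> N N0; apply: le_trans (profile_energy_le N0).
apply: ereal_inf_lbound.
by exists (log_profile t0 d1 N \o theta, gradient (log_profile t0 d1 N \o theta)) => //=;
  exact: profile_admissible.
Qed.

End level_energy.

Lemma energy_weight_ge0 (R : realType) (n : nat) (p : R) (Omega : set 'rV[R]_n)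
    (theta : 'rV[R]_n -> R) t : (0 <= energy_weight p Omega theta t)%E.
Proof. by apply: integral_ge0 => x _; rewrite lee_fin powR_ge0. Qed.

(** Since [Omega] is open, the two functions agree near each of its points, so their gradients agree
    there. This transfers the weight bounds to the Lipschitz extension. *)
Lemma eq_energy_weight (R : realType) (n : nat) (p : R) (Omega : set 'rV[R]_n.+1)
    (theta eta : 'rV[R]_n.+1 -> R) t : open Omega -> (forall x, Omega x -> eta x = theta x) ->
  energy_weight p Omega theta t =
  level_integral eta (fun x => enorm (gradient eta x) `^ (p - 1)) Omega t.
Proof.
move=> oO et; rewrite /energy_weight /level_integral.
have -> : level Omega theta t = Omega `&` eta @^-1` [set t].
  by apply/seteqP; split => x [Ox /=]; [rewrite -et | rewrite et].
apply: eq_integral => x; rewrite inE => -[Ox _]; congr ((enorm _ `^ _)%:E).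
apply/rowP => i; rewrite !mxE; apply: near_eq_derive.
by move: (oO); rewrite openE => /(_ x Ox); apply: filterS => y /et.
Qed.

Theorem lemma5p8 (R : realType) (n : nat) (n_gt0 : (0 < n)%N)
    (Omega : set 'rV[R]_n) (p : R) (theta : 'rV[R]_n -> R)
    (t0 delta0 c1 c2 alpha nu : R)
    (Omega_open : open Omega) (Omega_bounded : bounded_set Omega)
    (p_gt1 : 1 < p)
    (theta_lipschitz : [lipschitz theta x | x in closure Omega])
    (delta0_gt0 : 0 < delta0) (c1_gt0 : 0 < c1) (c2_gt0 : 0 < c2)
    (alpha_range : 0 <= alpha < 1) (nu_ge0 : 0 <= nu)
    (weight_bounds : {ae @lebesgue_measure R, forall t : R,
       t0 < t < t0 + delta0 ->
       ((c1 * (t - t0) `^ (alpha * (p - 1) + nu))%:E <=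
          energy_weight p Omega theta t)%E /\
       (energy_weight p Omega theta t <=
          (c2 * (t - t0) `^ (alpha * (p - 1) + nu))%:E)%E})
    (critical : 1 <= alpha + nu / (p - 1)) :
  forall delta : R, 0 < delta < delta0 ->
    weighted_capacity p (energy_weight p Omega theta) t0 (t0 + delta) = 0%E /\
    (interior_condenser Omega (sublevel Omega theta t0)
       (superlevel Omega theta (t0 + delta)) ->
     condenser_capacity p Omega (sublevel Omega theta t0)
       (superlevel Omega theta (t0 + delta)) = 0%E).
Proof.
(* A positive dimension is written as a successor so that one coordinate can be split off. *)
case: n n_gt0 Omega theta Omega_open Omega_bounded theta_lipschitz weight_bounds => // n _.
move=> Omega theta oO [B [_ OB]] [K [_ thetaK]] bounds delta /andP[d0 dd].
set g := alpha * (p - 1) + nu in bounds *.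
have pg : p - 1 <= g.
  have p10 : 0 < p - 1 by rewrite subr_gt0.
  rewrite -[leLHS]mul1r (le_trans (ler_wpM2r (ltW p10) critical))//.
  by rewrite mulrDl divfK ?gt_eqF.
have Ac : {ae @lebesgue_measure R, forall t, t0 < t < t0 + delta ->
    (energy_weight p Omega theta t <= (c2 * (t - t0) `^ g)%:E)%E}.
  by apply: aeS bounds => t bt tt; apply: (bt _).2; move: tt; lra.
split; first exact: weighted_capacity_eq0 d0 pg (ltW c2_gt0) (@energy_weight_ge0 _ _ _ _ _) Ac.
move=> _.
have OM x : Omega x -> `|x| <= B + 1 by apply: OB; rewrite ltrDl.
(* The Lipschitz hypothesis provides a threshold [K], possibly negative, every number above which is
   a Lipschitz constant. *)
pose L := Num.max 0 (K + 1).
have L0 : 0 <= L by rewrite le_max lexx.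
have thetaL x y : closure Omega x -> closure Omega y -> `|theta x - theta y| <= L * `|x - y|.
  move=> Ox Oy; have KL : K < L by rewrite lt_max ltrDl ltr01 orbT.
  exact: (thetaK L KL (x, y)).
have [eta [etaL eta_theta]] := lipschitz_extension L0 thetaL.
have et x : Omega x -> eta x = theta x by move=> Ox; apply: eta_theta; exact: subset_closure.
have -> : sublevel Omega theta t0 = sublevel Omega eta t0.
  by apply/seteqP; split => x [Ox /=]; [rewrite -et | rewrite et].
have -> : superlevel Omega theta (t0 + delta) = superlevel Omega eta (t0 + delta).
  by apply/seteqP; split => x [Ox /=]; [rewrite -et | rewrite et].
apply: (condenser_capacity_eq0 oO OM L0 etaL p_gt1 d0 pg (ltW c2_gt0)).
by apply: aeS Ac => t; rewrite (eq_energy_weight p t oO et).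
Qed.
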